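(* Let $X$ be a Banach space without the Radon-Nikodým property, let $(\mathcal F_n)_{n\ge0}$ be an interval filtration on $[0,1]$, let $V\subset[0,1]$ be the set of all accumulation points of $\bigcup_n\Delta_n$, where $\Delta_n$ is the set of all endpoints of atoms of $\mathcal F_n$, and let $k$ be a positive integer. Then there exists a number $\delta>0$ such that for all $\eta\in(0,1)$ there exist an increasing sequence of positive integers $(m_j)_{j\ge0}$, an $L^\infty_X$-bounded $X$-valued $k$-martingale spline sequence $(f_j)_{j\ge0}$ adapted to $(\mathcal F_{m_j})_{j\ge0}$ with $f_j\in S_{m_j}^{(k)}\otimes X$ for all $j$, and a sequence $(E_n)_{n\ge1}$ of measurable sets $E_n\subset V$ with $|E_n|\ge(1-2^{-n}\eta)|V|$, such that for all $n\ge1$ $$\|f_n(t)-f_{n-1}(t)\|_X\ge\delta,\qquad t\in E_n.$$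
   Context: $|\cdot|$ denotes Lebesgue measure on $[0,1]$. For a measure space $(\Omega,\mathcal A,\mu)$ and a Banach space $X$, $L^p_X$ denotes the Bochner-Lebesgue space of $p$-integrable (essentially bounded if $p=\infty$) Bochner measurable functions $\Omega\to X$; $L^p$ and $L^p_X$ are taken over $[0,1]$ with Lebesgue measure unless indicated otherwise. Radon-Nikodým property. A vector measure is a $\sigma$-additive map $\nu:\mathcal A\to X$ on a $\sigma$-algebra $\mathcal A$ of subsets of a set $\Omega$. Its variation is $|\nu|(E)=\sup_\pi\sum_{A\in\pi}\|\nu(A)\|_X$, the supremum being over all partitions $\pi$ of $E$ into finitely many pairwise disjoint members of $\mathcal A$; $\nu$ is of bounded variation if $|\nu|(\Omega)<\infty$. For a measure $\mu:\mathcal A\to[0,\infty)$, $\nu$ is $\mu$-continuous if $\lim_{\mu(E)\to0}\nu(E)=0$. $X$ has the Radon-Nikodým property (RNP) if for every measurable space $(\Omega,\mathcal A)$, every such measure $\mu$ on it and every $\mu$-continuous vector measure $\nu:\mathcal A\to X$ of bounded variation there is $f\in L^1_X(\Omega,\mathcal A,\mu)$ with $\nu(A)=\int_A f\,d\mu$ for all $A\in\mathcal A$. Interval filtration. A sequence $(\mathcal F_n)_{n\ge0}$ of $\sigma$-algebras on $[0,1]$ is an interval filtration if it is increasing and each $\mathcal F_n$ is generated by a finite partition of $[0,1]$ into intervals of positive Lebesgue measure (the atoms of $\mathcal F_n$). Splines. For a positive integer $k$, $S_n^{(k)}$ is the space of all real-valued $f\in C^{k-2}[0,1]$ that are a polynomial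 of order $k$ (i.e. of degree at most $k-1$) on each atom of $\mathcal F_n$; for $k=1$ there is no continuity requirement. For $x\in X$, $(f\otimes x)(t)=f(t)x$, and $S_n^{(k)}\otimes X=\operatorname{span}\{f\otimes x: f\in S_n^{(k)},x\in X\}$. $P_n^{(k)}$ is the orthogonal projection of $L^2[0,1]$ onto $S_n^{(k)}$, extended to $L^1$ and to $L^1_X$ so that $P_n^{(k)}(f\otimes x)=(P_n^{(k)}f)\otimes x$ for $f\in L^1$, $x\in X$. $k$-martingale spline sequence. A sequence $(f_n)_{n\ge0}$ in $L^1_X$ is an $X$-valued $k$-martingale spline sequence adapted to an interval filtration $(\mathcal F_n)$ if $P_n^{(k)}f_{n+1}=f_n$ for all $n\ge0$. In particular, $(f_j)$ adapted to $(\mathcal F_{m_j})$ means $P_{m_j}^{(k)}f_{j+1}=f_j$ for all $j\ge0$. *)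

(* Defs.v *)
From HB Require Import structures.
From mathcomp Require Import all_boot all_order all_algebra.
From mathcomp Require Import all_classical all_reals all_analysis.

Set Implicit Arguments.
Unset Strict Implicit.
Unset Printing Implicit Defensive.

Import Order.TTheory GRing.Theory Num.Theory.
Import numFieldNormedType.Exports.

Local Open Scope classical_set_scope.
Local Open Scope ring_scope.

Definition bochner_simple (d : measure_display) (T : measurableType d)
    (X : Type) (s : T -> X) : Prop :=
  finite_set (range s) /\ forall x : X, measurable (s @^-1` [set x]).

Definition bochner_measurable (d : measure_display) (T : measurableType d)
    (R : realType) (mu : {measure set T -> \bar R}) (D : set T)
    (X : normedModType R) (f : T -> X) : Prop :=
  exists s : nat -> T -> X, (forall n, bochner_simple (s n)) /\
    {ae mu, forall t, D t -> s n t @[n --> \oo] --> f t}.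

(* A Bochner measurable function is only almost everywhere equal to one with
   measurable norm; [\int] of a nonnegative function is a lower integral, so its
   value is that of any almost everywhere equal measurable function. *)
Definition L1X (d : measure_display) (T : measurableType d)
    (R : realType) (mu : {measure set T -> \bar R}) (D : set T)
    (X : normedModType R) : set (T -> X) :=
  [set f | bochner_measurable mu D f /\
           (\int[mu]_(t in D) (`|f t|)%:E < +oo)%E].

Definition simple_integral (d : measure_display) (T : measurableType d)
    (R : realType) (mu : {measure set T -> \bar R}) (D : set T)
    (X : normedModType R) (s : T -> X) : X :=
  \sum_(x \in range s) fine (mu (D `&` s @^-1` [set x])) *: x.

Definition bochner_integral (d : measure_display) (T : measurableType d)
    (R : realType) (mu : {measure set T -> \bar R}) (D : set T)
    (X : normedModType R) (f : T -> X) (v : X) : Prop :=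
  bochner_measurable mu D f /\
  exists s : nat -> T -> X,
    [/\ forall n, bochner_simple (s n) /\
                  (\int[mu]_(t in D) (`|s n t|)%:E < +oo)%E,
        (\int[mu]_(t in D) (`|f t - s n t|)%:E)%E @[n --> \oo] --> 0%E
      & simple_integral mu D (s n) @[n --> \oo] --> v].

(* A vector measure is a function on all of [set T] of which only the values
   on measurable sets matter. *)
Definition vector_measure (d : measure_display) (T : measurableType d)
    (R : realType) (X : normedModType R) (nu : set T -> X) : Prop :=
  forall A : nat -> set T, (forall i, measurable (A i)) -> trivIset setT A ->
    (\sum_(0 <= i < n) nu (A i)) @[n --> \oo] --> nu (\bigcup_i A i).

Definition vvariation (d : measure_display) (T : measurableType d)
    (R : realType) (X : normedModType R) (nu : set T -> X) (E : set T) :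
    \bar R :=
  ereal_sup [set (\sum_(A \in P) `|nu A|)%:E | P in
    [set P : set (set T) |
       [/\ finite_set P, P `<=` measurable & partition P id E]]].

Definition bounded_vvariation (d : measure_display) (T : measurableType d)
    (R : realType) (X : normedModType R) (nu : set T -> X) : Prop :=
  (vvariation nu setT < +oo)%E.

Definition measure_continuous (d : measure_display) (T : measurableType d)
    (R : realType) (mu : {measure set T -> \bar R})
    (X : normedModType R) (nu : set T -> X) : Prop :=
  forall e : R, 0 < e -> exists2 r : R, 0 < r &
    forall E, measurable E -> (mu E < r%:E)%E -> `|nu E| < e.

Definition RNP (R : realType) (X : completeNormedModType R) : Prop :=
  forall (d : measure_display) (T : measurableType d)
    (mu : {finite_measure set T -> \bar R}) (nu : set T -> X),
    vector_measure nu -> bounded_vvariation nu -> measure_continuous mu nu ->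
    exists f : T -> X, L1X mu setT f /\
      forall A, measurable A -> bochner_integral mu A f (nu A).

(* From here on, functions on [0,1] are represented by functions on [R] whose
   values outside [0,1] are irrelevant. *)

Definition I01 (R : realType) : set R := `[0, 1].

Definition atom (T : Type) (G : set (set T)) (A : set T) : Prop :=
  [/\ G A, A !=set0 & forall B, G B -> B `<=` A -> B = set0 \/ B = A].

Definition interval_filtration (R : realType) (F : nat -> set (set R)) :
    Prop :=
  (forall n, F n `<=` F n.+1) /\
  (forall n, exists P : set (set R),
    [/\ finite_set P, partition P id (@I01 R),
        forall A, P A -> is_interval A /\ (0 < lebesgue_measure A)%E
      & F n = <<s @I01 R, P >>]).

Definition endpoints (R : realType) (G : set (set R)) : set R :=
  [set t | exists2 A, atom G A & t = inf A \/ t = sup A].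

Definition accumulation_set (R : realType) (F : nat -> set (set R)) : set R :=
  limit_point (\bigcup_n endpoints (F n)).

(* Derivatives at 0 and 1 are one-sided. *)
Definition has_derivative01 (R : realType) (f g : R -> R) : Prop :=
  forall t, I01 t ->
    (f s - f t) / (s - t) @[s --> within [set s | I01 s /\ s != t] (nbhs t)]
      --> g t.

Fixpoint C01 (R : realType) (m : nat) (f : R -> R) : Prop :=
  if m is m'.+1 then exists2 g, has_derivative01 f g & C01 m' g
  else {within @I01 R, continuous f}.

Definition spline (R : realType) (G : set (set R)) (k : nat) : set (R -> R) :=
  [set f | ((2 <= k)%N -> C01 (k - 2) f) /\
    forall A, atom G A -> exists2 p : {poly R}, (size p <= k)%N &
      forall t, A t -> f t = p.[t]].

Definition tensor (R : realType) (X : normedModType R) (f : R -> R) (x : X) :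
    R -> X :=
  fun t => f t *: x.

Definition spline_tensor (R : realType) (X : normedModType R)
    (G : set (set R)) (k : nat) : set (R -> X) :=
  [set g | exists (N : nat) (f : 'I_N -> R -> R) (x : 'I_N -> X),
    (forall i, spline G k (f i)) /\
    forall t, I01 t -> g t = \sum_(i < N) tensor (f i) (x i) t].

Definition L1R (R : realType) : set (R -> R) :=
  [set f : R -> R | lebesgue_measure.-integrable (@I01 R) (EFin \o f)].

Definition L2R (R : realType) : set (R -> R) :=
  [set f : R -> R | measurable_fun (@I01 R) f /\
    lebesgue_measure.-integrable (@I01 R) (fun t => (f t ^+ 2)%:E)].

Definition L1X01 (R : realType) (X : normedModType R) : set (R -> X) :=
  @L1X _ _ R lebesgue_measure (@I01 R) X.

Definition orthogonal_projection (R : realType) (S : set (R -> R))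
    (f g : R -> R) : Prop :=
  S g /\ forall h, S h ->
    \int[lebesgue_measure]_(t in @I01 R) ((f t - g t) * h t) = 0.

(* [T] acts on representatives; the bound implies that it is compatible with
   almost everywhere equality. *)
Definition bounded_linear_L1 (R : realType) (X : normedModType R)
    (L1 : set (R -> X)) (T : (R -> X) -> R -> X) : Prop :=
  [/\ forall f, L1 f -> L1 (T f),
      forall (a : R) f g, L1 f -> L1 g ->
        ae_eq lebesgue_measure (@I01 R)
          (T (fun t => a *: f t + g t)) (fun t => a *: T f t + T g t)
    & exists C : R, forall f, L1 f ->
        (\int[lebesgue_measure]_(t in @I01 R) (`|T f t|)%:E <=
         C%:E * \int[lebesgue_measure]_(t in @I01 R) (`|f t|)%:E)%E].

(* The projection on scalar L^1: the continuous extension of the orthogonal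
   projection of L^2 onto the splines. Its values on L^2 are the canonical
   representatives, i.e. genuine splines. *)
Definition is_spline_projection (R : realType) (G : set (set R)) (k : nat)
    (P : (R -> R) -> R -> R) : Prop :=
  bounded_linear_L1 (X := R^o) (@L1R R) P /\
  forall f, L2R f -> orthogonal_projection (spline G k) f (P f).

(* By density of the simple functions, such an operator [PX] is unique up to
   almost everywhere equality. *)
Definition is_spline_projectionX (R : realType) (X : normedModType R)
    (G : set (set R)) (k : nat) (PX : (R -> X) -> R -> X) : Prop :=
  bounded_linear_L1 (@L1X01 R X) PX /\
  exists2 P, is_spline_projection G k P &
    forall f (x : X), L1R f ->
      ae_eq lebesgue_measure (@I01 R) (PX (tensor f x)) (tensor (P f) x).

(* The projection operator exists and is almost everywhere unique, so that
   quantifying it existentially amounts to speaking of the projection. *)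
Definition martingale_spline_sequence (R : realType) (X : normedModType R)
    (F : nat -> set (set R)) (k : nat) (f : nat -> R -> X) : Prop :=
  (forall n, L1X01 (f n)) /\
  forall n, exists2 PX, is_spline_projectionX (F n) k PX &
    ae_eq lebesgue_measure (@I01 R) (PX (f n.+1)) (f n).

Definition LinftyX_bounded (R : realType) (X : normedModType R)
    (f : nat -> R -> X) : Prop :=
  (forall n, bochner_measurable lebesgue_measure (@I01 R) (f n)) /\
  exists M : R, forall n,
    {ae lebesgue_measure, forall t, I01 t -> `|f n t| <= M}.

(* Main.v *)
(* If a vector measure nu has no density, then the averages nu(A)/mu(A) over the
   subsets A of a suitable set have a bounded convex hull D in which every point u
   is a limit of convex combinations of points of D at distance at least delta
   from u: otherwise repeated subdivision into pieces with nearly constant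
   averages produces a density.
   Given a spline f_n with values near D, cut [0,1] into short cells on which f_n
   is nearly a constant u, with u near some such convex combination of points
   y_l. Infinitely many knots of the filtration lie in every interval that meets
   the accumulation set V in positive measure, so for large m there are splines
   for F_m that are almost indicator functions of subintervals. Adding (y_l - u)
   times such a bump on the l-th part of the cell, the parts being proportioned
   with respect to |V n .|, moves f_n by at least delta on almost all of V. The
   inner products of the perturbation with the splines for F_(m_n) are small,
   because its weighted vectors nearly cancel in each cell, so subtracting its
   projection costs little and makes the sequence a martingale. *)
Require Import Defs.
From HB Require Import structures.
From mathcomp Require Import all_boot all_order all_algebra.
From mathcomp Require Import finmap.
From mathcomp Require Import all_classical all_reals all_analysis.
From mathcomp Require Import measurable_realfun.
From mathcomp Require Import ring lra zify.
Set Implicit Arguments.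
Unset Strict Implicit.
Unset Printing Implicit Defensive.
Import Order.TTheory GRing.Theory Num.Theory.
Import numFieldNormedType.Exports.
Local Open Scope classical_set_scope.
Local Open Scope ring_scope.

(** The obstacle is that V may have positive measure but empty interior. Bumps are integrated
    against Lebesgue measure while the parts of a cell are proportioned by |V n .|, so the
    cancellation in a cell fails by about |cell \ V|. Cells in which V is null are therefore left
    alone, and all others lie in a neighborhood U of V with |U \ V| as small as desired; the
    failures then add up to a multiple of |U \ V|. No bound on the spline projections that is
    uniform in the filtration is needed. An orthonormal basis of the splines for F_(m_n), with its
    dimension, sup norm and Lipschitz constants, is fixed before U, the cell length and the bumps,
    so the correction can be made as small as desired. Convexity of D serves the flanks of the
    bumps, where the new value is near a y_l + (1 - a) u with a between 0 and 1. The distance of f_n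
    to D may grow with n but stays below 1, which bounds the sequence. Half of the spread of D is
    reserved to pay for the correction, so the theorem gets half of the constant of
    nondentability. *)

Definition rmu {d : measure_display} {T : measurableType d} {R : realType}
  (mu : set T -> \bar R) (A : set T) : R := fine (mu A).

(** * Finite measures with real values, and exhaustion *)

Section finite_measure_real.
Context (d : measure_display) (T : measurableType d) (R : realType).
Variable mu : {finite_measure set T -> \bar R}.
Implicit Types A B : set T.
Local Notation m := (rmu mu).

Lemma rmuE A : measurable A -> mu A = (m A)%:E.
Proof. by move=> mA; rewrite /rmu fineK// fin_num_measure. Qed.

Lemma rmu0 : m set0 = 0.
Proof. by rewrite /rmu measure0. Qed.

Lemma rmu_ge0 A : 0 <= m A.
Proof. exact/fine_ge0/measure_ge0. Qed.

Lemma rmu_le A B : measurable A -> measurable B -> A `<=` B -> m A <= m B.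
Proof.
move=> mA mB AB; rewrite -lee_fin -!rmuE//.
by apply: le_measure => //; rewrite inE.
Qed.

Lemma rmuU A B : measurable A -> measurable B -> A `&` B = set0 ->
  m (A `|` B) = m A + m B.
Proof.
move=> mA mB AB; apply: EFin_inj.
rewrite -rmuE ?EFinD -?rmuE//; last exact: measurableU.
exact: measureU.
Qed.

Lemma rmuD A B : measurable A -> measurable B -> m (A `\` B) = m A - m (A `&` B).
Proof.
move=> mA mB; have := @rmuU (A `\` B) (A `&` B).
have -> : (A `\` B) `|` (A `&` B) = A.
  rewrite eqEsubset; split => x; first by case=> -[].
  by move=> Ax; have [?|?] := pselect (B x); [right|left].
move=> ->; first by rewrite addrK.
- exact: measurableD.
- exact: measurableI.
- by rewrite eqEsubset; split => // x [[_ nB] [_ /nB]].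
Qed.

Lemma rmu_bigsetU (F : nat -> set T) n : (forall i, measurable (F i)) ->
  trivIset setT F -> m (\big[setU/set0]_(i < n) F i) = \sum_(i < n) m (F i).
Proof.
move=> mF tF; rewrite /rmu measure_bigsetU//.
rewrite (eq_bigr (fun i : 'I_n => (m (F i))%:E)) ?sumEFin// => i _.
exact: rmuE.
Qed.

Lemma rmu_bigcup (F : nat -> set T) : (forall i, measurable (F i)) ->
  trivIset setT F -> \sum_(0 <= i < n) m (F i) @[n --> \oo] --> m (\bigcup_i F i).
Proof.
move=> mF tF.
have mU : measurable (\bigcup_i F i) by exact: bigcup_measurable.
have : (\sum_(0 <= i < n) mu (F i))%E @[n --> \oo] --> (m (\bigcup_i F i))%:E.
  by rewrite -rmuE//; exact: measure_sigma_additive.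
move=> /fine_cvgP[_]; apply: cvg_trans.
apply: near_eq_cvg; near=> n => /=.
rewrite (eq_bigr (fun i => (m (F i))%:E)) ?sumEFin// => i _.
exact: rmuE.
Unshelve. all: by end_near. Qed.

(** Continuity from above, obtained by subtracting from [m E] the partial sums of the measures of
    the traces of [F] on [E]. *)
Lemma rmu_tail (F : nat -> set T) E : (forall i, measurable (F i)) ->
  trivIset setT F -> measurable E -> rmu mu (E `\` \bigcup_i F i) = 0 ->
  m (E `\` \big[setU/set0]_(i < n) F i) @[n --> \oo] --> (0 : R).
Proof.
move=> mF tF mE E0.
have mU : measurable (\bigcup_i F i) by exact: bigcup_measurable.
have mb n : measurable (\big[setU/set0]_(i < n) F i) by exact: bigsetU_measurable.
pose F' := fun i => E `&` F i.
have mF' i : measurable (F' i) by exact: measurableI.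
have tF' : trivIset setT F' by apply: trivIset_setIl.
have h n : m (E `\` \big[setU/set0]_(i < n) F i) = m E - \sum_(0 <= i < n) m (F' i).
  rewrite rmuD// big_mkord -rmu_bigsetU//; congr (_ - m _).
  by rewrite big_distrr.
rewrite (_ : (fun _ => _) = (fun n => m E - \sum_(0 <= i < n) m (F' i))); last exact/funext.
have hz : m E - m (\bigcup_i F' i) = 0 by rewrite -setI_bigcupr -rmuD.
rewrite -[X in _ --> X]hz; apply: cvgB; first exact: cvg_cst.
exact: rmu_bigcup.
Qed.

End finite_measure_real.

(* Greedy choice: at each stage take a piece of at least half the largest
   measure available, so that nothing of positive measure survives. *)
Lemma exhaustion (d : measure_display) (T : measurableType d) (R : realType)
    (mu : {finite_measure set T -> \bar R}) (Q : set (set T)) (E : set T) :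
  measurable E ->
  (forall A, measurable A -> A `<=` E -> 0 < rmu mu A ->
    exists B, [/\ measurable B, B `<=` A, 0 < rmu mu B & Q B]) ->
  exists G : nat -> set T, [/\ forall i, measurable (G i),
    forall i, G i `<=` E, trivIset setT G,
    forall i, G i = set0 \/ (0 < rmu mu (G i) /\ Q (G i))
    & rmu mu (E `\` \bigcup_i G i) = 0].
Proof.
move=> mE hQ.
pose cand A := [set B | [/\ measurable B, B `<=` A, 0 < rmu mu B & Q B]].
have /choice[g hg] : forall A : set T, exists B, measurable A -> A `<=` E ->
    [/\ measurable B, B `<=` A, B = set0 \/ (0 < rmu mu B /\ Q B)
      & forall C, cand A C -> rmu mu C <= 2 * rmu mu B].
  move=> A; have [mA|] := pselect (measurable A); last by exists set0.
  have [AE|] := pselect (A `<=` E); last by exists set0.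
  have [[C0 cC0]|nC] := pselect (exists C, cand A C); last first.
    exists set0 => _ _; split => //; first by left.
    by move=> C cC; exfalso; apply: nC; exists C.
  have hs : has_sup [set rmu mu C | C in cand A].
    split; first by exists (rmu mu C0), C0.
    by exists (rmu mu A) => _ [C [mC CA _ _] <-]; exact: rmu_le.
  have s0 : 0 < sup [set rmu mu C | C in cand A].
    apply: (@lt_le_trans _ _ (rmu mu C0)); first by case: cC0.
    by apply: ub_le_sup; [exact: hs.2|exists C0].
  have [_ [B cB <-] hB] := sup_adherent (divr_gt0 s0 (ltr0n R 2)) hs.
  case: (cB) => mB BA B0 QB.
  exists B => _ _; split => //; first by right.
  move=> C cC.
  have : rmu mu C <= sup [set rmu mu C | C in cand A].
    by apply: ub_le_sup; [exact: hs.2|exists C].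
  by lra.
pose U := fix U n := if n is n'.+1 then U n' `\` g (U n') else E.
have hU n : measurable (U n) /\ U n `<=` E.
  elim: n => [|n [mU UE]] /=; first by split.
  have [mg gU _ _] := hg _ mU UE.
  by split; [exact: measurableD|move=> x [/UE]].
have hG n := hg _ (hU n).1 (hU n).2.
pose G n := g (U n).
have mG n : measurable (G n) by have [] := hG n.
have Umono i j : (i <= j)%N -> U j `<=` U i.
  move=> /subnK <-; elim: (j - i)%N => [|k IH]; first by rewrite add0n.
  by rewrite addSn => x [/IH].
have tG : trivIset setT G.
  apply: ltn_trivIset => j i ij; rewrite -subset0 => x [Gjx Gix].
  have : U i.+1 x. apply: (Umono _ _ ij). by have [_ h _ _] := hG j; exact: h.
  by case.
exists G; split => //.
- by move=> i x Gx; apply: (hU i).2; have [_ h _ _] := hG i; exact: h.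
- by move=> i; have [] := hG i.
set Z := E `\` _.
have mZ : measurable Z by apply: measurableD => //; exact: bigcup_measurable.
have ZU n : Z `<=` U n.
  elim: n => [|n IH] x Zx /=; first by case: Zx.
  split; first exact: IH.
  by move=> gx; apply: Zx.2; exists n.
apply/eqP; rewrite eq_le rmu_ge0 andbT leNgt; apply/negP => Z0.
have [B [mB BZ B0 QB]] := hQ _ mZ (@subDsetl _ _ _) Z0.
have hB n : rmu mu B <= 2 * rmu mu (G n).
  have [_ _ _] := hG n; apply; split => //.
  exact: subset_trans BZ (ZU n).
have [n hn] : exists n : nat, rmu mu E * 2 < n%:R * rmu mu B.
  exists (Num.bound (rmu mu E * 2 / rmu mu B)); rewrite -ltr_pdivrMr//.
  by apply: archi_boundP; rewrite divr_ge0 ?mulr_ge0 ?rmu_ge0.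
have : \sum_(i < n) rmu mu (G i) <= rmu mu E.
  rewrite -rmu_bigsetU//; apply: rmu_le => //; first exact: bigsetU_measurable.
  move=> x; rewrite -bigcup_mkord => -[i _ Gx].
  by apply: (hU i).2; have [_ h _ _] := hG i; exact: h.
have : \sum_(i < n) rmu mu B / 2 <= \sum_(i < n) rmu mu (G i).
  by apply: ler_sum => i _; rewrite ler_pdivrMr// mulrC; exact: hB.
rewrite sumr_const card_ord => h1 h2.
have e : (rmu mu B / 2) *+ n = n%:R * rmu mu B / 2 by rewrite -mulrA mulr_natl.
by have := le_trans h1 h2; rewrite e; lra.
Qed.

(** * Comparison of integrals of functions that need not be measurable *)

Section lower_integral.
Context (d : measure_display) (T : measurableType d) (R : realType).
Variable mu : {measure set T -> \bar R}.
Implicit Types (D : set T) (f g : T -> \bar R).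
Local Open Scope ereal_scope.

(* No measurability is needed: the integral of a nonnegative function is a
   supremum over simple functions below it. *)
Lemma ge0_le_lower_integral D f g : (forall x, D x -> 0 <= f x) ->
  (forall x, D x -> f x <= g x) ->
  \int[mu]_(x in D) f x <= \int[mu]_(x in D) g x.
Proof.
move=> f0 fg.
have g0 x : D x -> 0 <= g x by move=> Dx; exact: le_trans (f0 x Dx) (fg x Dx).
rewrite !ge0_integralE//; apply: le_ereal_sup => _ [h hf <-].
exists h => // x; apply: (le_trans (hf x)); rewrite /patch.
by case: ifPn => // /[!inE]/fg.
Qed.

(** Raising [g] to [+oo] on the exceptional null set makes the inequality hold everywhere and leaves
    the integral of the measurable [g] unchanged. Nothing is asked of the measurability of [f]. *)
Lemma ae_ge0_le_lower_integral D f g : measurable D ->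
  measurable_fun D g -> (forall x, D x -> 0 <= f x) ->
  (forall x, D x -> 0 <= g x) ->
  {ae mu, forall x, D x -> f x <= g x} ->
  \int[mu]_(x in D) f x <= \int[mu]_(x in D) g x.
Proof.
move=> mD mg f0 g0 [N [mN N0 hN]].
pose i : T -> \bar R := fun x => (\1_N x)%:E * +oo.
have mi : measurable_fun D i.
  apply: emeasurable_funM; last exact: measurable_cst.
  by apply/measurable_EFinP; exact: measurable_indic.
have i0 x : 0 <= i x by rewrite /i mule_ge0// lee_fin.
have iN x : N x -> i x = +oo by move=> Nx; rewrite /i indicE mem_set//= mul1e.
have iC x : ~ N x -> i x = 0 by move=> Nx; rewrite /i indicE memNset//= mul0e.
apply: (@le_trans _ _ (\int[mu]_(x in D) (g x + i x))).
  apply: ge0_le_lower_integral => // x Dx.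
  have [Nx|Nx] := pselect (N x).
    by rewrite (iN _ Nx) addey ?leey// gt_eqF// (lt_le_trans _ (g0 x Dx))// ltNy0.
  rewrite iC// adde0; apply: contrapT => nfg; apply: Nx; apply: hN => /= h.
  exact/nfg/h.
rewrite ge0_integralD// (_ : \int[mu]_(x in D) i x = 0) ?adde0//.
rewrite -(@integral0 _ _ _ mu D); apply: ge0_ae_eq_integral => //.
exists N; split => // x /= h; apply: contrapT => Nx; apply: h => _; exact: iC.
Qed.

End lower_integral.

(** * Simple functions and their sums against additive set functions *)

Section bochner_simple_theory.
Context (d : measure_display) (T : measurableType d).

Lemma bochner_simple_comp (Y Z : choiceType) (s : T -> Y) (g : Y -> Z) :
  bochner_simple s -> bochner_simple (g \o s).
Proof.
move=> [fs ms]; split.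
  have -> : range (g \o s) = g @` range s by rewrite image_comp.
  exact: finite_image.
move=> z; rewrite (_ : _ @^-1` _ =
  \bigcup_(y in range s `&` g @^-1` [set z]) s @^-1` [set y]).
  apply: fin_bigcup_measurable; first exact: finite_setIl.
  by move=> y _; exact: ms.
rewrite eqEsubset; split => [t /= gz|t [y [_ /= <-] /= ->]] //.
by exists (s t) => //=; split => //; exists t.
Qed.

Lemma bochner_simple_pair (Y Z : choiceType) (s : T -> Y) (s' : T -> Z) :
  bochner_simple s -> bochner_simple s' -> bochner_simple (fun t => (s t, s' t)).
Proof.
move=> [fs ms] [fs' ms']; split.
  apply: (@sub_finite_set _ _ (range s `*` range s')); last exact: finite_setX.
  by move=> _ [t _ <-]; split; exists t.
move=> [y z]; rewrite (_ : _ @^-1` _ = s @^-1` [set y] `&` s' @^-1` [set z]).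
  by apply: measurableI.
by rewrite eqEsubset; split => [t /= [-> ->]|t /= [-> ->]].
Qed.

Lemma bochner_simple_cst (Y : choiceType) (y : Y) : bochner_simple (fun _ : T => y).
Proof.
split; first by apply: (@sub_finite_set _ _ [set y]) => // _ [t _ <-].
by move=> x; rewrite preimage_cst; case: ifP => _; [exact: measurableT|exact: measurable0].
Qed.

Lemma bochner_simple_mem (A : set T) : measurable A ->
  bochner_simple (fun t => t \in A).
Proof.
move=> mA; split.
  exact: finite_finset.
move=> b; rewrite (_ : _ @^-1` _ = if b then A else ~` A).
  by case: b => //; exact: measurableC.
rewrite eqEsubset; split => t /=; case: b => //=.
- by move=> /set_mem.
- by move=> tA At; move: tA; rewrite mem_set.
- by move=> At; rewrite mem_set.
- by move=> nA; rewrite memNset.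
Qed.

End bochner_simple_theory.

Section weighted_sum.
Context (d : measure_display) (T : measurableType d) (R : realType).
Variable w : set T -> R.
Hypothesis w0 : w set0 = 0.
Hypothesis wU : forall A B, measurable A -> measurable B -> A `&` B = set0 ->
  w (A `|` B) = w A + w B.

(** Only finite additivity of [w] is assumed, so that one calculus serves both the measure of the
    trace on a fixed set, which gives [simple_integral], and the signed set functions [weight]
    below. *)
Definition wsum (X : normedModType R) (s : T -> X) : X :=
  \sum_(x \in range s) w (s @^-1` [set x]) *: x.

Lemma w_preimage_fset (Z : choiceType) (s : T -> Z) (r : seq Z) :
  bochner_simple s -> uniq r ->
  w (\bigcup_(z in [set` r]) s @^-1` [set z]) = \sum_(z <- r) w (s @^-1` [set z]).
Proof.
move=> [_ ms]; elim: r => [_|z r IH /= /andP[zr ur]].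
  by rewrite big_nil (_ : [set` [::]] = set0) ?bigcup_set0//; apply/seteqP; split.
rewrite big_cons -IH// -wU//.
- congr w; rewrite (_ : [set` z :: r] = z |` [set` r]) ?bigcup_setU1//.
  rewrite eqEsubset; split => x /=; rewrite inE; first by case/orP => [/eqP|]; [left|right].
  by case=> [->|->]; rewrite ?eqxx ?orbT.
- by apply: fin_bigcup_measurable => // z' _; exact: ms.
- rewrite eqEsubset; split => // t [/= sz [z' /= z'r z'z]].
  by move: zr; rewrite -sz z'z z'r.
Qed.

(** A fibre of [g \o s] is the disjoint union of the fibres of [s] over the points that [g] sends to
    the same value. With [s] a pair of simple functions this indexes several sums by a common
    refinement, which is how linearity is obtained. *)
Lemma wsum_comp (Z : choiceType) (X : normedModType R) (s : T -> Z) (g : Z -> X) :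
  bochner_simple s ->
  wsum (g \o s) = \sum_(z \in range s) w (s @^-1` [set z]) *: g z.
Proof.
move=> bs; have [fs ms] := bs.
have fgs : finite_set (range (g \o s)) by case: (bochner_simple_comp g bs).
rewrite /wsum !fsbig_finite//=.
transitivity (\sum_(x <- fset_set (range (g \o s)))
    \sum_(z <- fset_set (range s) | g z == x) w (s @^-1` [set z]) *: g z).
  apply: eq_bigr => x _.
  rewrite (eq_bigr (fun z => w (s @^-1` [set z]) *: x)); last by move=> z /eqP ->.
  rewrite -scaler_suml; congr (_ *: _).
  rewrite -big_filter -w_preimage_fset//; last by rewrite filter_uniq.
  congr w; rewrite eqEsubset; split => [t /= gx|t [z /=]].
    exists (s t) => //=; rewrite mem_filter gx eqxx/= in_fset_set// inE.
    by exists t.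
  by rewrite mem_filter => /andP[/eqP <- _] ->.
rewrite (exchange_big_dep xpredT)//=; apply: eq_big_seq => z.
rewrite in_fset_set// inE => -[t _ <-].
rewrite big_mkcond (bigD1_seq (g (s t)))/=; last 2 first.
- by rewrite in_fset_set// inE; exists t.
- exact: fset_uniq.
by rewrite eqxx big1 ?addr0// => x; rewrite eq_sym => /negbTE ->.
Qed.

Lemma wsumD (X : normedModType R) (s s' : T -> X) (a : R) :
  bochner_simple s -> bochner_simple s' ->
  wsum (fun t => a *: s t + s' t) = a *: wsum s + wsum s'.
Proof.
move=> bs bs'; have bp := bochner_simple_pair bs bs'.
have fp := bp.1.
have e1 := wsum_comp (fun z => a *: z.1 + z.2) bp.
have e2 := wsum_comp (fun z => z.1) bp.
have e3 := wsum_comp (fun z => z.2) bp.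
rewrite -[LHS]/(wsum ((fun z => a *: z.1 + z.2) \o (fun t => (s t, s' t)))) e1.
rewrite -[X in a *: wsum X]/(fst \o (fun t => (s t, s' t))) e2.
rewrite -[X in _ + wsum X]/(snd \o (fun t => (s t, s' t))) e3.
rewrite !fsbig_finite//= scaler_sumr -big_split/=; apply: eq_bigr => z _.
by rewrite scalerDr !scalerA mulrC.
Qed.

Lemma wsum_indic (X : normedModType R) (A : set T) (x : X) : measurable A ->
  wsum (fun t => \1_A t *: x) = w A *: x.
Proof.
move=> mA; have bA := bochner_simple_mem mA.
have := wsum_comp (fun b : bool => (b%:R : R) *: x) bA.
rewrite -[LHS]/(wsum (fun t => \1_A t *: x)) => ->.
(* If [A] is empty or the whole space, one truth value is not attained; its fibre is empty and has
   weight 0 by [w0]. *)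
rewrite (fsbig_widen _ [set true; false]) //=; last 2 first.
- by move=> b _; case: b => /=; [left|right].
- move=> b [_ nb] /=.
  have -> : (fun t => t \in A) @^-1` [set b] = set0.
    by apply/seteqP; split => // t /= tb; apply: nb; exists t.
  by rewrite w0 scale0r.
rewrite fsbigU//=; last by move=> b [-> //].
rewrite !fsbig_set1 scale0r scaler0 addr0 scale1r.
have -> // : (fun t => t \in A) @^-1` [set true] = A.
by apply/seteqP; split => t /=; [move=> /set_mem|move=> /mem_set].
Qed.

Lemma wsum0 (X : normedModType R) : wsum (fun _ : T => 0 : X) = 0.
Proof.
have := wsum_indic (0 : X) measurable0.
rewrite scaler0 (_ : (fun t => _) = (fun=> 0))//.
by apply/funext => t; rewrite scaler0.
Qed.

Lemma wsum_sum (X : normedModType R) (I : Type) (r : seq I) (c : I -> R)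
    (s : I -> T -> X) : (forall i, bochner_simple (s i)) ->
  bochner_simple (fun t => \sum_(i <- r) c i *: s i t) /\
  wsum (fun t => \sum_(i <- r) c i *: s i t) = \sum_(i <- r) c i *: wsum (s i).
Proof.
move=> bs; elim: r => [|i r [IHb IH]].
  rewrite big_nil (_ : (fun t => _) = (fun=> 0)); last first.
    by apply/funext => t; rewrite big_nil.
  by split; [exact: bochner_simple_cst|exact: wsum0].
have -> : (fun t => \sum_(j <- i :: r) c j *: s j t) =
    (fun t => c i *: s i t + \sum_(j <- r) c j *: s j t).
  by apply/funext => t; rewrite big_cons.
split; last by rewrite wsumD// IH big_cons.
exact: (bochner_simple_comp (fun z => c i *: z.1 + z.2) (bochner_simple_pair (bs i) IHb)).
Qed.

End weighted_sum.

Lemma bochner_simple_indic (d : measure_display) (T : measurableType d)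
    (R : realType) (X : normedModType R) (A : set T) (x : X) : measurable A ->
  bochner_simple (fun t => \1_A t *: x).
Proof.
move=> mA.
exact: (bochner_simple_comp (fun b : bool => (b%:R : R) *: x) (bochner_simple_mem mA)).
Qed.

(** * Nondentable sets of averages *)

Section vector_measure_theory.
Context (d : measure_display) (T : measurableType d) (R : realType).
Variable X : completeNormedModType R.
Variable mu : {finite_measure set T -> \bar R}.
Variable nu : set T -> X.
Hypothesis nuS : vector_measure nu.
Hypothesis nuV : bounded_vvariation nu.
Hypothesis nuC : measure_continuous mu nu.
Local Notation m := (rmu mu).

(** For the constant sequence of empty sets the partial sums converge, so their consecutive
    differences, all equal to [nu set0], tend to 0. *)
Lemma nu0 : nu set0 = 0.
Proof.
have := nuS (A := fun=> set0) (fun=> measurable0) (@trivIset_set0 _ _ _).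
rewrite bigcup0// => h.
have h1 := cvg_comp _ _ (@cvg_addnr 1) h.
have : (fun n => \sum_(0 <= i < n + 1) nu set0 - \sum_(0 <= i < n) nu set0)
    @ \oo --> nu set0 - nu set0 by exact: cvgB.
rewrite subrr (_ : (fun n => _) = fun=> nu set0).
  by move=> h2; apply: (cvg_unique _ (cvg_cst _) h2).
by apply/funext => n; rewrite addn1 big_nat_recr//= addrAC subrr add0r.
Qed.

Lemma nuU A B : measurable A -> measurable B -> A `&` B = set0 ->
  nu (A `|` B) = nu A + nu B.
Proof.
move=> mA mB AB.
have := nuS (A := bigcup2 A B) _ _.
rewrite bigcup2E => h.
have {}h : \sum_(0 <= i < n) nu (bigcup2 A B i) @[n --> \oo] --> nu (A `|` B).
  apply: h; last by rewrite -trivIset_bigcup2.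
  by move=> [|[|i]] //=; exact: measurable0.
have h2 : \sum_(0 <= i < n) nu (bigcup2 A B i) @[n --> \oo] --> nu A + nu B.
  apply: cvg_near_cst; near=> n.
  have -> : n = (n - 2).+2 by rewrite -addn2 subnK//; near: n; exact: nbhs_infty_ge.
  by rewrite big_nat_recl//= big_nat_recl//= big1 ?addr0// => i _; exact: nu0.
exact: cvg_unique _ h h2.
Unshelve. all: by end_near. Qed.

Lemma nu_bigsetU (F : nat -> set T) n : (forall i, measurable (F i)) ->
  trivIset setT F -> nu (\big[setU/set0]_(i < n) F i) = \sum_(i < n) nu (F i).
Proof.
move=> mF tF; elim: n => [|n IH]; first by rewrite !big_ord0 nu0.
rewrite !big_ord_recr/= nuU ?IH//; first exact: bigsetU_measurable.
rewrite -bigcup_mkord; apply/seteqP; split => // x [[i /= iin Fi] Fn].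
have e : i = n by apply: (tF i n) => //; exists x.
by move: iin; rewrite e ltnn.
Qed.

Lemma nuD A B : measurable A -> measurable B -> B `<=` A -> nu (A `\` B) = nu A - nu B.
Proof.
move=> mA mB BA; have mAB : measurable (A `\` B) by exact: measurableD.
by rewrite -[in RHS](setDUK BA) nuU ?setDIK// addrC addKr.
Qed.

Lemma nu_null A : measurable A -> m A = 0 -> nu A = 0.
Proof.
move=> mA A0; apply/normr0_eq0/eqP; rewrite eq_le normr_ge0 andbT.
apply/ler_addgt0Pr => e e0; rewrite add0r; apply: ltW.
have [r r0] := nuC e0; apply => //.
apply: (@le_lt_trans _ _ (m A)%:E); first by rewrite -(rmuE mu mA).
by rewrite A0 lte_fin.
Qed.

(** The variation is a supremum over partitions of the whole space into nonempty sets, so the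
    complement [C] is added and empty members of [F] are dropped before comparing. *)
Lemma nu_variation (F : nat -> set T) n : (forall i, measurable (F i)) ->
  trivIset setT F -> \sum_(i < n) `|nu (F i)| <= fine (vvariation nu setT).
Proof.
move=> mF tF.
pose C := ~` (\big[setU/set0]_(i < n) F i).
have mC : measurable C by apply: measurableC; exact: bigsetU_measurable.
pose P0 := F @` [set i | (i < n)%N /\ F i !=set0].
pose P1 := [set A | A = C /\ A !=set0].
pose P := P0 `|` P1.
have fI : finite_set [set i | (i < n)%N /\ F i !=set0].
  by apply: (@sub_finite_set _ _ `I_n) => // i [].
have fP0 : finite_set P0 by exact: finite_image.
have fP1 : finite_set P1 by apply: (@sub_finite_set _ _ [set C]) => // A [].
have fP : finite_set P by rewrite finite_setU.
have CF i : (i < n)%N -> C `&` F i = set0.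
  move=> lin; apply/seteqP; split => // x [nF Fx]; apply: nF.
  by rewrite -bigcup_mkord; exists i.
have PP : (\sum_(A \in P) `|nu A|)%:E \in [set (\sum_(A \in P) `|nu A|)%:E | P in
    [set P : set (set T) | [/\ finite_set P, P `<=` measurable & partition P id setT]]].
  rewrite inE; exists P => //; split => //.
    by move=> A [[i [_ _] <-]//|[-> _]].
  split.
  - rewrite -subTset => x _; have [Cx|nC] := pselect (C x).
      by exists C => //; right; split => //; exists x.
    move: nC; rewrite /C -bigcup_mkord => /contrapT[i /= lin Fx].
    by exists (F i) => //; left; exists i => //; split => //; exists x.
  - move=> A B [[i [lin _] <-]|[-> _]] [[j [ljn _] <-]|[-> _]] //.
    + by move=> [x [Fi Fj]]; congr F; apply: tF => //; exists x.
    + by move=> [x [Fx Cx]]; have : (C `&` F i) x by []; rewrite CF.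
    + by move=> [x [Cx Fx]]; have : (C `&` F j) x by []; rewrite CF.
  - by move=> A [[i [_ ?] <-]//|[]].
have Vfin : vvariation nu setT \is a fin_num.
  rewrite ge0_fin_numE//; apply: le_trans (ereal_sup_ubound (set_mem PP)).
  by rewrite lee_fin fsbig_finite//= sumr_ge0.
rewrite -lee_fin fineK//; apply: le_trans (ereal_sup_ubound (set_mem PP)).
rewrite lee_fin fsbigU0//=; last first.
- move=> A [[i [lin [x Fx]] <-]] [FC _].
  have : (C `&` F i) x by split => //; rewrite -FC.
  by rewrite CF.
apply: (@le_trans _ _ (\sum_(A \in P0) `|nu A|)); last first.
  by rewrite lerDl fsbig_finite//= sumr_ge0.
have Finj : set_inj [set i | (i < n)%N /\ F i !=set0] F.
  move=> i j /set_mem[lin [x Fx]] _ FF.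
  have FFx : (F i `&` F j) x by split => //; rewrite -FF.
  by apply: (tF i j) => //; exists x.
rewrite /P0 (fsbig_image _ _ (fun A => `|nu A|) Finj).
rewrite (fsbig_ord _ _ (fun i => `|nu (F i)|)).
rewrite [leRHS](fsbig_widen _ `I_n) //.
  by move=> i [].
move=> i [/= lin] /not_andP[//|nF] /=.
have -> : F i = set0 by apply/eqP/negPn/negP => /set0P.
by rewrite nu0 normr0.
Qed.

End vector_measure_theory.

Section average_range.
Context (d : measure_display) (T : measurableType d) (R : realType).
Variable X : completeNormedModType R.
Variable mu : {finite_measure set T -> \bar R}.
Variable nu : set T -> X.
Hypothesis nuS : vector_measure nu.
Hypothesis nuV : bounded_vvariation nu.
Hypothesis nuC : measure_continuous mu nu.
Local Notation m := (rmu mu).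

Definition average_range (E : set T) : set X :=
  [set x | exists A, [/\ measurable A, A `<=` E, 0 < m A & x = (m A)^-1 *: nu A]].

(** Otherwise sets with |nu B| > C m(B) would exhaust [E], and C m(E) would be at most the total
    variation [V]. The choice C = (V + 1) / m(E) excludes this. *)
Lemma bounded_average_range (E : set T) : measurable E -> 0 < m E ->
  exists F C, [/\ measurable F, F `<=` E, 0 < m F &
    forall A, measurable A -> A `<=` F -> `|nu A| <= C * m A].
Proof.
move=> mE E0; apply: contrapT => nF.
pose V := fine (vvariation nu setT).
have V0 : 0 <= V.
  by apply: le_trans (nu_variation nuS nuV (F := fun=> set0) 0 _ _);
    [rewrite big_ord0|move=> _; exact: measurable0|exact: trivIset_set0].
pose C := (V + 1) / m E.
have C0 : 0 < C by rewrite divr_gt0// ltr_wpDl.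
have [A mA AE A0|G [mG GE tG GQ G0]] := @exhaustion _ _ _ mu
    [set A | C * m A < `|nu A|] E mE.
  apply: contrapT => nB; apply: nF; exists A, C; split => // B mB BA.
  rewrite leNgt; apply/negP => h; apply: nB; exists B; split => //.
  rewrite lt_neqAle rmu_ge0 andbT eq_sym; apply/eqP => B0.
  by move: h; rewrite B0 mulr0 (nu_null nuC)// normr0 ltxx.
have mU : measurable (\bigcup_i G i) by exact: bigcup_measurable.
have hE : m E = m (\bigcup_i G i).
  apply/eqP; rewrite -subr_eq0 -[X in _ - m X](setIidr (_ : _ `<=` E)) -?rmuD ?G0//.
  by move=> x [i _ /GE].
have := rmu_bigcup (mu := mu) mG tG; rewrite -hE => cv.
have : m E <= V / C.
  rewrite -(cvg_lim (@Rhausdorff R) cv); apply: limr_le; first by apply/cvg_ex; exists (m E).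
  apply: nearW => n; rewrite ler_pdivlMr// big_mkord mulr_suml.
  apply: le_trans (nu_variation nuS nuV n mG tG); apply: ler_sum => i _.
  rewrite mulrC; case: (GQ i) => [->|[_ /ltW//]].
  by rewrite rmu0 mulr0.
apply/negP; rewrite -ltNge ltr_pdivrMr// /C mulrCA divff ?gt_eqF// mulr1; lra.
Qed.

(** The set whose average is x is exhausted by disjoint pieces with averages far from u, and x is
    the limit of the normalized finite sums over these pieces. The point u is independent of x: for
    the convex hull, u will be a combination and x one of its vertices. *)
Lemma average_range_spread (F : set T) (delta : R) : 0 < delta ->
  (forall G u, measurable G -> G `<=` F -> 0 < m G ->
    exists A, [/\ measurable A, A `<=` G & delta * m A < `|nu A - m A *: u|]) ->
  forall x u eps, average_range F x -> 0 < eps ->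
  exists s : seq (R * X), [/\ forall p, p \in s ->
      [/\ 0 <= p.1, average_range F p.2 & delta <= `|p.2 - u|],
    \sum_(p <- s) p.1 = 1 & `|\sum_(p <- s) p.1 *: p.2 - x| < eps].
Proof.
move=> delta0 hF _ u eps [A [mA AF A0 ->]] eps0.
have [B mB BA B0|G [mG GA tG GQ G0]] := @exhaustion _ _ _ mu
    [set B | delta * m B <= `|nu B - m B *: u|] A mA.
  have [D [mD DB hD]] := hF B u mB (subset_trans BA AF) B0.
  exists D; split => //; last exact: ltW.
  rewrite lt_neqAle rmu_ge0 andbT eq_sym; apply/eqP => D0.
  by move: hD; rewrite D0 mulr0 (nu_null nuC)// scale0r subrr normr0 ltxx.
have mU : measurable (\bigcup_i G i) by exact: bigcup_measurable.
have UA : \bigcup_i G i `<=` A by move=> x [i _ /GA].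
have hA : m A = m (\bigcup_i G i).
  by apply/eqP; rewrite -subr_eq0 -[X in _ - m X](setIidr UA) -?rmuD ?G0.
have nA : nu A = nu (\bigcup_i G i).
  apply/eqP; rewrite -subr_eq0 -(nuD nuS)// (nu_null nuC)//.
  exact: measurableD.
have cv : \sum_(0 <= i < n) m (G i) @[n --> \oo] --> m A.
  by rewrite hA; exact: rmu_bigcup.
have cnu : \sum_(0 <= i < n) nu (G i) @[n --> \oo] --> nu A.
  by rewrite nA; exact: nuS.
have cr : (\sum_(0 <= i < n) m (G i))^-1 *: \sum_(0 <= i < n) nu (G i) @[n --> \oo]
    --> (m A)^-1 *: nu A.
  by apply: cvgZ => //; apply: cvgV => //; rewrite gt_eqF.
near \oo => n.
have c0 : 0 < \sum_(0 <= i < n) m (G i) by near: n; exact: (cvgr_gt (m A)).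
have hn : `|(m A)^-1 *: nu A - (\sum_(0 <= i < n) m (G i))^-1 *:
    \sum_(0 <= i < n) nu (G i)| < eps.
  by near: n; move/cvgrPdist_lt : cr; apply.
set c := (\sum_(0 <= i < n) m (G i)) in c0 hn.
(* Null pieces have no average and are filtered out. Dividing by the mass [c] of the first n pieces
   makes the weights sum to 1. *)
exists [seq (m (G i) / c, (m (G i))^-1 *: nu (G i)) | i <- index_iota 0 n & 0 < m (G i)].
have e (V : nmodType) (f : nat -> V) : (forall i, m (G i) = 0 -> f i = 0) ->
    \sum_(i <- index_iota 0 n | 0 < m (G i)) f i = \sum_(0 <= i < n) f i.
  move=> f0; rewrite big_mkcond; apply: eq_bigr => i _; case: ifPn => //.
  by rewrite -leNgt => h; rewrite f0//; apply/eqP; rewrite eq_le h rmu_ge0.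
split.
- move=> p /mapP[i]; rewrite mem_filter => /andP[Gi0 _] -> /=; split.
  + by rewrite divr_ge0// ltW.
  + by exists (G i); split => //; exact: subset_trans (GA i) AF.
  + case: (GQ i) => [Gi|[_ /= h]]; first by move: Gi0; rewrite Gi rmu0 ltxx.
    have -> : (m (G i))^-1 *: nu (G i) - u = (m (G i))^-1 *: (nu (G i) - m (G i) *: u).
      by rewrite scalerBr scalerA mulVf ?scale1r// gt_eqF.
    by rewrite normrZ gtr0_norm ?invr_gt0// ler_pdivlMl// mulrC.
- rewrite big_map big_filter/= e; last by move=> i ->; rewrite mul0r.
  by rewrite -mulr_suml divff// gt_eqF.
- rewrite big_map big_filter/= (eq_bigr (fun i => c^-1 *: nu (G i))); last first.
    by move=> i Gi0; rewrite scalerA mulrAC divff ?mul1r// gt_eqF.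
  rewrite e; last by move=> i Gi0; rewrite (nu_null nuC)// scaler0.
  by rewrite -scaler_sumr -opprB normrN.
Unshelve. all: by end_near. Qed.

End average_range.

Definition convex_combinations (R : realType) (X : normedModType R) (S : set X) : set X :=
  [set x | exists s : seq (R * X), [/\ forall p, p \in s -> 0 <= p.1 /\ S p.2,
    \sum_(p <- s) p.1 = 1 & x = \sum_(p <- s) p.1 *: p.2]].

Section convex_combinations_theory.
Context (R : realType) (X : normedModType R).
Implicit Type S : set X.

Lemma convex_combinations_convex S (x y : X) (a : R) : 0 <= a -> a <= 1 ->
  convex_combinations S x -> convex_combinations S y ->
  convex_combinations S (a *: x + (1 - a) *: y).
Proof.
move=> a0 a1 [s [hs s1 ->]] [t [ht t1 ->]].
exists ([seq (a * p.1, p.2) | p <- s] ++ [seq ((1 - a) * p.1, p.2) | p <- t]); split.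
- move=> p; rewrite mem_cat => /orP[] /mapP[q qs ->] /=.
    by have [q0 Sq] := hs q qs; rewrite mulr_ge0.
  by have [q0 Sq] := ht q qs; rewrite mulr_ge0// subr_ge0.
- by rewrite big_cat !big_map/= -!mulr_sumr s1 t1; ring.
- rewrite big_cat !big_map/= !scaler_sumr; congr (_ + _);
    by apply: eq_bigr => p _; rewrite scalerA.
Qed.

Lemma sub_convex_combinations S : S `<=` convex_combinations S.
Proof.
move=> x Sx; exists [:: (1, x)]; split; last by rewrite big_seq1 scale1r.
  by move=> p; rewrite inE => /eqP ->.
by rewrite big_seq1.
Qed.

Lemma convex_combinations_bounded S (C : R) : (forall x, S x -> `|x| <= C) ->
  forall x, convex_combinations S x -> `|x| <= C.
Proof.
move=> SC _ [s [hs s1 ->]]; apply: le_trans (ler_norm_sum _ _ _) _.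
rewrite -[C]mul1r -s1 mulr_suml !big_seq; apply: ler_sum => p ps.
have [p0 Sp] := hs p ps.
by rewrite normrZ ger0_norm// ler_wpM2l// SC.
Qed.

End convex_combinations_theory.

(** The failure of dentability at scale [delta]: u stays in the closed convex hull of what is left
    of [D] after removing the open ball of radius [delta] about u. *)
Definition nondentable (R : realType) (X : normedModType R) (D : set X) (delta : R) :=
  forall u eps, D u -> 0 < eps -> exists s : seq (R * X),
    [/\ forall p, p \in s -> [/\ 0 <= p.1, D p.2 & delta <= `|p.2 - u|],
      \sum_(p <- s) p.1 = 1 & `|\sum_(p <- s) p.1 *: p.2 - u| < eps].

(** Each vertex of u is replaced by a combination of points of [S] far from u, not from the vertex,
    and the errors average out. *)
Lemma nondentable_convex_combinations (R : realType) (X : normedModType R)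
    (S : set X) (delta : R) :
  (forall x u eps, S x -> 0 < eps -> exists s : seq (R * X),
    [/\ forall p, p \in s -> [/\ 0 <= p.1, S p.2 & delta <= `|p.2 - u|],
      \sum_(p <- s) p.1 = 1 & `|\sum_(p <- s) p.1 *: p.2 - x| < eps]) ->
  nondentable (convex_combinations S) delta.
Proof.
move=> hS u eps [s [hs s1 us]] eps0.
have /choice[t ht] : forall x, exists t : seq (R * X), S x ->
    [/\ forall p, p \in t -> [/\ 0 <= p.1, S p.2 & delta <= `|p.2 - u|],
      \sum_(p <- t) p.1 = 1 & `|\sum_(p <- t) p.1 *: p.2 - x| < eps].
  move=> x; have [Sx|nS] := pselect (S x); last by exists [::].
  by have [t ht] := hS x u eps Sx eps0; exists t.
exists (flatten [seq [seq (p.1 * q.1, q.2) | q <- t p.2] | p <- s]); split.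
- move=> r /flattenP[_ /mapP[p ps ->] /mapP[q qt ->]] /=.
  have [p0 Sp] := hs p ps; have [h _ _] := ht _ Sp.
  have [q0 Sq dq] := h q qt; split => //; first exact: mulr_ge0.
  exact: sub_convex_combinations.
- rewrite big_flatten big_map/= -[RHS]s1 !big_seq; apply: eq_bigr => p ps.
  have [p0 Sp] := hs p ps; have [_ h _] := ht _ Sp.
  by rewrite big_map/= -mulr_sumr h mulr1.
- rewrite big_flatten big_map/= [X in _ - X]us -sumrB.
  rewrite (eq_big_seq (fun p => p.1 *: (\sum_(q <- t p.2) q.1 *: q.2 - p.2))); last first.
    move=> p ps; rewrite big_map/= scalerBr; congr (_ - _).
    by rewrite scaler_sumr; apply: eq_bigr => q _; rewrite scalerA.
  apply: le_lt_trans (ler_norm_sum _ _ _) _.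
  (* The strict bound survives averaging because the weights sum to 1 and so are not all zero. *)
  have : \sum_(p <- s) p.1 * `|\sum_(q <- t p.2) q.1 *: q.2 - p.2| < eps.
    suff : 0 < \sum_(p <- s) p.1 * (eps - `|\sum_(q <- t p.2) q.1 *: q.2 - p.2|).
      rewrite (eq_bigr (fun p => p.1 * eps - p.1 * `|\sum_(q <- t p.2) q.1 *: q.2 - p.2|)).
        by rewrite sumrB -mulr_suml s1 mul1r subr_gt0.
      by move=> p _; rewrite mulrBr.
    have nn p : p \in s -> 0 <= p.1 * (eps - `|\sum_(q <- t p.2) q.1 *: q.2 - p.2|).
      move=> ps; have [p0 Sp] := hs p ps; have [_ _ h] := ht _ Sp.
      by rewrite mulr_ge0// subr_ge0 ltW.
    rewrite lt_neqAle big_seq sumr_ge0// andbT eq_sym psumr_eq0//; last first.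
    apply/allPn. 
    have [p ps p1] : exists2 p, p \in s & p.1 != 0.
      apply: contrapT => np; move: s1; rewrite big_seq big1 => [/esym/eqP|p ps].
        by rewrite oner_eq0.
      by apply: contrapT => /eqP p1; apply: np; exists p.
    exists p => //; rewrite ps/= mulf_neq0// subr_eq0 gt_eqF//.
    by have [p0 Sp] := hs p ps; have [_ _ h] := ht _ Sp.
  apply: le_lt_trans; rewrite !big_seq; apply: ler_sum => p ps.
  by have [p0 Sp] := hs p ps; rewrite normrZ ger0_norm.
Qed.

(** * Construction of a density from pieces of small oscillation *)

Section density.
Context (d : measure_display) (T : measurableType d) (R : realType).
Variable X : completeNormedModType R.
Variable mu : {finite_measure set T -> \bar R}.
Variable nu : set T -> X.
Hypothesis nuS : vector_measure nu.
Hypothesis nuV : bounded_vvariation nu.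
Hypothesis nuC : measure_continuous mu nu.
Local Notation m := (rmu mu).

(** A condition on the averages nu(A) / m(A), multiplied out so that null sets need no exception. *)
Definition small_oscillation (delta : R) (G : set T) (u : X) :=
  forall A, measurable A -> A `<=` G -> `|nu A - m A *: u| <= delta * m A.

(** The first [N] pieces carry a simple approximation of the density. The rest is small in measure,
    which feeds the Borel-Cantelli argument and the continuity of [nu], and small in variation,
    which gives the approximation in L^1. *)
Definition density_level (delta : R) (G : nat -> set T) (u : nat -> X) (N : nat) :=
  [/\ (forall i, measurable (G i)) /\ trivIset setT G,
      m (~` \bigcup_i G i) = 0,
      forall i, small_oscillation delta (G i) (u i),
      m (~` \big[setU/set0]_(i < N) G i) <= delta
    & forall k, \sum_(N <= i < k) `|nu (G i)| <= delta].

Lemma density_level_exists (delta : R) : 0 < delta ->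
  (forall E, measurable E -> 0 < m E -> exists G u,
    [/\ measurable G, G `<=` E, 0 < m G & small_oscillation delta G u]) ->
  exists G u N, density_level delta G u N.
Proof.
move=> d0 hD.
have [A mA _ A0|G [mG _ tG GQ G0]] := @exhaustion _ _ _ mu
    [set G | exists u, small_oscillation delta G u] setT measurableT.
  by have [G [u [mG GA G0 hu]]] := hD A mA A0; exists G; split => //; exists u.
have /choice[u hu] : forall i, exists u, small_oscillation delta (G i) u.
  move=> i; have [Gi|[_ //]] := GQ i; exists 0 => A mA.
  rewrite Gi subset0 => ->.
  by rewrite (nu0 nuS) scaler0 subrr normr0 rmu0 mulr0.
(* The partial sums of |nu (G i)| are bounded by the variation; beyond an index where they come
   within delta of their supremum, all tails are at most delta. *)
have [N1 hN1] : exists N1, forall k, \sum_(N1 <= i < k) `|nu (G i)| <= delta.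
  pose S := [set \sum_(0 <= i < n) `|nu (G i)| | n in [set: nat]].
  have hS : has_sup S.
    split; first by exists (\sum_(0 <= i < 0) `|nu (G i)|), 0%N.
    exists (fine (vvariation nu setT)) => _ [n _ <-].
    by rewrite big_mkord; exact: nu_variation.
  have [_ [N _ <-] hN] := sup_adherent d0 hS.
  exists N => k; have [Nk|kN] := leqP N k; last first.
    by rewrite big_geq; [exact: ltW|exact: ltnW].
  have : \sum_(0 <= i < k) `|nu (G i)| <= sup S.
    by apply: ub_le_sup; [exact: hS.2|exists k].
  move=> h; move: h hN; rewrite (big_cat_nat (leq0n N) Nk)/=; lra.
have cv := rmu_tail mG tG measurableT G0.
have [N2 _ hN2] : \forall n \near \oo, m (setT `\` \big[setU/set0]_(i < n) G i) < delta.
  exact: (cvgr_lt 0).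
exists G, u, (maxn N1 N2); split => //.
- by rewrite -setTD.
- by rewrite -setTD; apply/ltW/hN2; exact: leq_maxr.
- move=> k; apply: le_trans (hN1 k).
  have [Nk|kN] := leqP (maxn N1 N2) k; last first.
    by rewrite big_geq; [exact: sumr_ge0|exact: ltnW].
  by rewrite [leRHS](big_cat_nat (leq_maxl N1 N2) Nk)//= lerDr sumr_ge0.
Qed.

Section level.
Variables (delta : R) (G : nat -> set T) (u : nat -> X) (N : nat).
Hypothesis d0 : 0 < delta.
Hypothesis hL : density_level delta G u N.

(** The factor 1 puts the sum in the form expected by [wsum_sum]. *)
Definition level_simple (t : T) : X := \sum_(i <- iota 0 N) 1 *: (\1_(G i) t *: u i).

(** A bound on [G i] for the distance from [level_simple] to the future density, which is within
    [delta] of [u i] there. Beyond [N] the simple function vanishes, hence the extra norm of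
    [u i]. *)
Let c i := if (i < N)%N then delta else `|u i| + delta.

Definition level_bound (t : T) : \bar R := (\sum_(i <oo) (c i * \1_(G i) t)%:E)%E.

Let c_ge0 i : 0 <= c i.
Proof. by rewrite /c; case: ifP => _; [exact: ltW|rewrite addr_ge0// ltW]. Qed.

Lemma level_simple_in i t : (i < N)%N -> G i t -> level_simple t = u i.
Proof.
case: hL => -[_ tG] _ _ _ _ iN Gi.
rewrite /level_simple (bigD1_seq i)/= ?iota_uniq ?mem_iota//.
rewrite indicE mem_set// !scale1r big1 ?addr0// => j ji.
rewrite indicE memNset ?scale0r ?scaler0// => Gj.
by move/eqP : ji; apply; apply: tG => //; exists t.
Qed.

Lemma level_simple_out t : (~` \big[setU/set0]_(i < N) G i) t -> level_simple t = 0.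
Proof.
move=> nG; rewrite /level_simple big_seq big1// => j; rewrite mem_iota => /andP[_ jN].
rewrite indicE memNset ?scale0r ?scaler0// => Gj.
by apply: nG; rewrite -bigcup_mkord; exists j.
Qed.

Lemma level_bound_ge0 t : (0 <= level_bound t)%E.
Proof. by apply: nneseries_ge0 => i _ _; rewrite lee_fin mulr_ge0. Qed.

Lemma measurable_level_bound : measurable_fun setT level_bound.
Proof.
case: hL => -[mG _] _ _ _ _.
apply: ge0_emeasurable_sum => [i t _ _|i _]; first by rewrite lee_fin mulr_ge0.
apply/measurable_EFinP; apply: measurable_funM => //.
Qed.

Lemma level_bound_in i t : G i t -> ((c i)%:E <= level_bound t)%E.
Proof.
move=> Gi; apply: le_trans (@nneseries_lim_ge _ _ xpredT 0 i.+1 _); last first.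
  by move=> j _ _; rewrite lee_fin mulr_ge0.
rewrite big_nat_recr//= indicE mem_set// mulr1; apply: leeDr.
by apply: sume_ge0 => j _; rewrite lee_fin mulr_ge0.
Qed.

(** By small oscillation |u i| m(G i) is at most |nu(G i)| + delta m(G i). The tail of the variation
    then contributes at most delta, and the remaining terms at most 2 delta m(T). *)
Lemma integral_level_bound :
  (\int[mu]_(t in setT) level_bound t <= (delta * (2 * m setT + 1))%:E)%E.
Proof.
case: hL => -[mG tG] _ hu _ hN.
rewrite integral_nneseries//; last 2 first.
- by move=> i; apply/measurable_EFinP; apply: measurable_funM.
- by move=> i t _; rewrite lee_fin mulr_ge0.
apply: lime_le.
  by apply: is_cvg_nneseries => i _ _; apply: integral_ge0 => t _; rewrite lee_fin mulr_ge0.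
apply: nearW => k.
have e i : (\int[mu]_x (c i * \1_(G i) x)%:E = (c i * m (G i))%:E)%E.
  have mi : measurable_fun setT (fun t => (\1_(G i) t)%:E : \bar R).
    by apply/measurable_EFinP.
  have i0 t : setT t -> (0 <= (\1_(G i) t : R)%:E)%E by rewrite lee_fin.
  under eq_integral do rewrite EFinM.
  rewrite (ge0_integralZl mu measurableT mi i0) ?lee_fin//.
  by rewrite integral_indic// setIT EFinM; congr (_ * _)%E; exact: rmuE.
under eq_bigr do rewrite e.
rewrite sumEFin lee_fin.
have hi i : `|u i| * m (G i) <= `|nu (G i)| + delta * m (G i).
  have := hu i (G i) (mG i) (@subset_refl _ _) => h.
  have -> : `|u i| * m (G i) = `|m (G i) *: u i|.
    by rewrite normrZ ger0_norm ?rmu_ge0// mulrC.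
  rewrite -[m (G i) *: u i](subKr (nu (G i))).
  by apply: le_trans (ler_normB _ _) _; rewrite lerD2l.
have mT : \sum_(0 <= i < k) m (G i) <= m setT.
  rewrite big_mkord -rmu_bigsetU//; apply: rmu_le => //.
  exact: bigsetU_measurable.
apply: (@le_trans _ _ (\sum_(0 <= i < k) (2 * delta * m (G i)) + \sum_(N <= i < k) `|nu (G i)|)).
  have -> : \sum_(N <= i < k) `|nu (G i)| =
      \sum_(0 <= i < k) (if (N <= i)%N then `|nu (G i)| else 0).
    by rewrite (big_nat_widenl _ 0)//= big_mkcond.
  rewrite -big_split/=; apply: ler_sum => i _; rewrite /c ltnNge.
  have h1 := hi i; have h2 : 0 <= delta * m (G i) by rewrite mulr_ge0 ?rmu_ge0// ltW.
  by case: (N <= i)%N => /=; lra.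
have h3 : delta * (\sum_(0 <= i < k) m (G i)) <= delta * m setT by rewrite ler_wpM2l// ltW.
by rewrite -mulr_sumr; have := hN k; lra.
Qed.

Lemma level_simple_bochner : bochner_simple level_simple.
Proof.
case: hL => -[mG _] _ _ _ _.
have w0 : (fun=> 0 : R) (set0 : set T) = 0 by [].
have wU A B : measurable A -> measurable B -> A `&` B = set0 ->
  (fun=> 0 : R) (A `|` B : set T) = (fun=> 0) A + (fun=> 0) B by rewrite addr0.
exact: (wsum_sum w0 wU (iota 0 N) (fun=> 1)
  (fun i => bochner_simple_indic (u i) (mG i))).1.
Qed.

Lemma level_simple_integral A : measurable A ->
  `|nu A - simple_integral mu A level_simple| <=
    `|nu (A `\` \big[setU/set0]_(i < N) G i)| + delta * m setT.
Proof.
move=> mA; case: hL => -[mG tG] _ hu _ hN.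
pose w B := fine (mu (A `&` B)).
have w0 : w set0 = 0 by rewrite /w setI0 measure0.
have wU B C : measurable B -> measurable C -> B `&` C = set0 -> w (B `|` C) = w B + w C.
  move=> mB mC BC; rewrite /w setIUr -/(rmu mu _) rmuU//; try exact: measurableI.
  by rewrite setIACA BC setI0.
rewrite -[simple_integral _ _ _]/(wsum w level_simple).
rewrite (wsum_sum w0 wU (iota 0 N) (fun=> 1) (fun i => bochner_simple_indic (u i) (mG i))).2.
under eq_bigr do rewrite scale1r (wsum_indic w0)//.
have -> : iota 0 N = index_iota 0 N by rewrite /index_iota subn0.
rewrite big_mkord.
pose G' i := A `&` G i.
have mG' i : measurable (G' i) by exact: measurableI.
have tG' : trivIset setT G' by exact: trivIset_setIl.
have UG : A `&` \big[setU/set0]_(i < N) G i = \big[setU/set0]_(i < N) G' i.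
  by rewrite big_distrr.
have mU : measurable (\big[setU/set0]_(i < N) G i) by exact: bigsetU_measurable.
have -> : nu A = nu (A `\` \big[setU/set0]_(i < N) G i) + \sum_(i < N) nu (G' i).
  rewrite -(nu_bigsetU nuS)// -UG -(nuU nuS).
  - congr nu; apply/seteqP; split => [x Ax|x [[]|[]]//].
    by have [?|?] := pselect ((\big[setU/set0]_(i < N) G i) x); [right|left].
  - exact: measurableD.
  - exact: measurableI.
  - by apply/seteqP; split => // x [[_ ?] []].
rewrite -addrA; apply: le_trans (ler_normD _ _) _; rewrite lerD2l -sumrB.
apply: le_trans (ler_norm_sum _ _ _) _.
apply: (@le_trans _ _ (\sum_(i < N) delta * m (G' i))).
  by apply: ler_sum => i _; apply: hu => //; exact: subIsetr.
rewrite -mulr_sumr; apply: ler_wpM2l; first exact: ltW.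
rewrite -(rmu_bigsetU mu N mG' tG'); apply: rmu_le => //.
exact: bigsetU_measurable.
Qed.

End level.
End density.

Section density_limit.
Context (d : measure_display) (T : measurableType d) (R : realType).
Variable X : completeNormedModType R.
Variable mu : {finite_measure set T -> \bar R}.
Variable nu : set T -> X.
Hypothesis nuS : vector_measure nu.
Hypothesis nuV : bounded_vvariation nu.
Hypothesis nuC : measure_continuous mu nu.
Local Notation m := (rmu mu).
Variables (e : nat -> R) (G : nat -> nat -> set T) (u : nat -> nat -> X) (N : nat -> nat).
Hypothesis e0 : forall n, 0 < e n.
Hypothesis e_cvg : e @ \oo --> (0 : R).
Hypothesis e_sum : forall k, \sum_(0 <= n < k) e n <= 2.
Hypothesis hL : forall n, density_level mu nu (e n) (G n) (u n) (N n).

Let s n := level_simple (G n) (u n) (N n).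
Let b n := level_bound (e n) (G n) (u n) (N n).

Definition level_limit (t : T) : X := lim (s n t @[n --> \oo]).

Let mG n i : measurable (G n i).
Proof. by case: (hL n) => -[]. Qed.

Let B n := ~` \big[setU/set0]_(i < N n) G n i.

Let mB n : measurable (B n).
Proof. by apply: measurableC; exact: bigsetU_measurable. Qed.

Let H n i p j : set T :=
  [set t | [/\ G n i t, G p j t & e n + e p < `|u n i - u p j|]].

(** On a common part of positive measure the average of [nu] would be within [e n] of [u n i] and
    within [e p] of [u p j]. *)
Let H0 n i p j : mu.-negligible (H n i p j).
Proof.
have [h|h] := leP `|u n i - u p j| (e n + e p).
  exists set0; split => //; rewrite ?measure0// => t [_ _].
  by rewrite ltNge h.
exists (G n i `&` G p j); split; last by move=> t [].
- exact: measurableI.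
set K := G n i `&` G p j.
have mK : measurable K by exact: measurableI.
suff : m K = 0 by move=> K0; rewrite (rmuE mu mK) K0.
apply/eqP; rewrite eq_le rmu_ge0 andbT leNgt; apply/negP => K0.
case: (hL n) => _ _ /(_ i K mK (@subIsetl _ _ _)) h1 _ _.
case: (hL p) => _ _ /(_ j K mK (@subIsetr _ _ _)) h2 _ _.
have : m K * `|u n i - u p j| <= m K * (e n + e p).
  rewrite -{1}(ger0_norm (ltW K0)) -normrZ scalerBr.
  rewrite (_ : _ - _ = (nu K - m K *: u p j) - (nu K - m K *: u n i)).
    by apply: le_trans (ler_normB _ _) _; lra.
  by rewrite opprB [RHS]addrC addrA subrK.
by rewrite ler_pM2l// leNgt h.
Qed.

Let good t := [/\ forall n, exists i, G n i t,
  forall n i p j, ~ H n i p j t & exists n0, forall n, (n0 <= n)%N -> ~ B n t].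

(** The pieces of a level cover almost everything, the sets [H] are null, and the measures of the
    sets [B n] have a finite sum, so by Borel-Cantelli almost every point lies in only finitely many
    of them. *)
Lemma ae_good : {ae mu, forall t, good t}.
Proof.
have h1 : mu.-negligible (\bigcup_n ~` \bigcup_i G n i).
  apply: negligible_bigcup => n.
  have mn : measurable (~` \bigcup_i G n i).
    by apply: measurableC; exact: bigcup_measurable.
  apply/negligibleP => //.
  case: (hL n) => _ Z _ _ _.
  by rewrite [LHS](rmuE mu mn) Z.
have h2 : mu.-negligible (\bigcup_n \bigcup_i \bigcup_p \bigcup_j H n i p j).
  by do 4! apply: negligible_bigcup => ?; exact: H0.
have h3 : mu.-negligible (lim_sup_set B).
  apply/negligibleP.
    by apply: bigcap_measurable => // k _; exact: bigcup_measurable.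
  apply: lim_sup_set_cvg0 => //.
  apply: (@le_lt_trans _ _ 2%:E); last by rewrite ltry.
  apply: lime_le; first exact: is_cvg_nneseries.
  apply: nearW => k; apply: (@le_trans _ _ (\sum_(0 <= n < k) (e n)%:E)%E).
    apply: lee_sum => n _; case: (hL n) => _ _ _ h _.
    by rewrite [leLHS](rmuE mu (mB n)) lee_fin.
  by rewrite sumEFin lee_fin.
apply: negligibleS (negligibleU h1 (negligibleU h2 h3)).
move=> t /= ng; apply: contrapT => nn; apply: ng; split.
- move=> n; apply: contrapT => h; apply: nn; left; exists n => // -[i _ Gi].
  by apply: h; exists i.
- by move=> n i p j h; apply: nn; right; left; exists n => //; exists i => //; exists p => //; exists j.
- apply: contrapT => h; apply: nn; right; right => k _.
  apply: contrapT => h'; apply: h; exists k => n kn Bn.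
  by apply: h'; exists n.
Qed.

(** At a good point the simple values are eventually values of pieces containing the point. They
    differ from the value of any piece of level k through it by at most e p + e k, so they are
    Cauchy, and letting p grow gives the bound. *)
Lemma good_dist t n i : good t -> G n i t -> `|level_limit t - u n i| <= e n.
Proof.
move=> [g1 g2 [n0 g3]] Gt.
have hs p : (n0 <= p)%N -> exists2 j, G p j t & s p t = u p j.
  move=> /g3; rewrite /B -bigcup_mkord => /contrapT[j /= jN Gj].
  by exists j => //; exact: (level_simple_in (hL p)).
have dist p k l : (n0 <= p)%N -> G k l t -> `|s p t - u k l| <= e p + e k.
  move=> /hs[j Gj ->] Gl; rewrite leNgt; apply/negP => h.
  by apply: (g2 p j k l); split.
have cvs : cvg (s p t @[p --> \oo]).
  apply/cauchy_cvgP/cauchy_exP => eps eps0.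
  have [k _ hk] : \forall k \near \oo, e k < eps / 2.
    by apply: (cvgr_lt 0) => //; rewrite divr_gt0.
  have [l Gl] := g1 k.
  exists (u k l).
  suff : \forall p \near \oo, ball (u k l) eps (s p t) by [].
  near=> p; rewrite -ball_normE/= distrC.
  apply: (@le_lt_trans _ _ (e p + e k)).
    by apply: dist => //; near: p; exact: nbhs_infty_ge.
  rewrite [eps]splitr; apply: ltrD; last by apply: hk => /=.
  by apply: hk => /=; near: p; exact: nbhs_infty_ge.
have cv : `|s p t - u n i| @[p --> \oo] --> `|level_limit t - u n i|.
  by apply: cvg_norm; apply: cvgB => //; exact: cvg_cst.
have cv2 : e p + e n @[p --> \oo] --> 0 + e n by apply: cvgD => //; exact: cvg_cst.
rewrite -[leRHS]add0r; apply: (ler_cvg_to cv cv2).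
by near=> p; apply: dist => //; near: p; exact: nbhs_infty_ge.
Unshelve. all: by end_near. Qed.

Lemma good_cvg t : good t -> s n t @[n --> \oo] --> level_limit t.
Proof.
move=> gt; apply/cvgrPdist_le => eps eps0.
have [g1 _ [n0 g3]] := gt.
near=> n.
have : ~ B n t by apply: g3; near: n; exact: nbhs_infty_ge.
rewrite /B -bigcup_mkord => /contrapT[j /= jN Gj].
rewrite /s (level_simple_in (hL n) jN Gj); apply: (le_trans (good_dist gt Gj)).
by apply: ltW; near: n; exact: (cvgr_lt 0).
Unshelve. all: by end_near. Qed.

Lemma good_bound t n : good t -> (`|level_limit t - s n t|%:E <= b n t)%E.
Proof.
move=> gt; have [g1 _ _] := gt; have [i Gi] := g1 n.
apply: le_trans (level_bound_in (u n) (N n) (e0 n) Gi); rewrite lee_fin.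
case: ltnP => [iN|Ni].
  by rewrite /s (level_simple_in (hL n) iN Gi); exact: good_dist.
rewrite /s (level_simple_out (u n) (G := G n) (N := N n)); last first.
  rewrite -bigcup_mkord => -[j /= jN Gj].
  case: (hL n) => -[_ tG] _ _ _ _.
  have e1 : j = i by apply: tG => //; exists t.
  by move: jN; rewrite e1 ltnNge Ni.
rewrite subr0 -[level_limit t](subrK (u n i)) addrC.
apply: le_trans (ler_normD _ _) _.
by rewrite lerD2l; exact: good_dist.
Qed.

Lemma level_limit_bochner A : bochner_measurable mu A level_limit.
Proof.
exists s; split; first by move=> n; exact: (level_simple_bochner (hL n)).
by apply: filterS ae_good => t gt _; exact: good_cvg.
Qed.

Lemma integral_level_limit_dist A n : measurable A ->
  (\int[mu]_(t in A) `|level_limit t - s n t|%:E <= (e n * (2 * m setT + 1))%:E)%E.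
Proof.
move=> mA; apply: le_trans (integral_level_bound (e0 n) (hL n)).
have mb := measurable_level_bound (e0 n) (hL n).
have bge0 t : (0 <= b n t)%E by apply: level_bound_ge0.
apply: (@le_trans _ _ (\int[mu]_(t in A) b n t)%E).
  apply: ae_ge0_le_lower_integral => //; first exact: measurable_funTS.
  by apply: filterS ae_good => t gt _; exact: good_bound.
exact: ge0_subset_integral.
Qed.

Lemma integral_level_simple_lty A n : measurable A ->
  (\int[mu]_(t in A) `|s n t|%:E < +oo)%E.
Proof.
move=> mA; pose C := \sum_(i <- iota 0 (N n)) `|u n i|.
apply: (@le_lt_trans _ _ (\int[mu]_(t in A) (cst C%:E) t)%E).
  apply: ge0_le_lower_integral => // t _; rewrite lee_fin.
  apply: le_trans (ler_norm_sum _ _ _) _; apply: ler_sum => i _.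
  rewrite scale1r normrZ indicE; case: (t \in _); rewrite ?normr1 ?mul1r//.
  by rewrite normr0 mul0r.
rewrite integral_cst// -ge0_fin_numE ?mule_ge0 ?lee_fin ?sumr_ge0//.
by rewrite fin_numM// fin_num_measure.
Qed.

Lemma integral_level_limit_lty : (\int[mu]_(t in setT) `|level_limit t|%:E < +oo)%E.
Proof.
have mb := measurable_level_bound (e0 0) (hL 0).
pose C := \sum_(i <- iota 0 (N 0)) `|u 0%N i|.
have C0 : 0 <= C by exact: sumr_ge0.
have bge0 t : (0 <= b 0 t)%E by apply: level_bound_ge0.
apply: (@le_lt_trans _ _ (\int[mu]_(t in setT) (C%:E + b 0 t))%E).
  apply: ae_ge0_le_lower_integral => //.
  - exact: emeasurable_funD.
  - by move=> t _; rewrite adde_ge0.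
  apply: filterS ae_good => t gt _.
  apply: (@le_trans _ _ (`|s 0 t|%:E + `|level_limit t - s 0 t|%:E)%E).
    by rewrite -EFinD lee_fin -{1}[level_limit t](subrK (s 0 t)) addrC ler_normD.
  apply: leeD; last exact: good_bound.
  rewrite lee_fin; apply: le_trans (ler_norm_sum _ _ _) _; apply: ler_sum => i _.
  rewrite scale1r normrZ indicE; case: (t \in _); rewrite ?normr1 ?mul1r//.
  by rewrite normr0 mul0r.
rewrite ge0_integralD// integral_cst// lte_add_pinfty//.
  rewrite -ge0_fin_numE ?mule_ge0//.
  by rewrite fin_numM// fin_num_measure.
apply: le_lt_trans (integral_level_bound (e0 0) (hL 0)) _.
by rewrite ltry.
Qed.

Lemma level_limit_integral A : measurable A -> bochner_integral mu A level_limit (nu A).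
Proof.
move=> mA; split; first exact: level_limit_bochner.
exists s; split.
- move=> n; split; first exact: (level_simple_bochner (hL n)).
  exact: integral_level_simple_lty.
- apply: (@squeeze_cvge _ _ _ _ (cst 0%E) _ (fun n => (e n * (2 * m setT + 1))%:E)).
  + apply: nearW => n; rewrite integral_level_limit_dist// andbT.
    by apply: integral_ge0 => t _; rewrite lee_fin.
  + exact: cvg_cst.
  + apply: cvg_EFin; first by apply: nearW.
    rewrite -[X in _ --> X](mul0r (2 * m setT + 1)).
    by apply: cvgM => //; exact: cvg_cst.
- apply/cvgrPdist_lt => eps eps0.
  have eps2 : 0 < eps / 2 by rewrite divr_gt0.
  have [r r0 hr] := nuC eps2.
  have cM : e n * m setT @[n --> \oo] --> (0 : R).
    by rewrite -[X in _ --> X](mul0r (m setT)); apply: cvgM => //; exact: cvg_cst.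
  near=> n.
  (* The integral of the simple function over [A] ignores the part of [A] outside the first [N n]
     pieces; that part has measure at most [e n], so the continuity of [nu] controls it. *)
  have hn := level_simple_integral nuS (e0 n) (hL n) mA.
  apply: le_lt_trans hn _.
  rewrite [eps]splitr; apply: ltrD.
    apply: hr; first by apply: measurableD => //; exact: bigsetU_measurable.
    have mD : measurable (A `\` \big[setU/set0]_(i < N n) G n i).
      by apply: measurableD => //; exact: bigsetU_measurable.
    apply: (@le_lt_trans _ _ (e n)%:E).
      rewrite [leLHS](rmuE mu mD) lee_fin; case: (hL n) => _ _ _ h _.
      by apply: le_trans h; apply: rmu_le => //; exact: mB.
    by rewrite lte_fin; near: n; exact: (cvgr_lt 0).
  by near: n; exact: (cvgr_lt 0).
Unshelve. all: by end_near. Qed.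

End density_limit.

Lemma RNP_of_small_oscillation (R : realType) (X : completeNormedModType R)
    (d : measure_display) (T : measurableType d)
    (mu : {finite_measure set T -> \bar R}) (nu : set T -> X) :
  vector_measure nu -> bounded_vvariation nu -> measure_continuous mu nu ->
  (forall delta E, 0 < delta -> measurable E -> 0 < rmu mu E -> exists G u,
    [/\ measurable G, G `<=` E, 0 < rmu mu G & small_oscillation mu nu delta G u]) ->
  exists f : T -> X, L1X mu setT f /\
    forall A, measurable A -> bochner_integral mu A f (nu A).
Proof.
move=> nuS nuV nuC hD.
(* The scales must be summable for the Borel-Cantelli argument. *)
pose e n : R := geometric 1 2^-1 n.
have e0 n : 0 < e n by rewrite /e /geometric/= mul1r exprn_gt0// invr_gt0.
have e_cvg : e @ \oo --> (0 : R).
  have h : `|2^-1 : R| < 1 by rewrite ger0_norm; lra.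
  exact: cvg_geometric.
have e_sum k : \sum_(0 <= n < k) e n <= 2.
  have := @geometric_seriesE R 1 2^-1.
  rewrite /series/= => h.
  have -> : \sum_(0 <= n < k) e n = 2 * (1 - 2^-1 ^+ k).
    have h2 : 2^-1 != 1 :> R by rewrite invr_eq1 gt_eqF// ltr1n.
    have := congr1 (fun f => f k) (h h2) => /= ->.
    by rewrite mul1r mulrC; congr (_ * _); field.
  have h3 : 0 < (2^-1 : R) ^+ k by rewrite exprn_gt0// invr_gt0.
  lra.
have /choice[p hp] : forall n, exists p : (nat -> set T) * (nat -> X) * nat,
    density_level mu nu (e n) p.1.1 p.1.2 p.2.
  move=> n; have [G [u [N h]]] := density_level_exists nuS nuV (e0 n) (fun E => hD (e n) E (e0 n)).
  by exists (G, u, N).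
pose f := level_limit (fun n => (p n).1.1) (fun n => (p n).1.2) (fun n => (p n).2).
exists f; split.
  split; first exact: (level_limit_bochner e_cvg e_sum hp).
  exact: (integral_level_limit_lty e0 e_cvg e_sum hp).
by move=> A mA; exact: (level_limit_integral nuS nuC e0 e_cvg e_sum hp mA).
Qed.

Theorem not_RNP_nondentable (R : realType) (X : completeNormedModType R) :
  ~ RNP X -> exists (D : set X) (delta C : R), [/\ 0 < delta, D !=set0,
    forall x, D x -> `|x| <= C,
    forall x y a, 0 <= a -> a <= 1 -> D x -> D y -> D (a *: x + (1 - a) *: y)
    & nondentable D delta].
Proof.
move=> nR; apply: contrapT => nD; apply: nR => d T mu nu nuS nuV nuC.
apply: RNP_of_small_oscillation => // delta E d0 mE E0.
have [F [C [mF FE F0 FC]]] := bounded_average_range nuS nuV nuC mE E0.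
(* If no subset of [F] had oscillation at most [delta] about any vector, the averages over subsets
   of [F] would spread away from every u, and their convex hull would be the set excluded by
   [nD]. *)
apply: contrapT => nG; apply: nD.
have avF : average_range mu nu F ((rmu mu F)^-1 *: nu F).
  by exists F; split => //; exact: subset_refl.
exists (convex_combinations (average_range mu nu F)), delta, C; split => //.
- by exists ((rmu mu F)^-1 *: nu F); exact: sub_convex_combinations.
- apply: convex_combinations_bounded => _ [A [mA AF A0 ->]].
  rewrite normrZ gtr0_norm ?invr_gt0// ler_pdivrMl// mulrC.
  exact: FC.
- by move=> x y a; exact: convex_combinations_convex.
- apply: nondentable_convex_combinations => x u eps.
  apply: (average_range_spread nuS nuC d0) => H v mH HF H0.
  apply: contrapT => nA; apply: nG; exists H, v; split => //.
    exact: subset_trans HF FE.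
  move=> A mA AH; rewrite leNgt; apply/negP => h; apply: nA.
  by exists A.
Qed.

(** * Bochner integral functionals *)

Section strongly_measurable.
Context (d : measure_display) (T : measurableType d) (R : realType).
Implicit Types X : normedModType R.

(** Convergence at every point, unlike the almost everywhere convergence in [bochner_measurable],
    makes the norm measurable. *)
Definition strongly_measurable X (F : T -> X) :=
  exists s : nat -> T -> X, (forall n, bochner_simple (s n)) /\
    forall t, s n t @[n --> \oo] --> F t.

Lemma bochner_simple_measurable (s : T -> R) : bochner_simple s ->
  measurable_fun setT s.
Proof.
move=> [fs ms] _ A _; rewrite setTI.
rewrite (_ : _ @^-1` _ = \bigcup_(y in range s `&` A) s @^-1` [set y]).
  apply: fin_bigcup_measurable; first exact: finite_setIl.
  by move=> y _; exact: ms.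
apply/seteqP; split => [t /= At|t [y [_ Ay] /= ->]] //.
by exists (s t) => //=; split => //; exists t.
Qed.

Lemma bochner_simple_linear X (a : R) (s s' : T -> X) :
  bochner_simple s -> bochner_simple s' -> bochner_simple (fun t => a *: s t + s' t).
Proof.
move=> bs bs'.
exact: (bochner_simple_comp (fun z => a *: z.1 + z.2) (bochner_simple_pair bs bs')).
Qed.

Lemma strongly_measurable_simple X (s : T -> X) :
  bochner_simple s -> strongly_measurable s.
Proof. by move=> bs; exists (fun=> s); split => // t; exact: cvg_cst. Qed.

Lemma strongly_measurable_linear X (a : R) (F G : T -> X) :
  strongly_measurable F -> strongly_measurable G ->
  strongly_measurable (fun t => a *: F t + G t).
Proof.
move=> [s [bs cs]] [s' [bs' cs']]; exists (fun n t => a *: s n t + s' n t); split.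
  by move=> n; exact: bochner_simple_linear.
by move=> t; apply: cvgD => //; apply: cvgZ => //; exact: cvg_cst.
Qed.

Lemma strongly_measurable_norm X (F : T -> X) : strongly_measurable F ->
  measurable_fun setT (fun t => `|F t|).
Proof.
move=> [s [bs cs]].
apply: (@measurable_fun_cvg _ _ _ _ (fun n t => `|s n t|)) => [n|t _].
  exact: (bochner_simple_measurable (bochner_simple_comp (fun x : X => `|x|) (bs n))).
by apply: cvg_norm; exact: cs.
Qed.

Lemma simple_decomposition X (s : T -> X) (t : T) : bochner_simple s ->
  s t = \sum_(x <- fset_set (range s)) 1 *: (\1_(s @^-1` [set x]) t *: x).
Proof.
move=> [fs ms]; rewrite (bigD1_seq (s t)) /= ?fset_uniq//; last first.
  by rewrite in_fset_set// inE; exists t.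
rewrite indicE mem_set//= !scale1r big1 ?addr0// => x xs.
rewrite indicE memNset ?scale0r ?scaler0// => /= sx.
by rewrite sx eqxx in xs.
Qed.

End strongly_measurable.

Section L1_representative.
Context (d : measure_display) (T : measurableType d) (R : realType).
Variable mu : {measure set T -> \bar R}.
Variables (D : set T) (mD : measurable D).
Implicit Types X : normedModType R.

(** The function is set to 0 off [D] and on the exceptional null set. The bound holds everywhere
    because, when the larger function is not measurable, only a pointwise inequality allows the
    integrals to be compared. *)
Lemma bochner_measurable_representative X (f : T -> X) : bochner_measurable mu D f ->
  exists F, [/\ strongly_measurable F, {ae mu, forall t, D t -> f t = F t}
    & forall t, `|F t| <= `|f t| ].
Proof.
move=> [s [bs [N [mN N0 hN]]]].
pose D' := D `\` N.
have mD' : measurable D' by exact: measurableD.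
exists (fun t => if t \in D' then f t else 0); split.
- exists (fun n t => if t \in D' then s n t else 0); split.
    move=> n; exact: (bochner_simple_comp (fun z : bool * X => if z.1 then z.2 else 0)
      (bochner_simple_pair (bochner_simple_mem mD') (bs n))).
  move=> t; case: ifPn => [|_]; last exact: cvg_cst.
  move=> /set_mem[Dt Nt]; apply: contrapT => nc; apply: Nt; apply: hN => /= h.
  exact/nc/h.
- exists N; split => // t /= h; apply: contrapT => Nt; apply: h => Dt.
  by rewrite mem_set.
- by move=> t; case: ifP => // _; rewrite normr0.
Qed.

Lemma ae_eq_integral_norm X (f F : T -> X) : strongly_measurable F ->
  {ae mu, forall t, D t -> f t = F t} -> (forall t, `|F t| <= `|f t|) ->
  (\int[mu]_(t in D) `|f t|%:E = \int[mu]_(t in D) `|F t|%:E)%E.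
Proof.
move=> mF fF Ff; apply/eqP; rewrite eq_le; apply/andP; split.
  apply: ae_ge0_le_lower_integral => //.
    by apply/measurable_EFinP; apply: measurable_funTS; exact: strongly_measurable_norm.
  by apply: filterS fF => t h /h ->.
by apply: ge0_le_lower_integral => // t _; rewrite lee_fin.
Qed.

Lemma strongly_measurable_bochner X (F f : T -> X) : strongly_measurable F ->
  {ae mu, forall t, D t -> f t = F t} -> bochner_measurable mu D f.
Proof.
move=> [s [bs cs]] fF; exists s; split => //.
by apply: filterS fF => t h /h ->.
Qed.

Lemma L1X_of_representative X (F f : T -> X) : strongly_measurable F ->
  {ae mu, forall t, D t -> f t = F t} ->
  (\int[mu]_(t in D) `|F t|%:E < +oo)%E -> L1X mu D f.
Proof.
move=> mF fF Foo; split; first exact: strongly_measurable_bochner mF fF.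
apply: le_lt_trans Foo; apply: ae_ge0_le_lower_integral => //.
  by apply/measurable_EFinP; apply: measurable_funTS; exact: strongly_measurable_norm.
by apply: filterS fF => t h /h ->.
Qed.

Lemma simple_L1_dense X (F : T -> X) : strongly_measurable F ->
  (\int[mu]_(t in D) `|F t|%:E < +oo)%E ->
  exists s : nat -> T -> X, [/\ forall n, bochner_simple (s n),
    forall n, (\int[mu]_(t in D) `|s n t|%:E < +oo)%E
    & (\int[mu]_(t in D) `|F t - s n t|%:E)%E @[n --> \oo] --> 0%E].
Proof.
move=> mF Foo; have [s [bs cs]] := mF.
have mnF := strongly_measurable_norm mF.
(* Discarding the values of [s n] of norm above 2 |F| gives errors dominated by 3 |F|. The limits do
   not change: where F t is nonzero, |s n t| is eventually at most 2 |F t|. *)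
pose B n := [set t | `|s n t| <= 2 * `|F t| ].
have mB n : measurable (B n).
  rewrite -[B n]setTI; apply: measurable_fun_le => //.
    exact: (bochner_simple_measurable (bochner_simple_comp (fun x : X => `|x|) (bs n))).
  exact: measurable_funM.
pose s' n t := if t \in B n then s n t else 0.
have bs' n : bochner_simple (s' n).
  exact: (bochner_simple_comp (fun z : bool * X => if z.1 then z.2 else 0)
      (bochner_simple_pair (bochner_simple_mem (mB n)) (bs n))).
have s'F n t : `|s' n t| <= 2 * `|F t|.
  by rewrite /s'; case: ifPn => [/set_mem//|_]; rewrite normr0 mulr_ge0.
have cs' t : s' n t @[n --> \oo] --> F t.
  have [F0|F0] := eqVneq (F t) 0.
    rewrite F0 (_ : (fun n => _) = fun=> 0); first exact: cvg_cst.
    apply/funext => n; apply/normr0_eq0/eqP; rewrite eq_le normr_ge0 andbT.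
    by apply: (le_trans (s'F n t)); rewrite F0 normr0 mulr0.
  apply: cvg_trans (cs t); apply: near_eq_cvg; near=> n.
  rewrite /s' mem_set// /B/=.
  have h : `|F t - s n t| < `|F t|.
    by near: n; move/cvgrPdist_lt : (cs t); apply; rewrite normr_gt0.
  have : `|s n t| <= `|F t| + `|F t - s n t|.
    by rewrite -{1}[s n t](subKr (F t)) ler_normB.
  lra.
have m3 : measurable_fun D (fun t => (3 * `|F t|)%:E).
  by apply/measurable_EFinP; apply: measurable_funTS; exact: measurable_funM.
have i3 : mu.-integrable D (fun t => (3 * `|F t|)%:E).
  apply/integrableP; split => //.
  under eq_integral do rewrite gee0_abs ?lee_fin ?mulr_ge0// EFinM.
  rewrite ge0_integralZl//; last by apply/measurable_EFinP; exact: measurable_funTS.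
  rewrite -ge0_fin_numE ?mule_ge0 ?integral_ge0// fin_numM//.
  by rewrite ge0_fin_numE// integral_ge0.
have i2 : mu.-integrable D (fun t => `|F t|%:E).
  apply/integrableP; split; last by under eq_integral do rewrite gee0_abs//.
  by apply/measurable_EFinP; exact: measurable_funTS.
have md n : measurable_fun setT (fun t => `|F t - s' n t|).
  have := strongly_measurable_norm (strongly_measurable_linear (-1) 
    (strongly_measurable_simple (bs' n)) mF).
  by under eq_fun do rewrite scaleN1r addrC.
exists s'; split => //.
- move=> n; apply: le_lt_trans (_ : (\int[mu]_(t in D) (3 * `|F t|)%:E < +oo)%E).
    apply: ge0_le_lower_integral => // t _; rewrite lee_fin (le_trans (s'F n t))//.
    by rewrite ler_wpM2r// ler_nat.
  move/integrableP : i3 => [_]; apply: le_lt_trans.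
  by apply: ge0_le_lower_integral => // t _; rewrite gee0_abs ?lee_fin ?mulr_ge0.
have [] := @dominated_convergence _ _ _ mu D mD
   (fun n t => `|F t - s' n t|%:E) (cst 0%E) (fun t => (3 * `|F t|)%:E).
- by move=> n; apply/measurable_EFinP; exact: measurable_funTS.
- exact: measurable_cst.
- apply: aeW => t _; apply: cvg_EFin; first exact: nearW.
  rewrite (_ : 0 = `|F t - F t|); last by rewrite subrr normr0.
  by apply: cvg_norm; apply: cvgB => //; exact: cvg_cst.
- exact: i3.
- apply: aeW => t n _; rewrite gee0_abs ?lee_fin//.
  apply: le_trans (ler_normB _ _) _; have := s'F n t; lra.
move=> _ _; rewrite integral_cst// mul0e; exact.
Unshelve. all: by end_near. Qed.

End L1_representative.

Lemma Rintegral_sum (d : measure_display) (T : measurableType d) (R : realType)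
    (mu : {measure set T -> \bar R}) (D : set T) (I : Type) (r : seq I) (f : I -> T -> R) :
  measurable D -> (forall i, mu.-integrable D (EFin \o f i)) ->
  mu.-integrable D (EFin \o (fun t => \sum_(i <- r) f i t)) /\
  \int[mu]_(t in D) (\sum_(i <- r) f i t) = \sum_(i <- r) \int[mu]_(t in D) f i t.
Proof.
move=> mD fi; elim: r => [|i r [IHi IH]].
  rewrite big_nil; under eq_Rintegral do rewrite big_nil.
  rewrite Rintegral_cst// mul0r; split => //.
  rewrite (_ : _ \o _ = cst 0%E); first exact: integrable0.
  by apply/funext => t /=; rewrite big_nil.
split.
  rewrite (_ : _ \o _ = (EFin \o f i) \+ (EFin \o (fun t => \sum_(j <- r) f j t))).
    exact: integrableD.
  by apply/funext => t /=; rewrite big_cons EFinD.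
under eq_Rintegral do rewrite big_cons.
by rewrite RintegralD// IH big_cons.
Qed.

Section weighted_integral.
Context (d : measure_display) (T : measurableType d) (R : realType).
Variable mu : {measure set T -> \bar R}.
Variables (D : set T) (mD : measurable D) (muD : (mu D < +oo)%E).
Variables (e : T -> R) (K : R).
Hypothesis me : measurable_fun D e.
Hypothesis eK : forall t, D t -> `|e t| <= K.
Hypothesis K0 : 0 <= K.
Implicit Types X : normedModType R.

Lemma integrable_mul_bounded (g : T -> R) : mu.-integrable D (EFin \o g) ->
  mu.-integrable D (EFin \o (fun t => g t * e t)).
Proof.
move=> gi; have gi' := @integrableZl _ _ _ mu D mD K _ gi.
apply: le_integrable gi' => //.
  apply/measurable_EFinP; apply: measurable_funM => //.
  by apply/measurable_EFinP; exact: measurable_int gi.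
move=> t Dt /=; rewrite lee_fin !normrM mulrC.
by rewrite (ger0_norm K0) ler_wpM2r// eK.
Qed.

Lemma integrable_indicator (A : set T) : measurable A -> 
  mu.-integrable D (EFin \o (\1_A : T -> R)).
Proof.
move=> mA; apply: measurable_bounded_integrable => //.
exists 1; split => // x x1 t _ /=; rewrite indicE.
by apply: le_trans (ltW x1); case: (_ \in _); rewrite ?normr1 ?normr0.
Qed.

(** The signed measure with density [e] on [D]. Summing simple functions against it defines the
    integral of F e for vector-valued F, with the bound [K] inherited from [e]. *)
Definition weight (A : set T) : R := \int[mu]_(t in D) (\1_A t * e t).

Lemma weight0 : weight set0 = 0.
Proof.
rewrite /weight; under eq_Rintegral do rewrite indic0 mul0r.
by rewrite Rintegral_cst// mul0r.
Qed.

Lemma weightU A B : measurable A -> measurable B -> A `&` B = set0 ->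
  weight (A `|` B) = weight A + weight B.
Proof.
move=> mA mB AB; rewrite /weight -RintegralD//; try exact/integrable_mul_bounded/integrable_indicator.
apply: eq_Rintegral => t _; rewrite -mulrDl; congr (_ * _).
rewrite !indicE in_setU.
have [tA|tA] := boolP (t \in A); have [tB|tB] := boolP (t \in B); rewrite ?addr0 ?add0r//.
exfalso; have : (A `&` B) t by split; exact: set_mem.
by rewrite AB.
Qed.

Lemma mu_le_lty A : measurable A -> (mu (D `&` A) < +oo)%E.
Proof.
move=> mA; apply: le_lt_trans muD; apply: le_measure; rewrite ?inE//.
exact: measurableI.
Qed.

Lemma weight_le A : measurable A -> `|weight A| <= K * fine (mu (D `&` A)).
Proof.
move=> mA; have iA := integrable_indicator mA; have iAe := integrable_mul_bounded iA.
apply: (le_trans (le_normr_Rintegral mD iAe)).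
apply: (@le_trans _ _ (\int[mu]_(t in D) (\1_A t * K))).
  apply: le_Rintegral => //.
  - exact: integrable_norm.
  - by have := @integrableZr _ _ _ mu D mD K _ iA.
  - by move=> t Dt; rewrite normrM ger0_norm// ler_wpM2l// eK.
rewrite RintegralZr// mulrC ler_wpM2l//.
by rewrite /Rintegral integral_indic// setIC.
Qed.

Lemma simple_integral_norm X (s : T -> X) : bochner_simple s ->
  (\int[mu]_(t in D) `|s t|%:E =
    (\sum_(x <- fset_set (range s)) fine (mu (D `&` s @^-1` [set x])) * `|x|)%:E)%E.
Proof.
move=> bs; have [fs ms] := bs.
transitivity (\int[mu]_(t in D)
    (\sum_(x <- fset_set (range s)) (`|x|%:E * (\1_(s @^-1` [set x]) t)%:E)))%E.
  apply: eq_integral => t _.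
  have bs' := bochner_simple_comp (fun x : X => `|x| : R) bs.
  rewrite (bigD1_seq (s t)) /= ?fset_uniq//; last by rewrite in_fset_set// inE; exists t.
  rewrite indicE mem_set//= mule1 big1 ?adde0// => x xs.
  rewrite indicE memNset ?mule0// => /= sx.
  by rewrite sx eqxx in xs.
have mi x : measurable_fun D (fun t => (\1_(s @^-1` [set x]) t : R)%:E).
  by apply/measurable_EFinP/measurable_indic.
rewrite ge0_integral_sum//; last by move=> x; exact: emeasurable_funM.
rewrite -sumEFin; apply: eq_bigr => x _.
rewrite ge0_integralZl//.
rewrite integral_indic// EFinM fineK; first by rewrite muleC setIC.
by rewrite ge0_fin_numE// mu_le_lty.
Qed.

Lemma wsum_le X (s : T -> X) : bochner_simple s ->
  (`|wsum weight s|%:E <= K%:E * \int[mu]_(t in D) `|s t|%:E)%E.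
Proof.
move=> bs; rewrite simple_integral_norm// -EFinM lee_fin.
have [fs ms] := bs; rewrite /wsum fsbig_finite//= mulr_sumr.
apply: le_trans (ler_norm_sum _ _ _) _; apply: ler_sum => x _.
by rewrite normrZ mulrA ler_wpM2r// weight_le.
Qed.

Lemma wsum_real (g : T -> R) : bochner_simple g ->
  wsum weight (g : T -> R^o) = \int[mu]_(t in D) (g t * e t).
Proof.
move=> bg; have [fg mg] := bg.
rewrite /wsum fsbig_finite//=.
have h i : mu.-integrable D (EFin \o (fun t => \1_(g @^-1` [set i]) t * e t)).
  exact/integrable_mul_bounded/integrable_indicator.
have h2 i : mu.-integrable D (EFin \o (fun t => \1_(g @^-1` [set i]) t * e t * i)).
  exact: (@integrableZr _ _ _ mu D mD i _ (h i)).
transitivity (\int[mu]_(t in D)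
   (\sum_(x <- fset_set (range g)) \1_(g @^-1` [set x]) t * e t * x)).
  rewrite (Rintegral_sum _ mD h2).2; apply: eq_bigr => x _.
  by rewrite RintegralZr.
apply: eq_Rintegral => t _.
have -> := simple_decomposition t (bg : bochner_simple (g : T -> R^o)).
rewrite mulr_suml; apply: eq_bigr => x _.
by rewrite scale1r mulrAC.
Qed.

Definition weighted_integral X (F : T -> X) (v : X) :=
  exists s : nat -> T -> X, [/\ forall n, bochner_simple (s n),
    (\int[mu]_(t in D) `|F t - s n t|%:E)%E @[n --> \oo] --> 0%E
    & wsum weight (s n) @[n --> \oo] --> v].

Lemma measurable_normB X (F G : T -> X) : strongly_measurable F -> strongly_measurable G ->
  measurable_fun D (fun t => `|F t - G t|%:E).
Proof.
move=> mF mG; apply/measurable_EFinP/measurable_funTS.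
have := strongly_measurable_norm (strongly_measurable_linear (-1) mG mF).
by under eq_fun do rewrite scaleN1r addrC.
Qed.

Lemma integral_norm_triangle X (F G H : T -> X) : strongly_measurable F ->
  strongly_measurable G -> strongly_measurable H ->
  (\int[mu]_(t in D) `|F t - H t|%:E <=
   \int[mu]_(t in D) `|F t - G t|%:E + \int[mu]_(t in D) `|G t - H t|%:E)%E.
Proof.
move=> mF mG mH; rewrite -ge0_integralD//; try exact: measurable_normB.
apply: ge0_le_lower_integral => // t _.
rewrite -EFinD lee_fin; exact: ler_distD.
Qed.

Lemma weighted_integral_linear X (a : R) (F G : T -> X) v v' :
  strongly_measurable F -> strongly_measurable G ->
  weighted_integral F v -> weighted_integral G v' ->
  weighted_integral (fun t => a *: F t + G t) (a *: v + v').
Proof.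
move=> mF mG [s [bs is_ cs]] [s' [bs' is' cs']].
exists (fun n t => a *: s n t + s' n t); split.
- by move=> n; exact: bochner_simple_linear.
- apply: (@squeeze_cvge _ _ _ _ (cst 0%E) _ (fun n => (`|a|%:E * \int[mu]_(t in D) `|F t - s n t|%:E
      + \int[mu]_(t in D) `|G t - s' n t|%:E)%E)).
  + apply: nearW => n; rewrite integral_ge0//=.
    have m1 := measurable_normB mF (strongly_measurable_simple (bs n)).
    have m2 := measurable_normB mG (strongly_measurable_simple (bs' n)).
    rewrite -ge0_integralZl// -ge0_integralD//; last first.
      by apply: emeasurable_funM => //; exact: measurable_cst.
    apply: ge0_le_lower_integral => // t _.
    rewrite -EFinM -EFinD lee_fin -normrZ scalerBr.
    rewrite (_ : _ - _ = (a *: F t - a *: s n t) + (G t - s' n t)); first exact: ler_normD.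
    by rewrite opprD addrACA.
  + exact: cvg_cst.
  + rewrite -[X in _ --> X](adde0 0%E); apply: cvgeD => //.
    by rewrite -[X in _ --> X](mule0 `|a|%:E); apply: cvgeZl => //.
- under eq_fun do rewrite (wsumD weight0 weightU)//.
  by apply: cvgD => //; apply: cvgZ => //; exact: cvg_cst.
Qed.

Lemma weighted_integral_le X (F : T -> X) v : strongly_measurable F ->
  weighted_integral F v ->
  (`|v|%:E <= K%:E * \int[mu]_(t in D) `|F t|%:E)%E.
Proof.
move=> mF [s [bs is_ cs]].
have cv : `|wsum weight (s n)|%:E @[n --> \oo] --> `|v|%:E.
  by apply: cvg_EFin; [exact: nearW|exact: cvg_norm].
set I := (\int[mu]_(t in D) `|F t|%:E)%E.
have I0 : (0 <= I)%E by exact: integral_ge0.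
have [Iy|Iy] := eqVneq I +oo%E.
  (* When K = 0 the right-hand side is 0 times [+oo], which is 0, so v itself has to be shown to
     vanish. *)
  have [K00|K00] := eqVneq K 0.
    have hz n : wsum weight (s n) = 0.
      apply/normr0_eq0/eqP; rewrite eq_le normr_ge0 andbT -lee_fin.
      by apply: (le_trans (wsum_le (bs n))); rewrite K00 mul0e.
    have -> : v = 0.
      have cs0 : wsum weight (s n) @[n --> \oo] --> (0 : X).
        by apply: cvg_near_cst; apply: nearW => n; exact: hz.
      exact: cvg_unique _ cs cs0.
    by rewrite normr0 K00 mul0e.
  by rewrite Iy gt0_muley ?leey// lte_fin lt_neqAle eq_sym K00.
have cI : (K%:E * (I + \int[mu]_(t in D) `|F t - s n t|%:E))%E @[n --> \oo] --> (K%:E * (I + 0))%E.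
  apply: cvgeZl => //; apply: cvgeD => //; last exact: cvg_cst.
  by rewrite fin_num_adde_defl.
rewrite -[I]adde0; apply: (lee_cvg_to cv cI); apply: nearW => n.
apply: (le_trans (wsum_le (bs n))); apply: lee_pmul => //.
  by rewrite integral_ge0.
have m0 : strongly_measurable (fun _ : T => 0 : X).
  exact/strongly_measurable_simple/bochner_simple_cst.
have := integral_norm_triangle m0 mF (strongly_measurable_simple (bs n)).
under eq_integral do rewrite sub0r normrN.
by under [X in (_ <= X + _)%E -> _]eq_integral do rewrite sub0r normrN.
Qed.

(** Completeness of X enters here: simple approximations in L^1 have Cauchy weighted sums. *)
Lemma weighted_integral_exists (X : completeNormedModType R) (F : T -> X) :
  strongly_measurable F -> (\int[mu]_(t in D) `|F t|%:E < +oo)%E ->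
  exists v, weighted_integral F v.
Proof.
move=> mF Foo; have [s [bs _ cs]] := simple_L1_dense mD mF Foo.
suff cv : cvg (wsum weight (s n) @[n --> \oo]) by exists (lim (wsum weight (s n) @[n --> \oo])), s.
have [cs1 cs2] := (fine_cvgP _ _).1 cs.
apply/cauchy_cvgP/cauchy_exP => eps eps0.
pose I n := (\int[mu]_(t in D) `|F t - s n t|%:E)%E.
have c0 : 0 < eps / (K + 1) / 2 by rewrite !divr_gt0// ltr_wpDl.
have : \forall n \near \oo, (I n < (eps / (K + 1) / 2)%:E)%E.
  near=> n.
  have In : I n \is a fin_num by near: n.
  rewrite -(fineK In) lte_fin; near: n.
  exact: (cvgr_lt 0).
move=> [n0 _ hn0].
exists (wsum weight (s n0)).
suff : \forall p \near \oo, ball (wsum weight (s n0)) eps (wsum weight (s p)) by [].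
exists n0 => // p /= np; rewrite -ball_normE/=.
have -> : wsum weight (s n0) - wsum weight (s p) =
    wsum weight (fun t => (-1) *: s p t + s n0 t).
  by rewrite (wsumD weight0 weightU)// scaleN1r addrC.
rewrite -lte_fin; apply: le_lt_trans (wsum_le _) _; first exact: bochner_simple_linear.
apply: (@le_lt_trans _ _ (K%:E * (I n0 + I p))%E).
  apply: lee_pmul => //; first by rewrite integral_ge0.
  under eq_integral do rewrite scaleN1r addrC.
  have := integral_norm_triangle (strongly_measurable_simple (bs n0)) mF
    (strongly_measurable_simple (bs p)).
  by under [X in (_ <= X + _)%E -> _]eq_integral do rewrite distrC.
apply: (@le_lt_trans _ _ (K%:E * (eps / (K + 1))%:E)%E).
  apply: lee_pmul => //; first by rewrite adde_ge0// integral_ge0.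
  rewrite [X in X%:E]splitr EFinD; apply: leeD; apply/ltW/hn0 => //=.
rewrite -EFinM lte_fin mulrCA -[ltRHS]mulr1 ltr_pM2l//.
by rewrite ltr_pdivrMr ?ltr_wpDl// mul1r ltrDl.
Unshelve. all: by end_near. Qed.

End weighted_integral.

Section bochner_functional.
Import HBSimple.
Context (d : measure_display) (T : measurableType d) (R : realType).
Variable mu : {measure set T -> \bar R}.
Variables (D : set T) (mD : measurable D) (muD : (mu D < +oo)%E).
Variable X : completeNormedModType R.
Implicit Types f g : T -> X.

Lemma L1X_representative f : L1X mu D f -> exists F,
  [/\ strongly_measurable F, {ae mu, forall t, D t -> f t = F t},
    (\int[mu]_(t in D) `|F t|%:E < +oo)%E
  & (\int[mu]_(t in D) `|f t|%:E = \int[mu]_(t in D) `|F t|%:E)%E].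
Proof.
move=> [/bochner_measurable_representative[//|F [mF fF Ff]] foo]; exists F.
by rewrite -(ae_eq_integral_norm mD mF fF Ff).
Qed.

Lemma integral_norm_linear (a : R) (F G : T -> X) : strongly_measurable F ->
  strongly_measurable G ->
  (\int[mu]_(t in D) `|a *: F t + G t|%:E <=
   `|a|%:E * \int[mu]_(t in D) `|F t|%:E + \int[mu]_(t in D) `|G t|%:E)%E.
Proof.
move=> mF mG.
have mnF : measurable_fun D (fun t => `|F t|%:E).
  by apply/measurable_EFinP/measurable_funTS/strongly_measurable_norm.
have mnG : measurable_fun D (fun t => `|G t|%:E).
  by apply/measurable_EFinP/measurable_funTS/strongly_measurable_norm.
rewrite -ge0_integralZl// -ge0_integralD//; last exact: emeasurable_funM.
apply: ge0_le_lower_integral => // t _.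
by rewrite -EFinM -EFinD lee_fin -normrZ ler_normD.
Qed.

Lemma L1X_linear (a : R) f g : L1X mu D f -> L1X mu D g ->
  L1X mu D (fun t => a *: f t + g t).
Proof.
move=> /L1X_representative[F [mF fF Foo _]] /L1X_representative[G [mG gG Goo _]].
apply: (@L1X_of_representative _ _ _ _ _ _ _ (fun t => a *: F t + G t)) => //.
- exact: strongly_measurable_linear.
- by apply: filterS2 fF gG => t hF hG Dt; rewrite hF// hG.
apply: (le_lt_trans (integral_norm_linear a mF mG)).
rewrite lte_add_pinfty// -ge0_fin_numE ?mule_ge0 ?integral_ge0//.
by rewrite fin_numM// ge0_fin_numE// integral_ge0.
Qed.

Lemma bochner_simple_sfun (g : {sfun T >-> R}) : bochner_simple g.
Proof. by split; [exact: fimfunP|move=> x; exact: measurable_sfunP]. Qed.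

Lemma L1X_tensor (f : T -> R) (x : X) : mu.-integrable D (EFin \o f) ->
  L1X mu D (fun t => f t *: x).
Proof.
move=> fi; have [g [_ gf _]] := approximation_sfun_integrable mD fi.
split.
  exists (fun n t => g n t *: x); split => [n|].
    exact: (bochner_simple_comp (fun r : R => r *: x) (bochner_simple_sfun (g n))).
  apply: aeW => t /gf h; apply: cvgZ; last exact: cvg_cst.
  by move/fine_cvgP : h => [_].
have /integrableP[mf foo] := fi.
under eq_integral do rewrite normrZ EFinM.
rewrite ge0_integralZr//; last first.
  by apply/measurable_EFinP; apply: measurableT_comp => //; apply/measurable_EFinP.
by rewrite -ge0_fin_numE ?mule_ge0 ?integral_ge0// fin_numM// ge0_fin_numE// integral_ge0.
Qed.

Variables (e : T -> R) (K : R).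
Hypothesis me : measurable_fun D e.
Hypothesis eK : forall t, D t -> `|e t| <= K.
Hypothesis K0 : 0 <= K.

Lemma weighted_integral_unique (F G : T -> X) v v' :
  strongly_measurable F -> strongly_measurable G ->
  {ae mu, forall t, D t -> F t = G t} ->
  weighted_integral mu D e F v -> weighted_integral mu D e G v' -> v = v'.
Proof.
move=> mF mG FG iF iG.
have := weighted_integral_linear mD muD me eK K0 (-1) mF mG iF iG.
move/(weighted_integral_le mD muD me eK K0 (strongly_measurable_linear _ mF mG)).
rewrite (_ : (\int[mu]_(t in D) _)%E = 0%E) ?mule0 ?lee_fin; last first.
  apply/eqP; rewrite eq_le integral_ge0// andbT.
  apply: (@le_trans _ _ (\int[mu]_(t in D) cst 0%E t)%E); last by rewrite integral_cst// mul0e.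
  apply: ae_ge0_le_lower_integral => //.
  by apply: filterS FG => t h Dt; rewrite h// scaleN1r addNr normr0.
rewrite normr_le0 scaleN1r addrC subr_eq0 => /eqP //.
Qed.

Lemma bochner_functional_exists : exists I : (T -> X) -> X, [/\
  forall (a : R) f g, L1X mu D f -> L1X mu D g ->
    I (fun t => a *: f t + g t) = a *: I f + I g,
  forall f, L1X mu D f -> (`|I f|%:E <= K%:E * \int[mu]_(t in D) `|f t|%:E)%E
  & forall (f : T -> R) (x : X), mu.-integrable D (EFin \o f) ->
    I (fun t => f t *: x) = (\int[mu]_(t in D) (f t * e t)) *: x].
Proof.
have /choice[I hI] : forall f, exists v, L1X mu D f -> exists F,
  [/\ strongly_measurable F, {ae mu, forall t, D t -> f t = F t},
    (\int[mu]_(t in D) `|f t|%:E = \int[mu]_(t in D) `|F t|%:E)%E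
   & weighted_integral mu D e F v].
  move=> f; have [/L1X_representative[F [mF fF Foo fFI]]|nf] := pselect (L1X mu D f); last by exists 0.
  have [v hv] := weighted_integral_exists mD muD me eK K0 mF Foo.
  by exists v => _; exists F.
exists I; split.
- move=> a f g L1f L1g.
  have [F [mF fF _ iF]] := hI f L1f; have [G [mG gG _ iG]] := hI g L1g.
  have [H [mH hH _ iH]] := hI _ (L1X_linear a L1f L1g).
  have iFG := weighted_integral_linear mD muD me eK K0 a mF mG iF iG.
  apply: (weighted_integral_unique mH (strongly_measurable_linear a mF mG) _ iH iFG).
  by apply: filterS3 fF gG hH => t h1 h2 h3 Dt; rewrite -h3// h1// h2.
- move=> f L1f; have [F [mF fF -> iF]] := hI f L1f.
  exact: weighted_integral_le iF.
- move=> f x fi; have [F [mF fF _ iF]] := hI _ (L1X_tensor x fi).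
  apply: (weighted_integral_unique mF mF (aeW _ (fun t _ => erefl)) iF).
  have [g [gi gf gcv]] := approximation_sfun_integrable mD fi.
  have bg n := bochner_simple_sfun (g n).
  exists (fun n t => g n t *: x); split.
  + by move=> n; exact: (bochner_simple_comp (fun r : R => r *: x) (bg n)).
  + apply: (@squeeze_cvge _ _ _ _ (cst 0%E) _ (fun n =>
      (`|x|%:E * \int[mu]_(t in D) `|(f t)%:E - (g n t)%:E|)%E)).
    * apply: nearW => n; rewrite integral_ge0//=.
      have m1 : measurable_fun D (fun t => `|(f t)%:E - (g n t)%:E|%E).
        apply: measurableT_comp => //; apply: emeasurable_funB.
          exact: measurable_int fi.
        exact: measurable_int (gi n).
      rewrite -ge0_integralZl//.
      apply: ae_ge0_le_lower_integral => //; first exact: emeasurable_funM.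
      apply: filterS fF => t h Dt; rewrite -h// -scalerBl normrZ.
      by rewrite -EFinM lee_fin mulrC.
    * exact: cvg_cst.
    * by rewrite -[X in _ --> X](mule0 `|x|%:E); apply: cvgeZl.
  + have hw n : wsum (weight mu D e) (fun t => g n t *: x) = (\int[mu]_(t in D) (g n t * e t)) *: x.
      rewrite -(wsum_real mD muD me eK K0 (bg n)).
      rewrite -[LHS]/(wsum (weight mu D e) ((fun r : R => r *: x) \o g n)).
      rewrite (wsum_comp (weight0 mu mD e) (weightU mD muD me eK K0) _ (bg n)).
      rewrite /wsum !fsbig_finite//=; try by case: (bg n).
      by rewrite scaler_suml; apply: eq_bigr => r _; rewrite scalerA.
    under eq_fun do rewrite hw.
    apply: cvgZ; last exact: cvg_cst.
    have cK : (K%:E * \int[mu]_(t in D) `|(f t)%:E - (g n t)%:E|)%E @[n --> \oo] --> 0%E.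
      by rewrite -[X in _ --> X](mule0 K%:E); apply: cvgeZl.
    apply/cvgrPdist_lt => eps eps0.
    have /fine_cvgP[cK1 cK2] := cK.
    near=> n.
    have cn : (K%:E * \int[mu]_(t in D) `|(f t)%:E - (g n t)%:E| < eps%:E)%E.
      have h : (K%:E * \int[mu]_(t in D) `|(f t)%:E - (g n t)%:E|)%E \is a fin_num by near: n.
      by rewrite -(fineK h) lte_fin; near: n; exact: (cvgr_lt 0).
    have ife := integrable_mul_bounded mD me eK K0 fi.
    have ige := integrable_mul_bounded mD me eK K0 (gi n).
    rewrite -RintegralB// -lte_fin.
    have ifg : mu.-integrable D (EFin \o (fun t => f t * e t - g n t * e t)).
      by have := integrableB mD ife ige.
    rewrite EFin_normr_Rintegral//.
    apply: le_lt_trans cn; have /integrableP[mfg _] := ifg.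
    apply: (le_trans (le_abse_integral mu mD mfg)).
    have m1 : measurable_fun D (fun t => `|(f t)%:E - (g n t)%:E|%E).
      apply: measurableT_comp => //; apply: emeasurable_funB.
        exact: measurable_int fi.
      exact: measurable_int (gi n).
    rewrite -ge0_integralZl//; apply: ge0_le_lower_integral => // t Dt.
    rewrite /= lee_fin -mulrBl normrM mulrC.
    by rewrite ler_wpM2r// eK.
Unshelve. all: by end_near. Qed.

End bochner_functional.

(** * Splines over an interval partition *)

Definition interval_partition (R : realType) (P : set (set R)) :=
  [/\ finite_set P, partition P id (@I01 R)
    & forall A, P A -> is_interval A /\ (0 < lebesgue_measure A)%E].

Definition refines (T : Type) (P' P : set (set T)) :=
  forall B, P' B -> exists2 A, P A & B `<=` A.

(** The sets that contain [A] or miss it form a sigma-algebra on [D], and by disjointness this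
    sigma-algebra contains [P]. *)
Lemma partition_dichotomy (T : Type) (D : set T) (P : set (set T)) :
  partition P id D -> forall A B, P A -> <<s D, P >> B ->
  A `<=` B \/ A `&` B = set0.
Proof.
move=> [cP tP nP] A B PA; apply: (smallest_sub (C := sigma_algebra D) (X := [set B | _ \/ _])).
- split.
  + by right; rewrite setI0.
  + move=> C [AC|AC].
      by right; apply/seteqP; split => // t [At [_ nCt]]; apply: nCt; exact: AC.
    left => t At; split; first by rewrite -cP; exists A.
    by move=> Ct; have : (A `&` C) t by []; rewrite AC.
  + move=> C hC; have [[i AC]|nC] := pselect (exists i, A `<=` C i).
      by left => t At; exists i => //; exact: AC.
    right; apply/seteqP; split => // t [At [i _ Ct]].
    case: (hC i) => [AC|AC]; first by apply: nC; exists i.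
    by rewrite -AC.
- move=> C PC /=; have [[t [At Ct]]|nAC] := pselect ((A `&` C) !=set0).
    by left; rewrite (tP A C) //; exists t.
  right; apply/seteqP; split => // t At; apply: nAC; by exists t.
Qed.

(** From here on the generating partition can be forgotten and recovered as [atom (F n)]. *)
Lemma atom_generated (T : Type) (D : set T) (P : set (set T)) :
  partition P id D -> forall A, atom <<s D, P >> A <-> P A.
Proof.
move=> hP; have [cP tP nP] := hP; move=> A; split.
- move=> [GA [t At] hA].
  have Dt : D t.
    move: A GA t At {hA}; apply: (smallest_sub (C := sigma_algebra D)) => //.
      split => //; first by move=> A hA t [].
      by move=> A hA t [i _ /hA].
    by move=> A PA t At; rewrite -cP; exists A.
  move: Dt; rewrite -cP => -[B PB /= Bt].
  have [BA|BA] := partition_dichotomy hP PB GA; last first.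
    by have : (B `&` A) t by []; rewrite BA.
  have [B0|<-//] := hA B (@sub_sigma_algebra _ D P B PB) BA.
  by move: Bt; rewrite B0.
- move=> PA; split; [exact: sub_sigma_algebra|exact: nP|].
  move=> B GB BA; have [AB|AB] := partition_dichotomy hP PA GB.
    by right; apply/seteqP.
  left; apply/seteqP; split => // t Bt; rewrite -AB; split => //; exact: BA.
Qed.

Section filtration_atoms.
Context (R : realType) (F : nat -> set (set R)).
Hypothesis hF : interval_filtration F.

Lemma filtration_partition n : interval_partition (atom (F n)).
Proof.
have [_ /(_ n)[P [fP pP iP ->]]] := hF.
suff -> : atom <<s @I01 R, P >> = P by [].
by apply/seteqP; split => A; rewrite (atom_generated pP).
Qed.

Lemma filtration_refines_succ n : refines (atom (F n.+1)) (atom (F n)).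
Proof.
move=> B aB; have [hinc /(_ n)[P [fP pP iP FE]]] := hF.
have [_ /(_ n.+1)[P' [fP' pP' iP' FE']]] := hF.
have aP A : atom (F n) A <-> P A by rewrite FE; exact: atom_generated.
have aP' A : atom (F n.+1) A <-> P' A by rewrite FE'; exact: atom_generated.
have PB := (aP' B).1 aB.
have [cP _ _] := pP; have [cP' _ nP'] := pP'.
have [t Bt] := nP' _ PB.
have : (@I01 R) t by rewrite -cP'; exists B.
rewrite -cP => -[A PA /= At]; exists A; first exact/aP.
have FA : <<s @I01 R, P' >> A.
  by rewrite -FE'; apply: hinc; rewrite FE; exact: sub_sigma_algebra.
have [//|BA] := partition_dichotomy pP' PB FA.
by have : (B `&` A) t by []; rewrite BA.
Qed.

Lemma filtration_refines m n : (m <= n)%N -> refines (atom (F n)) (atom (F m)).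
Proof.
move=> /subnK <-; elim: (n - m)%N => [|i IH] B aB; first by exists B.
have [A /IH[C aC AC] BA] := filtration_refines_succ aB.
by exists C => //; exact: subset_trans AC.
Qed.

End filtration_atoms.

Section interval_partition_theory.
Context (R : realType) (P : set (set R)).
Hypothesis hP : interval_partition P.
Local Notation mu := (@lebesgue_measure R).

Lemma partition_sub A : P A -> A `<=` @I01 R.
Proof. by move=> PA t At; have [_ [<- _ _] _] := hP; exists A. Qed.

Lemma partition_in t : I01 t -> exists2 A, P A & A t.
Proof. by have [_ [<- _ _] _] := hP. Qed.

Lemma partition_eq A B t : P A -> P B -> A t -> B t -> A = B.
Proof. by move=> PA PB At Bt; have [_ [_ tP _] _] := hP; apply: tP => //; exists t. Qed.

Lemma partition_measurable A : P A -> measurable A.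
Proof. by move=> PA; have [_ _ /(_ A PA)[iA _]] := hP; exact: is_interval_measurable. Qed.

Lemma lebesgue_I01 : mu (@I01 R) = 1%E.
Proof. by rewrite lebesgue_measure_itv/= lte_fin ltr01 EFinN sube0. Qed.

Lemma lebesgue_I01_lty : (mu (@I01 R) < +oo)%E.
Proof. by rewrite lebesgue_I01 ltry. Qed.

Lemma measurable_I01 : (measurable : set (set (measurableTypeR R))) (@I01 R).
Proof. exact: measurable_itv. Qed.

End interval_partition_theory.

Section C01_theory.
Context (R : realType).
Implicit Types f g : R -> R.

Lemma has_derivative01_linear (a : R) f f' g g' :
  has_derivative01 f f' -> has_derivative01 g g' ->
  has_derivative01 (fun t => a * f t + g t) (fun t => a * f' t + g' t).
Proof.
move=> df dg t It; have h1 := df t It; have h2 := dg t It.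
have : a * ((f s - f t) / (s - t)) + (g s - g t) / (s - t)
    @[s --> within [set s | I01 s /\ s != t] (nbhs t)] --> a * f' t + g' t.
  by apply: cvgD => //; apply: cvgM => //; exact: cvg_cst.
by apply: cvg_trans; apply: near_eq_cvg; apply: nearW => s /=; ring.
Qed.

Lemma C01_linear m (a : R) f g : C01 m f -> C01 m g -> C01 m (fun t => a * f t + g t).
Proof.
elim: m f g => [|m IH] f g /=.
  move=> cf cg x; apply: cvgD; last exact: cg.
  by apply: cvgM; [exact: cvg_cst|exact: cf].
move=> [f' df cf] [g' dg cg]; exists (fun t => a * f' t + g' t).
  exact: has_derivative01_linear.
exact: IH.
Qed.

Lemma C01_cst m (c : R) : C01 m (fun=> c).
Proof.
elim: m c => [|m IH] c /=; first by move=> x; exact: cvg_cst.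
exists (fun=> 0) => // t It; apply: cvg_near_cst; apply: nearW => s.
by rewrite subrr mul0r.
Qed.

End C01_theory.

Section poly_on_I01.
Context (R : realType).

Lemma horner_lipschitz (p : {poly R}) : exists C, [/\ 0 <= C,
  forall t, I01 t -> `|p.[t]| <= C
  & forall s t, I01 s -> I01 t -> `|p.[s] - p.[t]| <= C * `|s - t| ].
Proof.
elim/poly_ind: p => [|p c [C [C0 hb hl]]].
  exists 0; split => // [t _|s t _ _]; first by rewrite horner0 normr0.
  by rewrite !horner0 subrr normr0 mul0r.
have n1 (t : R) : I01 t -> `|t| <= 1.
  by rewrite /I01/= in_itv/= => /andP[t0 t1]; rewrite ger0_norm.
exists (2 * C + `|c|); split.
- by rewrite addr_ge0// mulr_ge0.
- move=> t It; rewrite !hornerE; apply: le_trans (ler_normD _ _) _.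
  rewrite lerD2r normrM; have := hb t It; have := n1 t It.
  by have := normr_ge0 t; have := normr_ge0 p.[t]; nra.
- move=> s t Is It; rewrite !hornerE.
  have -> : p.[s] * s + c - (p.[t] * t + c) = p.[s] * (s - t) + (p.[s] - p.[t]) * t by ring.
  apply: le_trans (ler_normD _ _) _; rewrite !normrM.
  have := hb s Is; have := hl s t Is It; have := n1 t It.
  have := normr_ge0 (s - t); have := normr_ge0 c; have := normr_ge0 t.
  move: (`|s - t|) (`|c|) (`|t|) (`|p.[s] - p.[t]|) (`|p.[s]|) => x y z u v z0 y0 x0 z1 uC vC.
  have h1 : v * x <= C * x by rewrite ler_wpM2r.
  have h2 : u * z <= C * x * 1.
    apply: (@le_trans _ _ (C * x * z)); first by rewrite ler_wpM2r.
    by rewrite ler_wpM2l// mulr_ge0.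
  have h3 : 0 <= y * x by rewrite mulr_ge0.
  lra.
Qed.

Lemma measurable_horner (p : {poly R}) (D : set R) : measurable_fun D (fun t => p.[t]).
Proof.
elim/poly_ind: p => [|p c IH].
  by under eq_fun do rewrite horner0; exact: measurable_cst.
by under eq_fun do rewrite !hornerE; apply: measurable_funD => //; exact: measurable_funM.
Qed.

End poly_on_I01.

Section spline_theory.
Context (R : realType) (G : set (set R)) (k : nat).
Hypothesis hG : interval_partition (atom G).
Implicit Types f g : R -> R.

Lemma spline_linear (a : R) f g : spline G k f -> spline G k g ->
  spline G k (fun t => a * f t + g t).
Proof.
move=> [cf pf] [cg pg]; split.
  by move=> k2; apply: C01_linear; [exact: cf|exact: cg].
move=> A aA; have [p sp hp] := pf A aA; have [q sq hq] := pg A aA.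
exists (a *: p + q).
  by rewrite (leq_trans (size_polyD _ _))// geq_max sq andbT (leq_trans (size_scale_leq _ _)).
by move=> t At; rewrite hornerD hornerZ hp// hq.
Qed.

Lemma spline0 : spline G k (fun=> 0).
Proof.
split; first by move=> _; exact: C01_cst.
by move=> A _; exists 0 => [|t _]; rewrite ?size_poly0// horner0.
Qed.

Lemma spline_cst (c : R) : (0 < k)%N -> spline G k (fun=> c).
Proof.
move=> k0; split; first by move=> _; exact: C01_cst.
move=> A _; exists c%:P => [|t _]; rewrite ?hornerC//.
by rewrite (leq_trans (size_polyC_leq1 _)).
Qed.

Lemma spline_scale (a : R) f : spline G k f -> spline G k (fun t => a * f t).
Proof.
by move=> sf; have := spline_linear a sf spline0; under eq_fun do rewrite addr0.
Qed.

Lemma spline_sum (I : eqType) (r : seq I) (c : I -> R) (f : I -> R -> R) :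
  (forall i, i \in r -> spline G k (f i)) -> spline G k (fun t => \sum_(i <- r) c i * f i t).
Proof.
elim: r => [|i r IH] h.
  by under eq_fun do rewrite big_nil; exact: spline0.
under eq_fun do rewrite big_cons; apply: spline_linear.
  by apply: h; rewrite mem_head.
by apply: IH => j jr; apply: h; rewrite inE jr orbT.
Qed.

(** The Lipschitz bound is confined to an atom because splines of order 1 may jump between atoms. It
    follows from the polynomial pieces, of which there are finitely many. *)
Lemma spline_lipschitz f : spline G k f -> exists C, [/\ 0 <= C,
  forall t, I01 t -> `|f t| <= C
  & forall A s t, atom G A -> A s -> A t -> `|f s - f t| <= C * `|s - t| ].
Proof.
move=> [_ pf].
have /choice[C hC] : forall A, exists C, 0 <= C /\ (atom G A ->
    (forall t, A t -> `|f t| <= C) /\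
    (forall s t, A s -> A t -> `|f s - f t| <= C * `|s - t|)).
  move=> A; have [aA|naA] := pselect (atom G A); last by exists 0; split.
  have [p sp hp] := pf A aA; have [C [C0 hb hl]] := horner_lipschitz p.
  have AI := partition_sub hG aA.
  exists C; split => // _; split => [t At|s t As At].
    by rewrite hp//; exact/hb/AI.
  by rewrite !hp//; apply: hl; exact: AI.
have fG : finite_set (atom G) by case: hG.
have CA A : atom G A -> C A <= \sum_(B <- fset_set (atom G)) C B.
  move=> aA; rewrite (bigD1_seq A) ?fset_uniq//=; last by rewrite in_fset_set// inE.
  by rewrite lerDl sumr_ge0// => B _; case: (hC B).
exists (\sum_(B <- fset_set (atom G)) C B); split.
- by rewrite sumr_ge0// => B _; case: (hC B).
- move=> t /(partition_in hG)[A aA At]; apply: le_trans (CA A aA).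
  by have [_ /(_ aA)[h _]] := hC A; exact: h.
- move=> A s t aA As At; have [_ /(_ aA)[_ h]] := hC A.
  by apply: (le_trans (h s t As At)); rewrite ler_wpM2r// CA.
Qed.

Lemma spline_measurable f : spline G k f -> measurable_fun (@I01 R) f.
Proof.
move=> [_ pf].
have /choice[p hp] : forall A, exists p : {poly R}, atom G A -> forall t, A t -> f t = p.[t].
  move=> A; have [aA|naA] := pselect (atom G A); last by exists 0.
  by have [p sp hp] := pf A aA; exists p.
have fG : finite_set (atom G) by case: hG.
pose B A := if `[< atom G A >] then A else set0.
have mB A : measurable (B A).
  by rewrite /B; case: asboolP => // aA; exact: (partition_measurable hG).
apply: (@eq_measurable_fun _ _ _ _ _
  (fun t => \sum_(A <- fset_set (atom G)) (\1_(B A) t * (p A).[t]))).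
  move=> t /set_mem It; have [A aA At] := partition_in hG It.
  have BA : B A = A by rewrite /B; case: asboolP.
  rewrite (bigD1_seq A) ?fset_uniq//=; last by rewrite in_fset_set// inE.
  rewrite indicE mem_set ?BA//= mul1r -(hp A aA t At) big1 ?addr0// => C CA.
  rewrite indicE memNset ?mul0r// /B; case: asboolP => [aC Ct|_ []].
  by move/eqP : CA; apply; exact: (partition_eq hG aC aA Ct At).
apply: measurable_sum => A.
apply: measurable_funM; last exact: measurable_horner.
exact: measurable_indic.
Qed.

(** An atom has positive measure, so it keeps infinitely many points outside a null set, and a
    polynomial vanishing at all of them is 0. *)
Lemma spline_ae0 f : spline G k f -> {ae lebesgue_measure, forall t, I01 t -> f t = 0} ->
  forall t, I01 t -> f t = 0.
Proof.
move=> [_ pf] [N [mN N0 hN]] t It; have [A aA At] := partition_in hG It.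
have [p _ hp] := pf A aA; rewrite hp//.
suff -> : p = 0 by rewrite horner0.
apply: contrapT => /eqP p0.
have : infinite_set (A `\` N).
  move=> /finite_set_countable/countable_lebesgue_measure0 AN.
  have [_ _ /(_ A aA)[_]] := hG.
  rewrite ltNge => /negP; apply.
  have mA := partition_measurable hG aA.
  rewrite -(setDUK (_ : A `&` N `<=` A)); last exact: subIsetl.
  apply: le_trans (measureU2 _ _ _) _.
  - exact: measurableI.
  - by apply: measurableD => //; exact: measurableI.
  rewrite setDIr setDv set0U [X in (_ + X)%E]AN adde0 -N0.
  by apply: le_measure; rewrite ?inE//; exact: measurableI.
move=> /(infinite_set_fset (size p))[B BA sB].
have : (size (enum_fset B) < size p)%N.
  apply: max_poly_roots => //; last exact: fset_uniq.
  apply/allP => x xB; have [Ax Nx] : (A `\` N) x by apply: BA.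
  apply/eqP; rewrite -hp//; apply: contrapT => fx; apply: Nx; apply: hN => /= h.
  by apply: fx; apply: h; exact: (partition_sub hG aA).
by rewrite ltnNge sB.
Qed.

End spline_theory.

Lemma spline_refines (R : realType) (G G' : set (set R)) k f :
  refines (atom G') (atom G) -> spline G k f -> spline G' k f.
Proof.
move=> hr [cf pf]; split => // B aB; have [A aA BA] := hr B aB.
by have [p sp hp] := pf A aA; exists p => // t Bt; apply: hp; exact: BA.
Qed.

Definition inner (R : realType) (f g : R -> R) : R :=
  \int[lebesgue_measure]_(t in @I01 R) (f t * g t).

(** * Inner products and orthonormal bases of splines *)

Section inner_theory.
Context (R : realType) (G : set (set R)) (k : nat).
Hypothesis hG : interval_partition (atom G).
Implicit Types f g : R -> R.
Local Notation mu := (@lebesgue_measure R).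

Lemma innerC f g : inner f g = inner g f.
Proof. by apply: eq_Rintegral => t _; rewrite mulrC. Qed.

Lemma L1R_linear (a : R) f g : L1R f -> L1R g -> L1R (fun t => a * f t + g t).
Proof.
move=> fi gi; have := integrableD (@measurable_I01 R) (integrableZl (@measurable_I01 R) a fi) gi.
exact.
Qed.

Lemma spline_L1R f : spline G k f -> L1R f.
Proof.
move=> sf; have [C [C0 fC _]] := spline_lipschitz hG sf.
apply: measurable_bounded_integrable.
- exact: measurable_I01.
- exact: lebesgue_I01_lty.
- exact: spline_measurable sf.
exists C; split; first exact: num_real.
by move=> x Cx t It; apply: ltW; apply: le_lt_trans Cx; exact: fC.
Qed.

Lemma L1R_mul_spline f (e : R -> R) : L1R f -> spline G k e -> mu.-integrable (@I01 R) (EFin \o (fun t => f t * e t)).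
Proof.
move=> fi se; have [C [C0 eC _]] := spline_lipschitz hG se.
exact: (integrable_mul_bounded (@measurable_I01 R) (spline_measurable hG se) eC C0 fi).
Qed.

Lemma inner_linear (a : R) f g (e : R -> R) : L1R f -> L1R g -> spline G k e ->
  inner (fun t => a * f t + g t) e = a * inner f e + inner g e.
Proof.
move=> fi gi se; have ife := L1R_mul_spline fi se; have ige := L1R_mul_spline gi se.
rewrite /inner -RintegralZl//; last exact: measurable_I01.
rewrite -RintegralD//; last 2 first.
- exact: measurable_I01.
- by have := integrableZl (@measurable_I01 R) a ife.
by apply: eq_Rintegral => t _; ring.
Qed.

Lemma inner0 (e : R -> R) : inner (fun=> 0) e = 0.
Proof.
rewrite /inner; under eq_Rintegral do rewrite mul0r.
by rewrite Rintegral_cst ?mul0r//; exact: measurable_I01.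
Qed.

Lemma L1R0 : L1R (fun=> 0 : R).
Proof.
rewrite /L1R/= (_ : _ \o _ = cst 0%E); last exact/funext.
by apply: integrable0; exact: measurable_I01.
Qed.

Lemma L1R_sum (I : eqType) (r : seq I) (c : I -> R) (f : I -> R -> R) :
  (forall i, i \in r -> L1R (f i)) -> L1R (fun t => \sum_(i <- r) c i * f i t).
Proof.
elim: r => [|i r IH] h.
  under eq_fun do rewrite big_nil.
  exact: L1R0.
under eq_fun do rewrite big_cons.
apply: L1R_linear; first by apply: h; rewrite mem_head.
by apply: IH => j jr; apply: h; rewrite inE jr orbT.
Qed.

Lemma inner_sum (I : eqType) (r : seq I) (c : I -> R) (f : I -> R -> R) (e : R -> R) :
  (forall i, i \in r -> L1R (f i)) -> spline G k e ->
  inner (fun t => \sum_(i <- r) c i * f i t) e = \sum_(i <- r) c i * inner (f i) e.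
Proof.
move=> + se; elim: r => [|i r IH] h.
  by rewrite big_nil; under eq_fun do rewrite big_nil; exact: inner0.
under eq_fun do rewrite big_cons.
have hr j : j \in r -> L1R (f j) by move=> jr; apply: h; rewrite inE jr orbT.
rewrite inner_linear//; first by rewrite IH// big_cons.
- by apply: h; rewrite mem_head.
- exact: L1R_sum.
Qed.

Lemma inner_eq0 f : spline G k f -> inner f f = 0 -> forall t, I01 t -> f t = 0.
Proof.
move=> sf ff0; apply: (spline_ae0 hG sf).
have fi := L1R_mul_spline (spline_L1R sf) sf.
have mI := @measurable_I01 R.
have : (\int[mu]_(t in @I01 R) `|(f t * f t)%:E| = 0)%E.
  have -> : (\int[mu]_(t in @I01 R) `|(f t * f t)%:E| = \int[mu]_(t in @I01 R) (f t * f t)%:E)%E.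
    by apply: eq_integral => t _; rewrite gee0_abs// lee_fin -expr2 sqr_ge0.
  by rewrite -[LHS]fineK; [congr (_%:E)|exact: integrable_fin_num].
move/(ae_eq_integral_abs mu mI (measurable_int mu fi)).1.
apply: filterS => t h /h /=[] /eqP.
by rewrite mulf_eq0 orbb => /eqP.
Qed.

Definition orthonormal_family d (e : nat -> R -> R) :=
  (forall i, (i < d)%N -> spline G k (e i)) /\
  (forall i j, (i < d)%N -> (j < d)%N -> inner (e i) (e j) = (i == j)%:R).

(** A spline is determined on [0,1] by its [k] coefficients on each atom. A larger family has
    linearly dependent coefficient vectors, and pairing the dependence with each [e j] makes all its
    coefficients 0. *)
Lemma orthonormal_family_size (d : nat) (e : nat -> R -> R) : orthonormal_family d e ->
  (d <= size (fset_set (atom G)) * k)%N.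
Proof.
move=> [se oe]; rewrite leqNgt; apply/negP => dN.
set s : seq (set R) := fset_set (atom G) in dN *.
have /choice[p hp] : forall i, exists p : set R -> {poly R}, (i < d)%N -> forall A, atom G A ->
    (size (p A) <= k)%N /\ forall t, A t -> e i t = (p A).[t].
  move=> i; have [id|id] := ltnP i d; last by exists (fun=> 0).
  have [_ pe] := se i id.
  have /choice[q hq] : forall A, exists q : {poly R}, atom G A ->
      (size q <= k)%N /\ forall t, A t -> e i t = q.[t].
    move=> A; have [aA|nA] := pselect (atom G A); last by exists 0.
    by have [q sq hq] := pe A aA; exists q.
  by exists q.
pose M : 'M[R]_(d, size s * k) :=
  \matrix_(i < d) mxvec (\matrix_(a < size s, b < k) (p i (nth set0 s a))`_b).
have : kermx M != 0.
  rewrite kermx_eq0 /row_free neq_ltn; apply/orP; left.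
  exact: leq_ltn_trans (rank_leq_col _) dN.
move=> /rowV0Pn[u /sub_kermxP uM u0].
have hc (a : 'I_(size s)) (b : 'I_k) : \sum_i u 0 i * (p i (nth set0 s a))`_b = 0.
  have := congr1 (fun v : 'rV[R]_(size s * k) => v 0 (mxvec_index a b)) uM.
  rewrite !mxE => h; rewrite -[RHS]h; apply: eq_bigr => i _; congr (_ * _).
  by rewrite /M mxE mxvecE mxE.
have hz t : I01 t -> \sum_(i < d) u 0 i * e i t = 0.
  move=> /(partition_in hG)[A aA At].
  have As : A \in s by rewrite /s in_fset_set ?inE//; case: hG.
  have ia : (index A s < size s)%N by rewrite index_mem.
  transitivity (\sum_(i < d) \sum_(b < k) u 0 i * ((p i A)`_b * t ^+ b)).
    apply: eq_bigr => i _; have [sp hpt] := hp i (ltn_ord i) A aA.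
    by rewrite hpt// (horner_coef_wide _ sp) mulr_sumr.
  rewrite exchange_big/= big1// => b _.
  have := hc (Ordinal ia) b; rewrite /= nth_index// => h.
  transitivity ((\sum_(i < d) u 0 i * (p i A)`_b) * t ^+ b); last by rewrite h mul0r.
  by rewrite mulr_suml; apply: eq_bigr => i _; rewrite mulrA.
move/eqP : u0; apply; apply/rowP => j; rewrite mxE.
have sL (i : 'I_d) : i \in index_enum 'I_d -> L1R (e i).
  by move=> _; exact/spline_L1R/se.
have := inner_sum (f := fun i : 'I_d => e i) (u 0) sL (se j (ltn_ord j)).
rewrite (bigD1 j)//= oe// eqxx mulr1 big1 ?addr0 => [<-|i ij]; last first.
  by rewrite oe// (_ : (i == j :> nat) = false) ?mulr0//; exact/negbTE.
by rewrite -[RHS](inner0 (e j)); apply: eq_Rintegral => t /set_mem It; rewrite hz.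
Qed.

(** An orthonormal family of maximal size is a basis: a nonzero remainder [r], once normalized,
    would enlarge it. Hence no explicit basis of the spline space is constructed. *)
Lemma spline_orthonormal_basis : exists d (e : nat -> R -> R), orthonormal_family d e /\
  forall h, spline G k h -> forall t, I01 t -> h t = \sum_(i < d) inner h (e i) * e i t.
Proof.
pose P d := `[< exists e, orthonormal_family d e >].
have P0 : exists d, P d by exists 0%N; apply/asboolP; exists (fun _ _ => 0).
have PN d : P d -> (d <= size (fset_set (atom G)) * k)%N.
  by move=> /asboolP[e]; exact: orthonormal_family_size.
case: (ex_maxnP P0 PN) => d /asboolP[e [se oe]] dmax.
exists d, e; split => // h sh.
pose r t := h t - \sum_(i < d) inner h (e i) * e i t.
have sE (i : 'I_d) : i \in index_enum 'I_d -> spline G k (e i) by move=> _; exact: se.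
have sr : spline G k r.
  have := spline_linear (-1) (spline_sum (f := fun i : 'I_d => e i) (fun i : 'I_d => inner h (e i)) sE) sh.
  by under eq_fun do rewrite mulN1r addrC.
have ri j : (j < d)%N -> inner r (e j) = 0.
  move=> jd; have sj := se j jd.
  have -> : inner r (e j) = inner (fun t => (-1) * (\sum_(i < d) inner h (e i) * e i t) + h t) (e j).
    by apply: eq_Rintegral => t _; rewrite mulN1r addrC.
  have sL (i : 'I_d) : i \in index_enum 'I_d -> L1R (e i) by move=> /sE; exact: spline_L1R.
  rewrite inner_linear//; [|exact: L1R_sum|exact: spline_L1R].
  rewrite (inner_sum (f := fun i : 'I_d => e i) _ sL)// (bigD1 (Ordinal jd))//= oe// eqxx mulr1 big1 ?addr0 => [|i ij].
    by rewrite mulN1r addNr.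
  rewrite oe// (_ : (i == j :> nat) = false) ?mulr0//.
  exact/negbTE.
have rr0 : inner r r = 0.
  apply: contrapT => /eqP rr.
  have rr_gt0 : 0 < inner r r.
    by rewrite lt_neqAle eq_sym rr Rintegral_ge0// => t _; rewrite -expr2 sqr_ge0.
  pose c := (Num.sqrt (inner r r))^-1.
  pose e' i := if i == d then (fun t => c * r t) else e i.
  have sc : spline G k (fun t => c * r t) by exact: spline_scale.
  have rL := spline_L1R sr.
  have zL : L1R (fun=> 0 : R) by exact: spline_L1R (spline0 _ _).
  have ic g : spline G k g -> inner (fun t => c * r t) g = c * inner r g.
    move=> sg; rewrite -[RHS]addr0 -(inner0 g) -inner_linear//.
    by apply: eq_Rintegral => t _; rewrite addr0.
  suff : P d.+1 by move=> /dmax; rewrite ltnn.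
  apply/asboolP; exists e'; split.
    move=> i; rewrite ltnS leq_eqVlt /e' => /orP[->//|id].
    by rewrite ltn_eqF//; exact: se.
  move=> i j hi hj; rewrite /e'; rewrite ltnS leq_eqVlt in hi; rewrite ltnS leq_eqVlt in hj.
  have [id|id] := eqVneq i d; have [jd|jd] := eqVneq j d.
  - rewrite id jd eqxx ic// innerC ic// mulrA -expr2 /c exprVn sqr_sqrtr ?ltW//.
    by rewrite mulVf.
  - have {}jd : (j < d)%N by move: hj; rewrite (negbTE jd).
    by rewrite id gtn_eqF// ic ?ri ?mulr0//; exact: se.
  - have {}id : (i < d)%N by move: hi; rewrite (negbTE id).
    by rewrite jd ltn_eqF// innerC ic ?ri ?mulr0//; exact: se.
  - move: hi hj; rewrite (negbTE id) (negbTE jd)/=; exact: oe.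
move=> t It; apply/eqP; rewrite -subr_eq0; apply/eqP.
exact: (inner_eq0 sr rr0 It).
Qed.

End inner_theory.

Definition tensor_sum (R : realType) (X : normedModType R) (L : seq ((R -> R) * X)) (t : R) : X :=
  \sum_(p <- L) p.1 t *: p.2.

(** The integral of [tensor_sum L] times [e], computed from the list so that only scalar integrals
    occur. *)
Definition coefficient (R : realType) (X : normedModType R) (L : seq ((R -> R) * X)) (e : R -> R) : X :=
  \sum_(p <- L) inner p.1 e *: p.2.

Lemma L1X01_sum (R : realType) (X : completeNormedModType R) (J : eqType) (r : seq J)
    (f : J -> R -> X) : (forall i, i \in r -> L1X01 (f i)) ->
  L1X01 (fun t => \sum_(i <- r) f i t).
Proof.
have mI := @measurable_I01 R.
elim: r => [|i r IH] h.
  under eq_fun do rewrite big_nil.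
  have := L1X_tensor mI (0 : X) (L1R0 R).
  by under eq_fun do rewrite scaler0.
under eq_fun do rewrite big_cons.
have hr j : j \in r -> L1X01 (f j) by move=> jr; apply: h; rewrite inE jr orbT.
have := L1X_linear mI 1 (h i (mem_head _ _)) (IH hr).
by under eq_fun do rewrite scale1r.
Qed.

Lemma L1X01_tensor_sum (R : realType) (X : completeNormedModType R)
    (L : seq ((R -> R) * X)) : (forall p, p \in L -> L1R p.1) -> L1X01 (tensor_sum L).
Proof.
by move=> hL; apply: L1X01_sum => p /hL; exact: (L1X_tensor (@measurable_I01 R)).
Qed.

(** * The spline projections on scalar and vector-valued functions *)

Section projection.
Context (R : realType) (G : set (set R)) (k : nat).
Hypothesis hG : interval_partition (atom G).
Local Notation mu := (@lebesgue_measure R).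
Variables (d : nat) (e : nat -> R -> R).
Hypothesis he : orthonormal_family G k d e.
Hypothesis eb : forall h, spline G k h -> forall t, I01 t -> h t = \sum_(i < d) inner h (e i) * e i t.

Definition projection (f : R -> R) (t : R) : R := \sum_(i < d) inner f (e i) * e i t.

Lemma projection_spline f : spline G k (projection f).
Proof.
apply: (spline_sum (f := fun i : 'I_d => e i) (fun i : 'I_d => inner f (e i))) => i _.
exact: he.1.
Qed.

Lemma basis_bounds : exists K : nat -> R, forall i, (i < d)%N ->
  [/\ 0 <= K i, measurable_fun (@I01 R : set (measurableTypeR R)) (e i)
    & forall t, I01 t -> `|e i t| <= K i].
Proof.
have /choice[K hK] : forall i, exists K, (i < d)%N ->
    0 <= K /\ forall t, I01 t -> `|e i t| <= K.
  move=> i; have [id|id] := ltnP i d; last by exists 0.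
  by have [K [K0 hb _]] := spline_lipschitz hG (he.1 i id); exists K.
exists K => i id; have [K0 hb] := hK i id; split => //.
exact: (spline_measurable hG (he.1 i id)).
Qed.

Lemma inner_projection f i : (i < d)%N -> inner (projection f) (e i) = inner f (e i).
Proof.
move=> id; have sL (j : 'I_d) : j \in index_enum 'I_d -> L1R (e j).
  by move=> _; exact/(spline_L1R hG)/he.1.
rewrite /projection (inner_sum hG (f := fun j : 'I_d => e j) (fun j : 'I_d => inner f (e j)) sL (he.1 i id)).
rewrite (bigD1 (Ordinal id))//= he.2// eqxx mulr1 big1 ?addr0// => j ji.
by rewrite he.2// (_ : (j == i :> nat) = false) ?mulr0//; exact/negbTE.
Qed.

Lemma inner_le f i K : (i < d)%N -> 0 <= K -> (forall t, I01 t -> `|e i t| <= K) -> L1R f ->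
  (`|inner f (e i)|%:E <= K%:E * \int[mu]_(t in @I01 R) `|f t|%:E)%E.
Proof.
move=> id K0 eK fi; have fe := L1R_mul_spline hG fi (he.1 i id).
have mI := @measurable_I01 R.
rewrite (EFin_normr_Rintegral mI fe).
have /integrableP[mfe _] := fe.
apply: (le_trans (le_abse_integral mu mI mfe)).
have mf : measurable_fun (@I01 R : set (measurableTypeR R)) (fun t => `|f t|%:E).
  apply/measurable_EFinP; apply: measurableT_comp => //.
  by apply/measurable_EFinP; exact: measurable_int fi.
rewrite -ge0_integralZl//; apply: ge0_le_lower_integral => // t It.
by rewrite /= lee_fin normrM mulrC ler_wpM2r// eK.
Qed.

Lemma L2R_L1R (f : R -> R) : L2R f -> L1R f.
Proof.
move=> [mf f2]; have mI := @measurable_I01 R.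
have i1 : mu.-integrable (@I01 R) (fun t => (1 + f t ^+ 2)%:E).
  have c1 : mu.-integrable (@I01 R) (EFin \o cst (1 : R)).
    apply: measurable_bounded_integrable => //; first exact: lebesgue_I01_lty.
    by exists 1; split => // x x1 t _ /=; rewrite normr1 ltW.
  exact: (integrableD mI c1 f2).
apply: le_integrable i1 => //; first by apply/measurable_EFinP.
move=> t It /=; rewrite lee_fin [leRHS]ger0_norm; last by rewrite addr_ge0// sqr_ge0.
have h := sqr_ge0 (`|f t| - 1).
have h2 : `|f t| ^+ 2 = f t ^+ 2 by rewrite real_normK// num_real.
have : (`|f t| - 1) ^+ 2 = `|f t| ^+ 2 - 2 * `|f t| + 1 by ring.
have := normr_ge0 (f t).
rewrite h2; lra.
Qed.

Lemma projection_is_spline_projection : is_spline_projection G k projection.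
Proof.
have [K hK] := basis_bounds; have mI := @measurable_I01 R.
have linP (a : R) f g : L1R f -> L1R g -> forall t,
    projection (fun t => a * f t + g t) t = a * projection f t + projection g t.
  move=> fi gi t; rewrite /projection mulr_sumr -big_split/=; apply: eq_bigr => i _.
  by rewrite (inner_linear hG _ fi gi (he.1 i (ltn_ord i))); ring.
split; first split.
- by move=> f _; exact: (spline_L1R hG (projection_spline f)).
- by move=> a f g fi gi; apply: aeW => t _; exact: linP.
(* One factor [K i] bounds the coefficient of f by its L^1 norm, the other bounds [e i], and [0,1]
   has measure 1. *)
- exists (\sum_(i < d) K i * K i) => f fi.
  have /integrableP[mf foo] := fi.
  have If : (\int[mu]_(t in @I01 R) `|f t|%:E)%E \is a fin_num.
    by rewrite ge0_fin_numE// integral_ge0.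
  set J := fine (\int[mu]_(t in @I01 R) `|f t|%:E).
  have hJ i : (i < d)%N -> `|inner f (e i)| <= K i * J.
    move=> id; have [K0 _ eK] := hK i id.
    by rewrite -lee_fin EFinM /J fineK//; exact: inner_le.
  rewrite -(fineK If) -/J -EFinM.
  apply: (@le_trans _ _ (\int[mu]_(t in @I01 R) cst (\sum_(i < d) K i * K i * J)%:E t)%E); last first.
    by rewrite integral_cst// [X in (_ * X)%E](lebesgue_I01 R) mule1 -mulr_suml.
  apply: ge0_le_lower_integral => // t It; rewrite lee_fin.
  apply: (le_trans (ler_norm_sum _ _ _)); apply: ler_sum => i _.
  have [K0 _ eK] := hK i (ltn_ord i).
  by rewrite normrM mulrC -mulrA; apply: ler_pM => //; [exact: eK|exact: hJ].
move=> f /L2R_L1R fi; split; first exact: projection_spline.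
move=> h sh.
have sL (j : 'I_d) : j \in index_enum 'I_d -> L1R (e j).
  by move=> _; exact/(spline_L1R hG)/he.1.
have pL := spline_L1R hG (projection_spline f).
pose r t := (-1) * projection f t + f t.
have rL : L1R r by exact: L1R_linear.
transitivity (\int[mu]_(t in @I01 R) (\sum_(i < d) inner h (e i) * (r t * e i t))).
  apply: eq_Rintegral => t /set_mem It; rewrite {1}(eb sh It) mulr_sumr.
  by apply: eq_bigr => i _; rewrite /r; ring.
have ri (i : 'I_d) : mu.-integrable (@I01 R) (EFin \o (fun t => inner h (e i) * (r t * e i t))).
  have := integrableZl mI (inner h (e i)) (L1R_mul_spline hG rL (he.1 i (ltn_ord i))).
  exact.
rewrite (Rintegral_sum _ mI ri).2 big1// => i _.
rewrite RintegralZl//; last exact: (L1R_mul_spline hG rL (he.1 i (ltn_ord i))).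
rewrite -[X in _ * X]/(inner r (e i)) (inner_linear hG _ pL fi (he.1 i (ltn_ord i))).
by rewrite inner_projection// mulN1r addNr mulr0.
Qed.

Variable X : completeNormedModType R.

(** [PX] is built from the vector-valued coefficient functionals of the basis. The formula on tensor
    sums holds at every point, so the martingale property can be checked by comparing
    coefficients. *)
Lemma projectionX_exists : exists PX, is_spline_projectionX (X := X) G k PX /\
  forall L : seq ((R -> R) * X), (forall p, p \in L -> L1R p.1) ->
    forall t, PX (tensor_sum L) t = \sum_(i < d) e i t *: coefficient L (e i).
Proof.
have [K hK] := basis_bounds; have mI := @measurable_I01 R.
have muI := lebesgue_I01_lty R.
have /choice[I hI] : forall i, exists I : (R -> X) -> X, (i < d)%N -> [/\
  forall (a : R) f g, L1X01 f -> L1X01 g ->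
    I (fun t => a *: f t + g t) = a *: I f + I g,
  forall f, L1X01 f -> (`|I f|%:E <= (K i)%:E * \int[mu]_(t in @I01 R) `|f t|%:E)%E
  & forall (f : R -> R) (x : X), L1R f -> I (fun t => f t *: x) = inner f (e i) *: x].
  move=> i; have [id|id] := ltnP i d; last by exists (fun=> 0).
  have [K0 me eK] := hK i id.
  by have [I hI] := bochner_functional_exists mI muI X me eK K0; exists I.
pose PX f t := \sum_(i < d) e i t *: I i f.
exists PX; split; first split.
- split.
  + move=> f L1f; apply: L1X01_sum => i _.
    exact: (L1X_tensor mI _ (spline_L1R hG (he.1 i (ltn_ord i)))).
  + move=> a f g L1f L1g; apply: aeW => t _.
    rewrite /PX scaler_sumr -big_split/=; apply: eq_bigr => i _.
    have [-> // _ _] := hI i (ltn_ord i).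
    by rewrite scalerDr !scalerA mulrC.
  + exists (\sum_(i < d) K i * K i) => f L1f.
    have [_ foo] := L1f.
    have If : (\int[mu]_(t in @I01 R) `|f t|%:E)%E \is a fin_num.
      by rewrite ge0_fin_numE// integral_ge0.
    set J := fine (\int[mu]_(t in @I01 R) `|f t|%:E).
    have hJ i : (i < d)%N -> `|I i f| <= K i * J.
      move=> id; rewrite -lee_fin EFinM /J fineK//.
      by have [_ h _] := hI i id; exact: h.
    rewrite -(fineK If) -/J -EFinM.
    apply: (@le_trans _ _ (\int[mu]_(t in @I01 R) cst (\sum_(i < d) K i * K i * J)%:E t)%E); last first.
      by rewrite integral_cst// [X in (_ * X)%E](lebesgue_I01 R) mule1 -mulr_suml.
    apply: ge0_le_lower_integral => // t It; rewrite lee_fin.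
    apply: (le_trans (ler_norm_sum _ _ _)); apply: ler_sum => i _.
    have [K0 _ eK] := hK i (ltn_ord i).
    by rewrite normrZ -mulrA; apply: ler_pM => //; [exact: eK|exact: hJ].
- exists projection; first exact: projection_is_spline_projection.
  move=> f x fi; apply: aeW => t _.
  rewrite /PX /tensor /projection scaler_suml; apply: eq_bigr => i _.
  have [_ _ ->//] := hI i (ltn_ord i).
  by rewrite scalerA mulrC.
move=> L hL t; apply: eq_bigr => i _; congr (_ *: _).
have [linI _ tI] := hI i (ltn_ord i).
elim: L hL => [|p L IH] hL.
  rewrite /coefficient big_nil.
  have z : L1R (fun=> 0 : R) by exact: (spline_L1R hG (spline0 G k)).
  transitivity (inner (fun=> 0) (e i) *: (0 : X)); last by rewrite scaler0.
  rewrite -(tI _ _ z); congr (I i _).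
  by apply/funext => s; rewrite /tensor_sum big_nil scaler0.
rewrite /coefficient big_cons -/(coefficient L (e i)) -IH; last first.
  by move=> q qL; apply: hL; rewrite inE qL orbT.
have Lp : L1R p.1 by apply: hL; rewrite mem_head.
have Lt : L1X01 (tensor_sum L).
  by apply: L1X01_tensor_sum => q qL; apply: hL; rewrite inE qL orbT.
rewrite -(tI _ _ Lp) -[X in X + _]scale1r -linI//; last exact: (L1X_tensor mI).
by congr (I i _); apply/funext => s; rewrite /tensor_sum big_cons scale1r.
Qed.

End projection.

(** * Step-up splines *)

Section truncated_power.
Context (R : realType).

(** For d = 0 this is constantly 1 and not a Heaviside function, hence the hypotheses d > 0 below
    and the separate treatment of splines of order 1. *)
Definition truncated_power (d : nat) (c t : R) : R := (Num.max 0 (t - c)) ^+ d.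

Lemma truncated_power_le d c t : (0 < d)%N -> t <= c -> truncated_power d c t = 0.
Proof.
move=> d0 tc; rewrite /truncated_power (_ : Num.max 0 (t - c) = 0) ?expr0n; last first.
  by apply/max_idPl; rewrite subr_le0.
by case: d d0.
Qed.

Lemma truncated_power_ge d c t : c <= t -> truncated_power d c t = (t - c) ^+ d.
Proof.
move=> tc; rewrite /truncated_power (_ : Num.max 0 (t - c) = t - c)//.
by apply/max_idPr; rewrite subr_ge0.
Qed.

Lemma truncated_powerS d c t : (0 < d)%N ->
  truncated_power d.+1 c t = (t - c) * truncated_power d c t.
Proof.
move=> d0; have [ct|tc] := leP c t; first by rewrite !truncated_power_ge// exprS.
by rewrite !truncated_power_le ?mulr0 ?ltW.
Qed.

(** Degree 2 starts the induction for derivatives and is done by hand because the factor of degree 1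
    is not differentiable at c. Higher degrees follow from the product rule. *)
Lemma truncated_power2_taylor c s t :
  `|truncated_power 2 c s - truncated_power 2 c t - 2 * truncated_power 1 c t * (s - t)|
    <= (s - t) ^+ 2.
Proof.
have [cs|sc] := leP c s; have [ct|tc] := leP c t.
- rewrite !truncated_power_ge// (_ : _ - _ = (s - t) ^+ 2); last by ring.
  by rewrite ger0_norm// sqr_ge0.
- rewrite (truncated_power_ge 2 cs) !(truncated_power_le _ (ltW tc))//.
  rewrite mulr0 mul0r !subr0 ger0_norm ?sqr_ge0//.
  have h : 0 <= (c - t) * (2 * s - t - c) by rewrite mulr_ge0//; lra.
  rewrite !expr2; lra.
- rewrite (truncated_power_le _ (ltW sc))// !(truncated_power_ge _ ct) expr1 sub0r.
  have h : 0 <= (t - c) * (t + c - 2 * s) by rewrite mulr_ge0//; lra.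
  have h2 := sqr_ge0 (s - c).
  by rewrite ger0_norm; move: h2; rewrite !expr2; lra.
- by rewrite !(truncated_power_le _ (ltW _))// mulr0 mul0r !subr0 normr0 sqr_ge0.
Qed.

Lemma is_derive_truncated_power d (c t : R) : (0 < d)%N ->
  is_derive t 1 (truncated_power d.+1 c) (d.+1%:R * truncated_power d c t).
Proof.
case: d => // d _; elim: d => [|d IH].
  have cv : (fun h => h^-1 *: (truncated_power 2 c (h *: 1 + t) - truncated_power 2 c t)) @ 0^'
      --> 2 * truncated_power 1 c t.
    apply/cvgrPdist_lt => e e0; near=> h.
    have h0 : h != 0 by near: h; exact: nbhs_dnbhs_neq.
    have he : `|h| < e.
      by near: h; apply: dnbhs0_lt.
    apply: le_lt_trans he.
    have := truncated_power2_taylor c (h *: 1 + t) t.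
    rewrite addrK [h *: 1]mulr1 => hh.
    rewrite -(ler_pM2l (_ : 0 < `|h|)) ?normr_gt0// -normrM mulrBr.
    rewrite [h * (h^-1 *: _)]mulrA mulfV// mul1r -normrN opprB.
    rewrite -expr2 real_normK ?num_real//; apply: le_trans hh.
    by rewrite [h * _]mulrC.
  apply: DeriveDef; first by apply/cvg_ex; exists (2 * truncated_power 1 c t).
  exact: (cvg_lim _ cv).
have -> : truncated_power d.+3 c = (fun t => t - c) * truncated_power d.+2 c.
  by apply/funext => s; rewrite truncated_powerS.
have h1 : is_derive t 1 (fun s : R => s - c) (1 - 0).
  exact: (@is_deriveB _ _ _ id (cst c) t 1 1 0).
apply: is_derive_eq.
rewrite (truncated_powerS c t (ltn0Sn d)) /GRing.scale/=.
rewrite -[d.+3]addn1 natrD; ring.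
Unshelve. all: by end_near. Qed.

Lemma is_derive_has_derivative01 (f g : R -> R) :
  (forall t : R, is_derive t 1 f (g t)) -> has_derivative01 f g.
Proof.
move=> df t It; have [dt lt] := df t.
have : h^-1 *: (f (h *: 1 + t) - f t) @[h --> 0^'] --> g t.
  by rewrite -lt.
move=> cv.
apply/cvgrPdist_lt => e e0; move/cvgrPdist_lt : cv => /(_ e e0).
move=> [r r0 hr]; exists r => // s /= sr [Is st].
have := hr (s - t); rewrite /= sub0r normrN distrC => /(_ sr).
rewrite subr_eq0 => /(_ st); rewrite [(s - t) *: 1]mulr1 subrK.
by rewrite [_^-1 *: _]mulrC.
Qed.

Lemma continuous_truncated_power1 (c : R) : continuous (truncated_power 1 c).
Proof.
have -> : truncated_power 1 c = (cst 0 : R -> R) \max (fun t => t - c) by [].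
move=> t; apply: continuous_max; first exact: cst_continuous.
by apply: continuousB; [exact: cvg_id|exact: cst_continuous].
Qed.

Lemma C01_truncated_power d c : C01 d (truncated_power d.+1 c).
Proof.
elim: d => [|d IH] /=.
  by apply: continuous_subspaceT => t; exact: continuous_truncated_power1.
exists (fun t => d.+2%:R * truncated_power d.+1 c t + 0).
  apply: is_derive_has_derivative01 => t; rewrite addr0.
  exact: is_derive_truncated_power.
by apply: C01_linear => //; exact: C01_cst.
Qed.

End truncated_power.

Section steps.
Context (R : realType).

Definition power_combination (d : nat) (r : seq (R * R)) (t : R) : R :=
  \sum_(q <- r) q.1 * truncated_power d q.2 t.

Lemma is_derive_power_combination d r (t : R) :
  is_derive t 1 (power_combination d.+2 [seq (q.1 / d.+2%:R, q.2) | q <- r])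
    (power_combination d.+1 r t).
Proof.
elim: r => [|q r IH].
  rewrite /power_combination big_nil.
  rewrite (_ : (fun t => _) = cst 0); last by apply/funext => s; rewrite big_nil.
  exact: is_derive_cst.
have h := is_derive_truncated_power q.2 t (ltn0Sn d).
rewrite (_ : power_combination _ _ =
  (q.1 / d.+2%:R) *: truncated_power d.+2 q.2 +
    power_combination d.+2 [seq (q.1 / d.+2%:R, q.2) | q <- r]).
  apply: is_derive_eq.
  rewrite /power_combination big_cons; congr (_ + _).
  by rewrite /GRing.scale/= mulrA divfK// pnatr_eq0.
by apply/funext => s; rewrite /power_combination/= big_cons.
Qed.

Lemma derive_ge0_le (f g : R -> R) (x y : R) : (forall t : R, is_derive t 1 f (g t)) ->
  x <= y -> exists z, [/\ x <= z, z <= y & f y - f x = g z * (y - x)].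
Proof.
move=> df; rewrite le_eqVlt => /orP[/eqP <-|xy].
  by exists x; rewrite !subrr mulr0.
have cf : {within `[x, y], continuous f}.
  apply: continuous_subspaceT => z; apply: differentiable_continuous.
  by apply/derivable1_diffP; case: (df z).
have [z + ->] := MVT xy (fun z _ => df z) cf.
by rewrite in_itv/= => /andP[/ltW xz /ltW zy]; exists z.
Qed.

(* The step of degree [d.+2] is a normalized primitive of the difference of two
   consecutive steps of degree [d.+1], which is nonnegative and compactly
   supported. *)
Lemma step_function_exists (d M : nat) (tau : nat -> R) :
  (forall i j, (i < j)%N -> (j < M)%N -> tau i < tau j) ->
  forall i, (i + 2 ^ d.+1 <= M)%N -> exists r : seq (R * R), [/\
    forall q, q \in r -> exists2 j, (i <= j < M)%N & q.2 = tau j,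
    forall t, 0 <= power_combination d.+1 r t <= 1,
    forall t, t <= tau i -> power_combination d.+1 r t = 0
  & forall t, tau (i + 2 ^ d.+1).-1 <= t -> power_combination d.+1 r t = 1].
Proof.
move=> tauS.
have tau_le i j : (i <= j)%N -> (j < M)%N -> tau i <= tau j.
  by rewrite leq_eqVlt => /orP[/eqP ->//|ij jM]; exact/ltW/tauS.
elim: d => [|d IH] i iM.
  (* Degree 1: a ramp between two consecutive knots. *)
  rewrite expn1 addn2 in iM *; rewrite [i.+2.-1]/=.
  have ii : tau i < tau i.+1 by exact: tauS.
  pose c := (tau i.+1 - tau i)^-1.
  have c0 : 0 < c by rewrite invr_gt0 subr_gt0.
  have cE : c * (tau i.+1 - tau i) = 1 by rewrite mulVf// gt_eqF// subr_gt0.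
  have cdiff t : c * (t - tau i) - c * (t - tau i.+1) = c * (tau i.+1 - tau i) by ring.
  exists [:: (c, tau i); (- c, tau i.+1)].
  have E t : power_combination 1 [:: (c, tau i); (- c, tau i.+1)] t =
      c * truncated_power 1 (tau i) t - c * truncated_power 1 (tau i.+1) t.
    by rewrite /power_combination big_cons big_seq1/= mulNr.
  split.
  - move=> q; rewrite !inE => /orP[] /eqP -> /=; first by exists i => //; rewrite leqnn ltnW.
    by exists i.+1 => //; rewrite leqnSn.
  - move=> t; rewrite E.
    have [ti|it] := leP t (tau i).
      by rewrite !truncated_power_le// ?(le_trans ti (ltW ii))// mulr0 subr0 lexx ler01.
    have [ti1|it1] := leP t (tau i.+1).
      rewrite (truncated_power_le _ ti1)// (truncated_power_ge _ (ltW it)) expr1 mulr0 subr0.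
      by rewrite mulr_ge0 ?subr_ge0 ?(ltW c0) ?(ltW it)//= -cE ler_pM2l// lerB.
    rewrite (truncated_power_ge _ (ltW it)) (truncated_power_ge _ (ltW it1)) !expr1.
    by rewrite cdiff cE ler01 lexx.
  - move=> t ti.
    by rewrite E !truncated_power_le// ?(le_trans ti (ltW ii))// mulr0 subr0.
  - move=> t it; rewrite E (truncated_power_ge _ it) (truncated_power_ge _ (le_trans (ltW ii) it)).
    by rewrite !expr1 cdiff cE.
(* The two steps to be subtracted use consecutive disjoint blocks of knots, so each degree doubles
   the number of knots. *)
have e2 : (2 ^ d.+2 = 2 ^ d.+1 + 2 ^ d.+1)%N by rewrite expnS mul2n addnn.
have n0 : (0 < 2 ^ d.+1)%N by rewrite expn_gt0.
set n := (2 ^ d.+1)%N in IH e2 n0 *.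
rewrite e2 addnA in iM *; clearbody n.
have inM : (i + n <= M)%N by rewrite (leq_trans _ iM)// leq_addr.
have [ru [ku u01 ul ur]] := IH i inM.
have [rv [kv v01 vl vr]] := IH (i + n)%N iM.
pose r0 := ru ++ [seq (- q.1, q.2) | q <- rv].
pose w := power_combination d.+1 r0.
have wE t : w t = power_combination d.+1 ru t - power_combination d.+1 rv t.
  rewrite /w /power_combination big_cat/= big_map -sumrN; congr (_ + _).
  by apply: eq_bigr => q _; rewrite mulNr.
pose r1 := [seq (q.1 / d.+2%:R, q.2) | q <- r0].
pose W := power_combination d.+2 r1.
have dW (t : R) : is_derive t 1 W (w t) by exact: is_derive_power_combination.
set a := tau (i + n + n).-1.
set b := tau (i + n)%N; set b' := tau (i + n).-1.
have inn : (i + n < M)%N by lia.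
have b'b : b' < b by apply: tauS => //; lia.
have ba : b <= a.
  by apply: tau_le; lia.
have ib' : tau i <= b'.
  by apply: tau_le; lia.
have k0 q : q \in r0 -> exists2 j, (i <= j < M)%N & q.2 = tau j.
  rewrite mem_cat => /orP[/ku//|/mapP[p /kv[j /andP[ij jM] pj] ->]].
  by exists j => //; rewrite jM (leq_trans _ ij)// leq_addr.
have k1 q : q \in r1 -> exists2 j, (i <= j < M)%N & q.2 = tau j.
  by move=> /mapP[p /k0[j ij pj] ->]; exists j.
(* The first step has reached 1 before the second one leaves 0. *)
have w0 t : 0 <= w t.
  rewrite wE subr_ge0; have [tb|bt] := leP t b.
    by rewrite vl//; have /andP[] := u01 t.
  by rewrite ur; [have /andP[] := v01 t|exact/ltW/(lt_trans b'b bt)].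
have Wmono x y : x <= y -> W x <= W y.
  move=> xy; have [z [_ _ h]] := derive_ge0_le dW xy.
  by rewrite -subr_ge0 h mulr_ge0// subr_ge0.
have Wl t : t <= tau i -> W t = 0.
  move=> ti; rewrite /W /power_combination big_seq big1// => q /k1[j /andP[ij jM] ->].
  by rewrite truncated_power_le ?mulr0// (le_trans ti)// tau_le.
have Wr t : a <= t -> W t = W a.
  move=> at_; have [z [az _ h]] := derive_ge0_le dW at_.
  apply/eqP; rewrite -subr_eq0 h wE (ur z) ?(vr z)// ?subrr ?mul0r//.
  by apply: le_trans az; exact: le_trans (ltW b'b) ba.
(* Between the last knot [b'] of the first block and the first knot [b] of the second, the
   derivative [w] is 1, so [W] really increases and can be normalized. *)
have Wa : 0 < W a.
  have [z [bz zb h]] := derive_ge0_le dW (ltW b'b).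
  have : 0 < W b - W b'.
    by rewrite h wE (ur z bz) (vl z zb) subr0 mul1r subr_gt0.
  have := Wmono _ _ ba; have := Wmono _ _ ib'; rewrite (Wl (tau i))//; lra.
have sE t : power_combination d.+2 [seq ((W a)^-1 * q.1, q.2) | q <- r1] t = (W a)^-1 * W t.
  rewrite {1}/power_combination big_map.
  rewrite -[W t]/(\sum_(q <- r1) q.1 * truncated_power d.+2 q.2 t) mulr_sumr.
  by apply: eq_bigr => q _ /=; rewrite mulrA.
exists [seq ((W a)^-1 * q.1, q.2) | q <- r1]; split.
- by move=> q /mapP[p /k1[j ij pj] ->]; exists j.
- move=> t; rewrite sE; apply/andP; split.
    have [ti|it] := leP t (tau i); first by rewrite (Wl t ti) mulr0.
    by rewrite mulr_ge0 ?invr_ge0 ?(ltW Wa)// -(Wl (tau i))// Wmono// ltW.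
  rewrite mulrC ler_pdivrMr// mul1r.
  by have [ta|/ltW at_] := leP t a; [exact: Wmono|rewrite (Wr t at_)].
- by move=> t ti; rewrite sE (Wl t ti) mulr0.
- by move=> t ta; rewrite sE (Wr t ta) mulVf// gt_eqF.
Qed.

End steps.

Section knots.
Context (R : realType) (F : nat -> set (set R)).
Hypothesis hF : interval_filtration F.

(** What makes a truncated power at [c] polynomial on every atom. It is stated by order alone, so it
    does not matter which atom contains [c]. *)
Definition knot (n : nat) (c : R) := forall B, atom (F n) B ->
  (forall s, B s -> s <= c) \/ (forall s, B s -> c <= s).

(** A finer atom lies in an atom [C] of level m. Either [C] is the atom with endpoint [c], or by
    convexity it lies entirely on one side of that atom. *)
Lemma endpoint_knot m n c : endpoints (F m) c -> (m <= n)%N -> knot n c.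
Proof.
move=> [A aA cA] mn B aB.
have hP := filtration_partition hF m.
have [C aC BC] := filtration_refines hF mn aB.
have [_ [_ tP _] /(_ _ aA)[iA _]] := hP.
have [_ _ /(_ _ aC)[iC _]] := hP.
have [a0 Aa0] : A !=set0 by case: aA.
have AI := partition_sub hP aA.
have lbA : has_lbound A by exists 0 => t /AI; rewrite /I01/= in_itv/= => /andP[].
have ubA : has_ubound A by exists 1 => t /AI; rewrite /I01/= in_itv/= => /andP[].
have [CA|CA] := pselect (C = A).
  case: cA => ->; [right|left] => s /BC; rewrite CA => As.
    exact: ge_inf.
  exact: ub_le_sup.
have disj s : C s -> A s -> False by move=> Cs As; apply: CA; exact: (partition_eq hP aC aA Cs As).
have infsup : inf A <= sup A by apply: le_trans (ge_inf lbA Aa0) (ub_le_sup ubA Aa0).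
have [low|nlow] := pselect (forall s, C s -> s <= a0).
  left => s /BC Cs.
  have h : s <= inf A.
    apply: lb_le_inf; first by exists a0.
    move=> a Aa; rewrite leNgt; apply/negP => as_; apply: (disj s Cs).
    by apply: (iA a a0) => //; rewrite (ltW as_) low.
  by case: cA => -> //; exact: le_trans infsup.
right => s /BC Cs.
have [s1 [Cs1 as1]] : exists s1, C s1 /\ a0 < s1.
  apply: contrapT => h; apply: nlow => s1 Cs1; rewrite leNgt; apply/negP => as1.
  by apply: h; exists s1.
have high s2 : C s2 -> a0 <= s2.
  move=> Cs2; rewrite leNgt; apply/negP => sa; apply: (disj a0) => //.
  by apply: (iC s2 s1) => //; rewrite !ltW.
have h : sup A <= s.
  apply: sup_le_ub; first by exists a0.
  move=> a Aa; rewrite leNgt; apply/negP => as_; apply: (disj s Cs).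
  by apply: (iA a0 a) => //; rewrite (high s Cs) ltW.
by case: cA => -> //; exact: le_trans h.
Qed.

Lemma truncated_power_spline n c d : knot n c -> spline (F n) d.+2 (truncated_power d.+1 c).
Proof.
move=> kc; split; first by rewrite !subSS subn0 => _; exact: C01_truncated_power.
move=> A aA; case: (kc A aA) => hA.
  exists 0; first by rewrite size_poly0.
  by move=> t /hA tc; rewrite truncated_power_le// horner0.
exists (('X - c%:P) ^+ d.+1); first by rewrite size_exp_XsubC.
by move=> t /hA ct; rewrite truncated_power_ge// horner_exp hornerXsubC.
Qed.

(** Finitely many endpoints inside the interval suffice, and they remain knots at all later levels.
    Having the step at every level from m on lets two steps be taken at a common level. *)
Lemma filtration_step k (p q : R) : (0 < k)%N ->
  infinite_set (\bigcup_n endpoints (F n) `&` `]p, q[) ->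
  exists m, forall n, (m <= n)%N -> exists s : R -> R, [/\ spline (F n) k s,
    forall t, 0 <= s t <= 1, forall t, t <= p -> s t = 0
    & forall t, I01 t -> q <= t -> s t = 1].
Proof.
move=> k0 iK.
(* Order d + 2 needs 2^(d + 1) knots and order 1 a single knot; 2^k covers both. *)
have [B BK sB] := infinite_set_fset (2 ^ k) iK.
pose l := sort <=%R (enum_fset B).
have sl : size l = size (enum_fset B) by rewrite size_sort.
have ul : uniq l by rewrite sort_uniq fset_uniq.
have lK c : c \in l -> (\bigcup_n endpoints (F n) `&` `]p, q[) c.
  by rewrite mem_sort => cB; exact: BK.
have /choice[lev hlev] : forall c, exists n, c \in l -> endpoints (F n) c.
  move=> c; have [cl|cl] := boolP (c \in l); last by exists 0%N.
  by have [[n _ ?] _] := lK c cl; exists n.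
exists (\max_(c <- l) lev c) => n hn.
have kn c : c \in l -> knot n c.
  move=> cl; apply: (endpoint_knot (hlev c cl)); apply: leq_trans hn.
  exact: leq_bigmax_seq.
have lpq c : c \in l -> p < c < q.
  by move=> /lK[_]; rewrite /= in_itv/=.
(* For order 1 the step is the indicator of the atoms to the right of one knot. *)
case: k k0 sB => // -[_|d _] sB.
  have [c cl] : exists c, c \in l.
    by exists (nth 0 l 0); rewrite mem_nth// sl (leq_trans _ sB).
  have /andP[pc cq] := lpq c cl.
  pose U : set R := [set t | exists2 A, atom (F n) A & A t /\ forall s, A s -> c <= s].
  exists \1_U; split.
  - split => // A aA; have hP := filtration_partition hF n.
    have [hA|hA] := pselect (forall s, A s -> c <= s).
      exists 1; rewrite ?size_poly1// => t At; rewrite hornerC indicE mem_set//.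
      by exists A.
    exists 0; rewrite ?size_poly0// => t At; rewrite horner0 indicE memNset//.
    move=> [A' aA' [A't h]]; apply: hA.
    by rewrite (partition_eq hP aA aA' At A't).
  - by move=> t; rewrite indicE; case: (_ \in _); rewrite ?ler01 ?lexx.
  - move=> t tp; rewrite indicE memNset// => -[A _ [At h]].
    by have := h t At; rewrite leNgt (le_lt_trans tp pc).
  - move=> t It qt; rewrite indicE mem_set//.
    have [A aA At] := partition_in (filtration_partition hF n) It.
    exists A => //; split => //; case: (kn c cl A aA) => // h.
    by have := h t At; rewrite leNgt (lt_le_trans cq qt).
have tauS i j : (i < j)%N -> (j < size l)%N -> nth 0 l i < nth 0 l j.
  move=> ij jl; rewrite lt_neqAle nth_uniq ?(ltn_trans ij)// (ltn_eqF ij)/=.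
  apply: (sorted_leq_nth le_trans le_refl 0 (sort_sorted (@le_total _ R) _)) => //.
    by rewrite inE (ltn_trans ij).
  exact: ltnW.
have sl2 : (0 + 2 ^ d.+1 <= size l)%N.
  by rewrite add0n sl (leq_trans _ sB)// leq_exp2l.
have [r [kr r01 rl rr]] := step_function_exists tauS sl2.
exists (power_combination d.+1 r); split => //.
- apply: (@spline_sum _ _ _ _ r (fun q => q.1) (fun q => truncated_power d.+1 q.2)) => x xr.
  apply: truncated_power_spline; have [j /andP[_ jl] ->] := kr x xr.
  exact/kn/mem_nth.
- move=> t tp; apply: rl; apply: (le_trans tp).
  have /lpq/andP[/ltW //] : nth 0 l 0 \in l.
  by rewrite mem_nth// (leq_trans _ sl2)// add0n expn_gt0.
- move=> t It qt; apply: rr; apply: le_trans qt.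
  have /lpq/andP[_ /ltW //] : nth 0 l (0 + 2 ^ d.+1).-1 \in l.
  by rewrite mem_nth// (leq_trans _ sl2)// prednK// add0n expn_gt0.
Qed.

End knots.

(** * Perturbing a spline *)

(** Restriction by intersection gives a finite measure on the whole line, to which the lemmas on
    [rmu] apply. *)
Definition lebesgue01 (R : realType) : set (measurableTypeR R) -> \bar R :=
  mrestr lebesgue_measure (@measurable_I01 R).

HB.instance Definition _ (R : realType) := Measure.on (@lebesgue01 R).

Lemma lebesgue01_fin_num (R : realType) : fin_num_fun (@lebesgue01 R).
Proof.
move=> A mA; rewrite ge0_fin_numE//; apply: le_lt_trans (lebesgue_I01_lty R).
apply: le_measure; rewrite ?inE//; last exact: measurable_I01.
exact: measurableI mA (@measurable_I01 R).
Qed.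

HB.instance Definition _ (R : realType) :=
  @Measure_isFinite.Build _ _ R (@lebesgue01 R) (@lebesgue01_fin_num R).

(** * Distribution functions of sets, and bumps proportioned by V *)

Section distribution_function.
Context (R : realType).
Implicit Types (U : set R) (p q t : R).
Local Notation m := (rmu (@lebesgue01 R)).

(** Increments over an interval measure the part of [U] inside it. Being continuous, the function
    can be used to cut intervals in prescribed proportions, and its increments add up over adjacent
    intervals. *)
Definition set_cdf U t : R := m (U `&` `]-oo, t]).

Lemma lebesgue01E (A : set R) : measurable A -> A `<=` @I01 R ->
  lebesgue_measure A = (m A)%:E.
Proof.
move=> mA AI; rewrite -(rmuE (@lebesgue01 R) mA).
by rewrite -[RHS]/(lebesgue_measure (A `&` @I01 R)) setIidl.
Qed.

Lemma set_cdfB U p q : measurable U -> p <= q ->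
  set_cdf U q - set_cdf U p = m (U `&` `]p, q]).
Proof.
move=> mU pq; rewrite /set_cdf.
have mp (a b : itv_bound R) : measurable (U `&` [set` Interval a b]).
  by apply: measurableI => //; exact: measurable_itv.
have -> : U `&` `]-oo, q] = (U `&` `]-oo, p]) `|` (U `&` `]p, q]).
  rewrite -setIUr; congr (_ `&` _); apply/seteqP; split => t /=; rewrite !in_itv/=.
    by move=> tq; have [tp|pt] := leP t p; [left|right].
  by case=> [tp|/andP[_ //]]; exact: le_trans pq.
rewrite (rmuU (@lebesgue01 R) (mp _ _) (mp _ _)); first by rewrite addrC addKr.
apply/seteqP; split => // t [[_ /=]]; rewrite in_itv/= => tp [_]; rewrite /= in_itv/=.
by rewrite ltNge tp.
Qed.

Lemma set_cdf_le U p q : measurable U -> p <= q -> set_cdf U p <= set_cdf U q.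
Proof. by move=> mU pq; rewrite -subr_ge0 set_cdfB// rmu_ge0. Qed.

Lemma rmu_itv_le (A : set R) p q : measurable A -> A `<=` `[p, q] -> p <= q -> m A <= q - p.
Proof.
move=> mA Apq pq; rewrite -lee_fin -(rmuE (@lebesgue01 R) mA).
apply: (@le_trans _ _ (lebesgue_measure (`[p, q] : set R))).
  apply: le_measure; rewrite ?inE//.
  - exact: measurableI mA (@measurable_I01 R).
  - by move=> t [/Apq].
by rewrite lebesgue_measure_itv/= lte_fin; case: ifP => //; rewrite lee_fin subr_ge0.
Qed.

Lemma set_cdf_lipschitz U p q : measurable U -> p <= q -> set_cdf U q - set_cdf U p <= q - p.
Proof.
move=> mU pq; rewrite set_cdfB//; apply: rmu_itv_le => //.
- by apply: measurableI => //; exact: measurable_itv.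
- by move=> t [_ /=]; rewrite !in_itv/= => /andP[/ltW -> ->].
Qed.

Lemma set_cdfB_le U U' p q : measurable U -> measurable U' -> U `<=` U' -> p <= q ->
  set_cdf U q - set_cdf U p <= set_cdf U' q - set_cdf U' p.
Proof.
move=> mU mU' UU' pq; rewrite !set_cdfB//; apply: rmu_le.
- by apply: measurableI => //; exact: measurable_itv.
- by apply: measurableI => //; exact: measurable_itv.
- exact: setSI.
Qed.

Lemma rmu_itv_oo p q : 0 <= p -> p <= q -> q <= 1 -> m `]p, q[ = q - p.
Proof.
move=> p0 pq q1; apply: EFin_inj; rewrite -lebesgue01E; last 2 first.
- exact: measurable_itv.
- move=> t /=; rewrite /I01/= !in_itv/= => /andP[pt tq].
  by rewrite (le_trans p0 (ltW pt)) (le_trans (ltW tq) q1).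
rewrite lebesgue_measure_itv/= lte_fin; case: ltP => // qp.
have -> : p = q by apply/eqP; rewrite eq_le pq qp.
by rewrite subrr.
Qed.

Lemma set_cdf_cover U p q : measurable U -> 0 <= p -> p <= q -> q <= 1 ->
  `]p, q[ `<=` U -> set_cdf U q - set_cdf U p = q - p.
Proof.
move=> mU p0 pq q1 pqU; apply/eqP; rewrite eq_le set_cdf_lipschitz//= set_cdfB//.
rewrite -{1}(rmu_itv_oo p0 pq q1); apply: rmu_le.
- exact: measurable_itv.
- by apply: measurableI => //; exact: measurable_itv.
- by move=> t pqt; split; [exact: pqU|move: pqt; rewrite /= !in_itv/= => /andP[-> /ltW]].
Qed.

Lemma set_cdf_total U : measurable U -> set_cdf U 1 - set_cdf U 0 = m U.
Proof.
move=> mU; rewrite set_cdfB//.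
have mU1 : measurable (U `&` `]0, 1]) by apply: measurableI => //; exact: measurable_itv.
apply/eqP; rewrite eq_le; apply/andP; split.
  by apply: rmu_le => //; exact: subIsetl.
have mD : measurable (U `\` (U `&` `]0, 1])) by exact: measurableD.
rewrite -subr_le0 -{1}(setIidr (@subIsetl _ U `]0, 1])) -rmuD//.
rewrite -lee_fin -(rmuE (@lebesgue01 R) mD).
apply: (@le_trans _ _ (lebesgue_measure ([set 0] : set R))); last by rewrite lebesgue_measure_set1.
apply: le_measure; rewrite ?inE//.
- exact: measurableI mD (@measurable_I01 R).
move=> t [[Ut nt]]; rewrite /I01/= in_itv/= => /andP[t0 t1].
apply/eqP; rewrite eq_le t0 andbT leNgt; apply/negP => t00.
by apply: nt; split => //=; rewrite in_itv/= t00.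
Qed.

Lemma set_cdf_ivt U p q v : measurable U -> p <= q -> set_cdf U p <= v -> v <= set_cdf U q ->
  exists t, [/\ p <= t, t <= q & set_cdf U t = v].
Proof.
move=> mU pq pv vq.
have lip x y : `|set_cdf U x - set_cdf U y| <= `|x - y|.
  wlog xy : x y / x <= y.
    move=> h; have [xy|yx] := leP x y; first exact: h.
    by rewrite distrC [leRHS]distrC; apply: h; exact: ltW.
  rewrite distrC ger0_norm ?subr_ge0 ?set_cdf_le// distrC ger0_norm ?subr_ge0//.
  exact: set_cdf_lipschitz.
have cG : continuous (set_cdf U).
  move=> x; apply/cvgrPdist_lt => e e0; near=> y.
  apply: le_lt_trans (lip x y) _; near: y.
  by move: e e0; apply/cvgrPdist_lt; exact: cvg_id.
have hv : Num.min (set_cdf U p) (set_cdf U q) <= v <= Num.max (set_cdf U p) (set_cdf U q).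
  by rewrite ge_min pv le_max vq orbT.
have [t] := IVT pq (continuous_subspaceT cG) hv.
by rewrite in_itv/= => /andP[pt tq] <-; exists t.
Unshelve. all: by end_near. Qed.

End distribution_function.

Section bumps.
Context (R : realType) (F : nat -> set (set R)) (k : nat).
Hypothesis hF : interval_filtration F.
Hypothesis k0 : (0 < k)%N.
Local Notation V := (accumulation_set F).
Local Notation m := (rmu (@lebesgue01 R)).
Local Notation G := (set_cdf V).

Lemma closed_accumulation_set : closed V.
Proof.
apply: limit_point_closed; apply: hausdorff_accessible; exact: Rhausdorff.
Qed.

Lemma measurable_accumulation_set : measurable V.
Proof. exact: closed_measurable closed_accumulation_set. Qed.

Lemma endpoints_I01 n : endpoints (F n) `<=` @I01 R.
Proof.
move=> t [A aA cA]; have AI := partition_sub (filtration_partition hF n) aA.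
have [a0 Aa0] : A !=set0 by case: aA.
have lbA : has_lbound A by exists 0 => s /AI; rewrite /I01/= in_itv/= => /andP[].
have ubA : has_ubound A by exists 1 => s /AI; rewrite /I01/= in_itv/= => /andP[].
have := AI a0 Aa0; rewrite /I01/= !in_itv/= => /andP[a00 a01].
case: cA => ->; apply/andP; split.
- by apply: lb_le_inf; [exists a0|move=> s /AI; rewrite /I01/= in_itv/= => /andP[]].
- by apply: le_trans a01; exact: ge_inf.
- by apply: le_trans a00 _; exact: ub_le_sup.
- by apply: sup_le_ub; [exists a0|move=> s /AI; rewrite /I01/= in_itv/= => /andP[]].
Qed.

Lemma accumulation_set_I01 : V `<=` @I01 R.
Proof.
apply: subset_trans (@subset_limit_point _ _) _.
have cI : closed (@I01 R) by exact: itv_closed.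
rewrite (closure_id (@I01 R)).1//; apply: closure_subset.
by move=> t [n _]; exact: endpoints_I01.
Qed.

Lemma accumulation_point_between (p q : R) : p < q -> G p < G q ->
  exists2 x, V x & p < x < q.
Proof.
move=> pq Gpq; have mV := measurable_accumulation_set.
apply: contrapT => nx.
have : G q - G p <= 0.
  rewrite set_cdfB ?(ltW pq)//.
  apply: (@le_trans _ _ (m [set q])).
    apply: rmu_le => //; first by apply: measurableI => //; exact: measurable_itv.
    move=> t [Vt /=]; rewrite in_itv/= => /andP[pt]; rewrite le_eqVlt => /orP[/eqP//|tq].
    by exfalso; apply: nx; exists t; rewrite ?pt.
  have := @rmu_itv_le R [set q] q q (measurable_set1 _) _ (lexx _).
  by rewrite subrr; apply=> t /= ->; rewrite in_itv/= lexx.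
by lra.
Qed.

Lemma infinite_endpoints (p q : R) : p < q -> G p < G q ->
  infinite_set (\bigcup_n endpoints (F n) `&` `]p, q[).
Proof.
move=> pq /(accumulation_point_between pq)[x Vx pxq].
have := (limit_point_infinite_setP _ _).1 Vx [set` `]p, q[].
rewrite setIC; apply.
by apply: open_nbhs_nbhs; split; [exact: itv_open|rewrite /= in_itv].
Qed.

Lemma spline_filtration n n' (f : R -> R) : (n <= n')%N ->
  spline (F n) k f -> spline (F n') k f.
Proof. by move=> nn'; apply: spline_refines; exact: filtration_refines. Qed.

(** The bump rises between p and a and falls between b and q, where a and b cut off V-measure theta
    at either end; this positive measure provides the knots. If V has measure at most 2 theta in the
    interval, the zero function does. *)
Lemma bump_exists (p q theta : R) : 0 <= p -> p <= q -> q <= 1 -> 0 < theta ->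
  exists n (phi : R -> R) (W : set R), [/\ spline (F n) k phi,
    forall t, I01 t -> 0 <= phi t <= 1,
    forall t, I01 t -> phi t != 0 -> p < t < q,
    [/\ measurable W, W `<=` `]p, q[ & forall t, W t -> phi t = 1]
  & G q - G p - 2 * theta <= m (V `&` W)].
Proof.
move=> p0 pq q1 th0; have mV := measurable_accumulation_set.
have [small|big] := leP (G q - G p) (2 * theta).
  exists 0%N, (fun=> 0), set0; split => //.
  - exact: spline0.
  - by move=> t _; rewrite lexx ler01.
  - by move=> t _; rewrite eqxx.
  - by split.
  - by rewrite setI0 rmu0 subr_le0.
have [a [pa aq Ga]] : exists a, [/\ p <= a, a <= q & G a = G p + theta].
  by apply: set_cdf_ivt => //; lra.
have [b [pb bq Gb]] : exists b, [/\ p <= b, b <= q & G b = G q - theta].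
  by apply: set_cdf_ivt => //; lra.
have lt_of_G x y : G x < G y -> x < y.
  by move=> h; rewrite ltNge; apply/negP => /(set_cdf_le mV); rewrite leNgt h.
have pa' : p < a by apply: lt_of_G; lra.
have bq' : b < q by apply: lt_of_G; lra.
have ab : a < b by apply: lt_of_G; lra.
have i1 : infinite_set (\bigcup_n endpoints (F n) `&` `]p, a[).
  by apply: infinite_endpoints => //; lra.
have i2 : infinite_set (\bigcup_n endpoints (F n) `&` `]b, q[).
  by apply: infinite_endpoints => //; lra.
have [n1 h1] := filtration_step hF k0 i1.
have [n2 h2] := filtration_step hF k0 i2.
have [s1 [sp1 s101 s10 s11]] := h1 (maxn n1 n2) (leq_maxl _ _).
have [s2 [sp2 s201 s20 s21]] := h2 (maxn n1 n2) (leq_maxr _ _).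
exists (maxn n1 n2), (fun t => (-1) * s2 t + s1 t), [set` `[a, b]]; split.
- exact: spline_linear.
- move=> t It; have := s101 t; have := s201 t.
  have [tb|bt] := leP t b; first by rewrite s20//; lra.
  by rewrite s11//; [lra|exact/ltW/(lt_trans ab)].
- move=> t It h; apply/andP; split; rewrite ltNge; apply/negP => th.
    by move/eqP : h; apply; rewrite s20 ?s10//; [ring|exact: le_trans th pb].
  move/eqP : h; apply; rewrite s21 ?s11//; first by ring.
  exact/(le_trans _ th)/ltW/(lt_trans ab bq').
- split; first exact: measurable_itv.
    move=> t /=; rewrite !in_itv/= => /andP[at_ tb].
    by rewrite (lt_le_trans pa' at_) (le_lt_trans tb bq').
  move=> t /=; rewrite in_itv/= => /andP[at_ tb].
  rewrite s20// s11//; first by ring.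
  rewrite /I01/= in_itv/=; apply/andP; split.
    exact: le_trans (le_trans p0 pa) at_.
  exact: le_trans tb (le_trans bq q1).
- apply: (@le_trans _ _ (G b - G a)); first by rewrite Ga Gb; lra.
  rewrite set_cdfB ?(ltW ab)//; apply: rmu_le.
  + by apply: measurableI => //; exact: measurable_itv.
  + by apply: measurableI => //; exact: measurable_itv.
  + by move=> t [Vt]; rewrite /= !in_itv/= => /andP[/ltW -> ->].
Qed.

End bumps.

Section cells.
Context (R : realType) (F : nat -> set (set R)) (k : nat).
Hypothesis hF : interval_filtration F.
Hypothesis k0 : (0 < k)%N.
Local Notation V := (accumulation_set F).
Local Notation m := (rmu (@lebesgue01 R)).
Local Notation G := (set_cdf V).
Local Notation mu := (@lebesgue_measure R).

Lemma Rintegral_indicator (A : set R) : measurable A ->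
  \int[mu]_(t in @I01 R) (\1_A t) = m A.
Proof. by move=> mA; rewrite /Rintegral integral_indic//; exact: measurable_I01. Qed.

Lemma bump_integral n (phi e : R -> R) (W : set R) (p q e0 omega : R) j :
  0 <= p -> p <= q -> q <= 1 ->
  spline (F n) k phi -> (forall t, I01 t -> 0 <= phi t <= 1) ->
  (forall t, I01 t -> phi t != 0 -> p < t < q) ->
  measurable W -> (forall t, W t -> phi t = 1) -> spline (F j) k e ->
  (forall t, p < t < q -> `|e t - e0| <= omega) ->
  let a := inner phi (fun=> 1) in
  [/\ m W <= a, a <= q - p & `|inner phi e - e0 * a| <= omega * a].
Proof.
move=> p0 pq q1 sphi phi01 phiS mW W1 se eomega a.
have mI := @measurable_I01 R.
have hn := filtration_partition hF n; have hj := filtration_partition hF j.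
have Lphi := spline_L1R hn sphi; have Le := spline_L1R hj se.
have s1 : spline (F n) k (fun=> 1) by exact: spline_cst.
have L1 : L1R (fun=> 1 : R) by exact: (spline_L1R hn s1).
have aE : a = \int[mu]_(t in @I01 R) (phi t).
  by apply: eq_Rintegral => t _; rewrite mulr1.
have ind (A : set R) : measurable A -> mu.-integrable (@I01 R) (EFin \o (\1_A : R -> R)).
  by move=> mA; exact: (integrable_indicator mI (lebesgue_I01_lty R)).
split.
- rewrite aE -Rintegral_indicator//; apply: le_Rintegral => //; first exact: ind.
  move=> t It; rewrite indicE; have [/set_mem Wt|_] := boolP (t \in W).
    by rewrite W1.
  by have /andP[] := phi01 t It.
- have mpq : measurable [set` `]p, q[] by exact: measurable_itv.
  rewrite aE -(rmu_itv_oo p0 pq q1) -Rintegral_indicator//; apply: le_Rintegral => //.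
    exact: ind.
  move=> t It; rewrite indicE; have /andP[phi0 phi1] := phi01 t It.
  have [->|tn] := eqVneq (phi t) 0; first by rewrite ler0n.
  by rewrite mem_set//= in_itv/= phiS.
- have -> : inner phi e - e0 * a = inner (fun t => (- e0) * 1 + e t) phi.
    rewrite (inner_linear hn _ L1 Le sphi) (innerC (fun=> 1)) (innerC e) -/a; ring.
  have iw : mu.-integrable (@I01 R) (EFin \o (fun t => (- e0 * 1 + e t) * phi t)).
    by apply: (L1R_mul_spline hn _ sphi); exact: L1R_linear.
  have ir : mu.-integrable (@I01 R) (EFin \o (fun t => omega * phi t)).
    by have := integrableZl mI omega Lphi.
  apply: (le_trans (le_normr_Rintegral mI iw)).
  rewrite aE -RintegralZl//; apply: le_Rintegral => //; first exact: integrable_norm.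
  move=> t It; have /andP[phi0 _] := phi01 t It.
  rewrite normrM (ger0_norm phi0) mulr1.
  have [->|tn] := eqVneq (phi t) 0; first by rewrite !mulr0.
  by rewrite ler_wpM2r// addrC eomega// phiS.
Qed.

(** The cell is cut so that the part for x carries V-measure x.1 v. The integral of the bump there
    is only known to lie between x.1 v - 2 theta and the length of the part; the sum of these
    uncertainties is the factor of [K]. The weights need not sum to 1, so that the induction can
    remove one part at a time. *)
Lemma cell_exists (X : normedModType R) (v theta : R) (s : seq (R * X)) :
  0 <= v -> 0 < theta -> (forall x, x \in s -> 0 <= x.1) ->
  forall p q, 0 <= p -> p <= q -> q <= 1 -> G q - G p = (\sum_(x <- s) x.1) * v ->
  exists n (L : seq ((R -> R) * X)) (W : set R), [/\
    forall x, x \in L -> spline (F n) k x.1,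
    forall t, I01 t -> tensor_sum L t != 0 -> p < t < q /\
      exists a x, [/\ 0 <= a, a <= 1, x \in s & tensor_sum L t = a *: x.2],
    [/\ measurable W, W `<=` `]p, q[ & forall t, W t -> exists2 x, x \in s & tensor_sum L t = x.2],
    G q - G p - 2 * (size s)%:R * theta <= m (V `&` W)
  & forall B j e e0 omega K, spline (F j) k e -> 0 <= B -> 0 <= K -> 0 <= omega -> `|e0| <= K ->
      (forall t, p < t < q -> `|e t - e0| <= omega) ->
      (forall x, x \in s -> `|x.2| <= B) ->
      `|coefficient L e - (e0 * v) *: \sum_(x <- s) x.1 *: x.2| <=
        B * (omega * (q - p) + K * ((q - p) - (G q - G p) + 2 * (size s)%:R * theta))].
Proof.
move=> v0 th0; have mV := measurable_accumulation_set F.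
elim: s => [|x s IH] s0 p q p0 pq q1 Gs.
  exists 0%N, [::], set0; rewrite Gs big_nil mul0r; split => //.
  - by move=> t _; rewrite /tensor_sum big_nil eqxx.
  - by split.
  - by rewrite setI0 rmu0 mulr0 mul0r subr0.
  - move=> B j e e0 omega K _ B0 K0 o0 _ _ _.
    rewrite /coefficient big_nil big_nil scaler0 subr0 normr0.
    by rewrite mulr_ge0// addr_ge0// mulr_ge0 ?subr_ge0// mulr0 mul0r addr0 subr0 subr_ge0.
have x0 : 0 <= x.1 by apply: s0; rewrite mem_head.
have s0' y : y \in s -> 0 <= y.1 by move=> ys; apply: s0; rewrite inE ys orbT.
have sum0 : 0 <= \sum_(y <- s) y.1 by rewrite big_seq sumr_ge0.
rewrite big_cons in Gs.
have [r [pr rq Gr]] : exists r, [/\ p <= r, r <= q & G r = G p + x.1 * v].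
  apply: set_cdf_ivt => //; first by rewrite lerDl mulr_ge0.
  have : 0 <= (\sum_(y <- s) y.1) * v by rewrite mulr_ge0.
  by move: Gs; rewrite mulrDl; lra.
have r1 : r <= 1 := le_trans rq q1.
have r0 : 0 <= r := le_trans p0 pr.
have Gs' : G q - G r = (\sum_(y <- s) y.1) * v by move: Gs; rewrite mulrDl; lra.
have [n' [L' [W' [sL' supL' [mW' W'rq hW'] mVW' coefL']]]] := IH s0' r q r0 rq q1 Gs'.
have [n1 [phi [W1 [sphi phi01 phiS [mW1 W1pr hW1] mVW1]]]] := bump_exists hF k0 p0 pr r1 th0.
have I01pq t : p < t < q -> I01 t.
  move=> /andP[pt tq]; rewrite /I01/= in_itv/= (le_trans p0 (ltW pt)).
  exact: le_trans (ltW tq) q1.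
have ts t : tensor_sum ((phi, x.2) :: L') t = phi t *: x.2 + tensor_sum L' t.
  by rewrite /tensor_sum big_cons.
have L'0 t : I01 t -> t <= r -> tensor_sum L' t = 0.
  move=> It tr; apply: contrapT => /eqP /(supL' t It)[/andP[rt _] _].
  by move: rt; rewrite ltNge tr.
have phi0 t : I01 t -> r <= t -> phi t = 0.
  move=> It rt; apply: contrapT => /eqP /(phiS t It)/andP[_].
  by rewrite ltNge rt.
exists (maxn n1 n'), ((phi, x.2) :: L'), (W1 `|` W'); split.
- move=> y; rewrite inE => /orP[/eqP ->|/sL'].
    exact: spline_filtration (leq_maxl _ _) sphi.
  exact: spline_filtration (leq_maxr _ _).
- move=> t It; rewrite ts.
  have [tr|rt] := leP t r.
    rewrite L'0// addr0 => h.
    have phit : phi t != 0 by apply: contraNneq h => ->; rewrite scale0r.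
    have /andP[pt tr'] := phiS t It phit; split.
      by rewrite pt (lt_le_trans tr' rq).
    have /andP[a0 a1] := phi01 t It.
    by exists (phi t), x; rewrite mem_head.
  rewrite phi0 ?ltW// scale0r add0r => /(supL' t It)[/andP[_ tq] [a [y [a0 a1 ys hy]]]].
  split; first by rewrite (le_lt_trans pr rt) tq.
  by exists a, y; rewrite inE ys orbT.
- split; first exact: measurableU.
    move=> t [/W1pr|/W'rq]; rewrite /= !in_itv/= => /andP[pt tq].
      by rewrite pt (lt_le_trans tq rq).
    by rewrite tq (le_lt_trans pr pt).
  move=> t [W1t|W't]; rewrite ts.
    have := W1pr t W1t; rewrite /= in_itv/= => /andP[pt tr].
    have It : I01 t by apply: I01pq; rewrite pt (lt_le_trans tr rq).
    exists x; first by rewrite mem_head.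
    by rewrite hW1// scale1r L'0 ?addr0// ltW.
  have := W'rq t W't; rewrite /= in_itv/= => /andP[rt tq].
  have It : I01 t by apply: I01pq; rewrite tq (le_lt_trans pr rt).
  have [y ys hy] := hW' t W't.
  exists y; first by rewrite inE ys orbT.
  by rewrite phi0 ?ltW// scale0r add0r.
- rewrite setIUr rmuU; last 3 first.
  + exact: measurableI.
  + exact: measurableI.
  + apply/seteqP; split => // t [[_ /W1pr]]; rewrite /= in_itv/= => /andP[_ tr].
    move=> [_ /W'rq]; rewrite /= in_itv/= => /andP[rt _].
    by move: tr; rewrite ltNge (ltW rt).
  have : (size (x :: s))%:R = (size s)%:R + 1 :> R by rewrite /= -addn1 natrD.
  by move=> ->; lra.
move=> B j e e0 omega K se B0 K0 o0 eK eo sB.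
have [||||ha1 ha2 ha3] := @bump_integral n1 phi e (V `&` W1) p r e0 omega j p0 pr r1 sphi phi01 phiS.
- exact: measurableI.
- by move=> t [_ /hW1].
- exact: se.
- by move=> t /andP[pt tr]; apply: eo; rewrite pt (lt_le_trans tr rq).
set a := inner phi (fun=> 1) in ha1 ha2 ha3.
have eo' t : r < t < q -> `|e t - e0| <= omega.
  by move=> /andP[rt tq]; apply: eo; rewrite tq (le_lt_trans pr rt).
have sB' y : y \in s -> `|y.2| <= B by move=> ys; apply: sB; rewrite inE ys orbT.
have h2 := coefL' B j e e0 omega K se B0 K0 o0 eK eo' sB'.
have xB : `|x.2| <= B by apply: sB; rewrite mem_head.
rewrite /coefficient !big_cons -/(coefficient L' e) scalerDr scalerA opprD addrACA.
apply: le_trans (ler_normD _ _) _.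
have h1 : `|inner phi e *: x.2 - (e0 * v * x.1) *: x.2| <=
    B * (omega * (r - p) + K * ((r - p) - (G r - G p) + 2 * theta)).
  rewrite -scalerBl normrZ mulrC; apply: ler_pM => //.
  (* The first difference is the oscillation of e over the part, the second the mismatch between the
     mass of the bump and the mass prescribed by V. *)
  have -> : inner phi e - e0 * v * x.1 = (inner phi e - e0 * a) + e0 * (a - x.1 * v) by ring.
  apply: le_trans (ler_normD _ _) _; apply: lerD.
    by apply: (le_trans ha3); rewrite ler_wpM2l.
  rewrite normrM; apply: ler_pM => //.
  have hl := set_cdf_lipschitz mV pr.
  rewrite ler_norml; apply/andP; split; move: Gr mVW1 hl ha1 ha2; lra.
apply: le_trans (lerD h1 h2) _.
have -> : (size (x :: s))%:R = (size s)%:R + 1 :> R by rewrite /= -addn1 natrD.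
rewrite -mulrDr ler_wpM2l// le_eqVlt; apply/orP; left; apply/eqP; ring.
Qed.

End cells.

Lemma coefficient_cat (R : realType) (X : normedModType R) (L L' : seq ((R -> R) * X)) e :
  coefficient (L ++ L') e = coefficient L e + coefficient L' e.
Proof. by rewrite /coefficient big_cat. Qed.

Lemma tensor_sum_cat (R : realType) (X : normedModType R) (L L' : seq ((R -> R) * X)) t :
  tensor_sum (L ++ L') t = tensor_sum L t + tensor_sum L' t.
Proof. by rewrite /tensor_sum big_cat. Qed.

Section strips.
Context (R : realType) (F : nat -> set (set R)) (k : nat).
Hypothesis hF : interval_filtration F.
Hypothesis k0 : (0 < k)%N.
Local Notation V := (accumulation_set F).
Local Notation m := (rmu (@lebesgue01 R)).
Local Notation G := (set_cdf V).
Variables (X : normedModType R) (U : set R) (d : nat) (e : nat -> R -> R).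
Variables (delta M kappa : R) (Q : R -> X -> Prop).
Hypothesis mU : measurable U.
Hypothesis VU : V `<=` U.
Hypothesis M0 : 0 <= M.
Hypothesis kappa0 : 0 < kappa.
Local Notation H := (set_cdf U).

(* The error terms are increments over [p, q] of functions of one variable, so
   that they add up when strips are concatenated. *)
Definition strip (p q : R) := exists n (L : seq ((R -> R) * X)) (W : set R), [/\
  forall x, x \in L -> spline (F n) k x.1,
  forall t, I01 t -> tensor_sum L t != 0 -> p < t < q /\ Q t (tensor_sum L t),
  [/\ measurable W, W `<=` `]p, q[ & forall t, W t -> delta <= `|tensor_sum L t| ],
  G q - G p - kappa * (q - p) <= m (V `&` W)
  & forall i, (i < d)%N -> `|coefficient L (e i)| <=
      M * ((H q - H p) - (G q - G p)) + kappa * (q - p)].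

Let mV : measurable V := measurable_accumulation_set F.

(** No perturbation is made where V is null, since no knots may be available there. The coefficient
    bound is still nonnegative because V is contained in [U]. *)
Lemma strip_null p q : p <= q -> G q <= G p -> strip p q.
Proof.
move=> pq Gqp; have kpq : 0 <= kappa * (q - p) by rewrite mulr_ge0 ?subr_ge0 ?(ltW kappa0).
have GH := set_cdfB_le mV mU VU pq.
exists 0%N, [::], set0; split => //.
- by move=> t _; rewrite /tensor_sum big_nil eqxx.
- by split.
- by rewrite setI0 rmu0; lra.
- move=> i _; rewrite /coefficient big_nil normr0 addr_ge0// mulr_ge0//.
  by rewrite subr_ge0.
Qed.

(** The perturbations live on disjoint open intervals, so at each point of [0,1] at most one is
    nonzero and the pointwise clauses carry over. *)
Lemma strip_cat p r q : 0 <= p -> p <= r -> r <= q -> q <= 1 ->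
  strip p r -> strip r q -> strip p q.
Proof.
move=> p0 pr rq q1.
move=> [n1 [L1 [W1 [sL1 QL1 [mW1 W1pr hW1] mVW1 cL1]]]].
move=> [n2 [L2 [W2 [sL2 QL2 [mW2 W2rq hW2] mVW2 cL2]]]].
have L10 t : I01 t -> r <= t -> tensor_sum L1 t = 0.
  move=> It rt; apply: contrapT => /eqP /(QL1 t It)[/andP[_ tr] _].
  by move: tr; rewrite ltNge rt.
have L20 t : I01 t -> t <= r -> tensor_sum L2 t = 0.
  move=> It tr; apply: contrapT => /eqP /(QL2 t It)[/andP[rt _] _].
  by move: rt; rewrite ltNge tr.
have I01pq t : p < t < q -> I01 t.
  move=> /andP[pt tq]; rewrite /I01/= in_itv/= (le_trans p0 (ltW pt)).
  exact: le_trans (ltW tq) q1.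
exists (maxn n1 n2), (L1 ++ L2), (W1 `|` W2); split.
- move=> x; rewrite mem_cat => /orP[/sL1|/sL2].
    exact: (spline_filtration hF (leq_maxl _ _)).
  exact: (spline_filtration hF (leq_maxr _ _)).
- move=> t It; rewrite tensor_sum_cat; have [tr|rt] := leP t r.
    rewrite (L20 t It tr) addr0 => /(QL1 t It)[/andP[-> tr'] h].
    by rewrite (lt_le_trans tr' rq).
  rewrite (L10 t It (ltW rt)) add0r => /(QL2 t It)[/andP[rt' ->] h].
  by rewrite (le_lt_trans pr rt').
- split; first exact: measurableU.
    move=> t [/W1pr|/W2rq]; rewrite /= !in_itv/= => /andP[pt tq].
      by rewrite pt (lt_le_trans tq rq).
    by rewrite tq (le_lt_trans pr pt).
  move=> t [W1t|W2t]; rewrite tensor_sum_cat.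
    have := W1pr t W1t; rewrite /= in_itv/= => /andP[pt tr].
    have It : I01 t by apply: I01pq; rewrite pt (lt_le_trans tr rq).
    by rewrite (L20 t It (ltW tr)) addr0; exact: hW1.
  have := W2rq t W2t; rewrite /= in_itv/= => /andP[rt tq].
  have It : I01 t by apply: I01pq; rewrite tq (le_lt_trans pr rt).
  by rewrite (L10 t It (ltW rt)) add0r; exact: hW2.
- rewrite setIUr rmuU; last 3 first.
  + exact: measurableI.
  + exact: measurableI.
  + apply/seteqP; split => // t [[_ /W1pr]]; rewrite /= in_itv/= => /andP[_ tr].
    move=> [_ /W2rq]; rewrite /= in_itv/= => /andP[rt _].
    by move: tr; rewrite ltNge (ltW rt).
  by lra.
- move=> i id; rewrite coefficient_cat; apply: le_trans (ler_normD _ _) _.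
  by have := cL1 i id; have := cL2 i id; lra.
Qed.

End strips.

(** * Cutting [0,1] into short intervals inside atoms *)

Section splitting.
Context (R : realType).
Variable P : R -> R -> Prop.
Hypothesis Pcat : forall p r q : R, 0 <= p -> p < r -> r < q -> q <= 1 ->
  P p r -> P r q -> P p q.

Lemma split_at_points (pts : seq R) :
  (forall p q : R, 0 <= p -> p < q -> q <= 1 ->
    (forall z, z \in pts -> ~~ (p < z < q)) -> P p q) ->
  forall p q : R, 0 <= p -> p < q -> q <= 1 -> P p q.
Proof.
elim: pts => [h p q p0 pq q1|z pts IH h]; first exact: h.
apply: IH => p q p0 pq q1 hpts.
have [/andP[pz zq]|nz] := boolP (p < z < q); last first.
  by apply: h => // w; rewrite inE => /orP[/eqP ->//|]; exact: hpts.
have z0 := le_trans p0 (ltW pz); have z1 := le_trans (ltW zq) q1.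
apply: (Pcat p0 pz zq q1); apply: h => // w; rewrite inE => /orP[/eqP ->|/hpts].
- by rewrite ltxx andbF.
- by apply: contra => /andP[-> wz]; rewrite (lt_trans wz).
- by rewrite ltxx.
- by apply: contra => /andP[zw ->]; rewrite (lt_trans pz zw).
Qed.

Lemma split_short (h : R) : 0 < h ->
  (forall p q : R, 0 <= p -> p < q -> q <= 1 -> q - p <= h -> P p q) ->
  forall p q : R, 0 <= p -> p < q -> q <= 1 -> P p q.
Proof.
move=> h0 Ph p q p0 pq q1; have qph : 0 <= (q - p) / h by rewrite divr_ge0 ?(ltW h0)// subr_ge0 ltW.
have [n] : exists n, (q - p) / h < n%:R by exists (Num.Def.archi_bound ((q - p) / h)); exact: archi_boundP.
rewrite ltr_pdivrMr// => /ltW; elim: n p p0 pq {qph} => [|n IH] p p0 pq hn.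
  by move: hn pq; rewrite mul0r; lra.
have [qph|hqp] := leP (q - p) h; first exact: Ph.
have n1 : n.+1%:R = n%:R + 1 :> R by rewrite -addn1 natrD.
have [? ?] : 0 <= p + h /\ p < p + h by lra.
apply: (@Pcat p (p + h) q) => //; first lra.
  apply: Ph => //; lra.
apply: IH => //; [lra|].
by move: hn; rewrite n1 mulrDl; lra.
Qed.

End splitting.

Section partition_splitting.
Context (R : realType) (G : set (set R)).
Hypothesis hG : interval_partition (atom G).

(** Take the atom containing the midpoint: if it missed some t of the interval, one of its endpoints
    would lie between t and the midpoint. *)
Lemma sub_atom (p q : R) : 0 <= p -> p < q -> q <= 1 ->
  (forall z, endpoints G z -> ~~ (p < z < q)) ->
  exists2 A, atom G A & `]p, q[ `<=` A.
Proof.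
move=> p0 pq q1 hz.
pose c := (p + q) / 2; have [pc cq] : p < c /\ c < q by rewrite /c; split; lra.
have Ic : I01 c by rewrite /I01/= in_itv/=; apply/andP; split; lra.
have [A aA Ac] := partition_in hG Ic; exists A => //.
have AI := partition_sub hG aA; have [_ _ /(_ A aA)[iA _]] := hG.
have lbA : has_lbound A by exists 0 => s /AI; rewrite /I01/= in_itv/= => /andP[].
have ubA : has_ubound A by exists 1 => s /AI; rewrite /I01/= in_itv/= => /andP[].
move=> t; rewrite /= in_itv/= => /andP[pt tq]; apply: contrapT => nAt.
have [tc|ct] := leP t c.
  have /negP := hz (inf A) (ex_intro2 _ _ A aA (or_introl erefl)); apply.
  apply/andP; split; last by apply: le_lt_trans cq; exact: ge_inf.
  apply: lt_le_trans pt _; apply: lb_le_inf; first by exists c.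
  move=> s As; rewrite leNgt; apply/negP => st; apply: nAt.
  by apply: (iA s c) => //; rewrite (ltW st).
have /negP := hz (sup A) (ex_intro2 _ _ A aA (or_intror erefl)); apply.
apply/andP; split; first by apply: lt_le_trans pc _; exact: ub_le_sup.
apply: le_lt_trans tq; apply: sup_le_ub; first by exists c.
move=> s As; rewrite leNgt; apply/negP => st; apply: nAt.
by apply: (iA c s) => //; rewrite (ltW st) ltW.
Qed.

Lemma split_at_atoms (P : R -> R -> Prop) (h : R) : 0 < h ->
  (forall p r q : R, 0 <= p -> p < r -> r < q -> q <= 1 -> P p r -> P r q -> P p q) ->
  (forall p q A, 0 <= p -> p < q -> q <= 1 -> q - p <= h -> atom G A ->
    `]p, q[ `<=` A -> P p q) -> P 0 1.
Proof.
move=> h0 Pcat Pcell.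
have [/finite_seqP[s sE] _ _] := hG.
apply: (@split_at_points _ P Pcat (map inf s ++ map sup s)) => // p q p0 pq q1 hz.
suff [A aA pqA] : exists2 A, atom G A & `]p, q[ `<=` A.
  (* [split_short] concerns all intervals in [0,1]; relativizing to subintervals of [p, q] keeps
     every cell inside the atom [A]. *)
  pose P' (a b : R) := p <= a -> b <= q -> P a b.
  have : P' p q; last by apply.
  apply: (@split_short _ P' _ h) => // a.
    move=> r b a0 ar rb b1 Par Prb pa bq; apply: (Pcat a r b) => //.
      by apply: Par => //; rewrite (le_trans (ltW rb)).
    by apply: Prb => //; rewrite (le_trans pa) ?ltW.
  move=> b a0 ab b1 bah pa bq; apply: (Pcell _ _ A) => // t /=.
  rewrite in_itv/= => /andP[at_ tb]; apply: pqA.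
  by rewrite /= in_itv/= (le_lt_trans pa at_) (lt_le_trans tb bq).
apply: sub_atom => // z [A aA [->|->]]; apply: hz; rewrite mem_cat.
  by apply/orP; left; apply: map_f; move: aA; rewrite sE.
by apply/orP; right; apply: map_f; move: aA; rewrite sE.
Qed.

End partition_splitting.

(** Neighborhoods of shrinking radius decrease to the closed set V, so their measures converge to
    that of V. The radius [h] bounds cell lengths: a shorter cell containing a point of V lies in
    [U]. *)
Lemma closed_neighborhood (R : realType) (V : set R) (eps : R) : closed V -> 0 < eps ->
  exists U h, [/\ measurable U, 0 < h, rmu (@lebesgue01 R) U <= rmu (@lebesgue01 R) V + eps
    & forall x t, V x -> `|x - t| < h -> U t].
Proof.
move=> cV eps0.
pose U n := \bigcup_(x in V) (ball x (n.+1%:R^-1 : R)).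
have oU n : open (U n) by apply: bigcup_open => x _; exact: ball_open.
have mU n : measurable (U n) by exact: open_measurable.
have mV : measurable V by exact: closed_measurable.
have VE : \bigcap_n U n = V.
  apply/seteqP; split => [t Ut|t Vt n _]; last by exists t => //; apply: ballxx.
  rewrite [V](closure_id V).1// => B /nbhs_ballP[r /= r0 rB].
  have [n nr] : exists n, n.+1%:R^-1 < r.
    have := near_infty_natSinv_lt (PosNum r0) => -[n _ /(_ n (leqnn n)) h].
    by exists n.
  have [x Vx xt] := Ut n I; exists x; split => //; apply: rB.
  by apply: ball_sym; apply: le_ball xt; exact: ltW.
have niU : nonincreasing_seq U.
  move=> i j ij; apply/subsetPset => t [x Vx xt]; exists x => //.
  by apply: le_ball xt; rewrite lef_pV2 ?posrE// ler_nat.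
have fin : (lebesgue01 (U 0%N) < +oo)%E.
  rewrite -ge0_fin_numE; last exact: measure_ge0.
  exact: (lebesgue01_fin_num (mU 0%N)).
have cU : (lebesgue01 (U n) @[n --> \oo] --> lebesgue01 (\bigcap_n U n))%E.
  by apply: (@nonincreasing_cvg_mu _ _ R (@lebesgue01 R)) => //; rewrite VE.
move: cU; rewrite VE (rmuE (@lebesgue01 R) mV) => /fine_cvg/cvgrPdist_lt/(_ _ eps0).
move=> [n _ /(_ n (leqnn n)) hn'].
have {hn'}hn : `|rmu (@lebesgue01 R) V - rmu (@lebesgue01 R) (U n)| < eps := hn'.
exists (U n), (n.+1%:R^-1); split.
- exact: mU.
- by rewrite invr_gt0.
- by move: hn; rewrite ltr_norml => /andP[+ _]; lra.
- by move=> x t Vx xt; exists x.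
Qed.

Definition close_to (R : realType) (X : normedModType R) (D : set X) (r : R) (z : X) :=
  exists2 y, D y & `|z - y| < r.

Section cell_strip.
Context (R : realType) (F : nat -> set (set R)) (k : nat).
Hypothesis hF : interval_filtration F.
Hypothesis k0 : (0 < k)%N.
Local Notation V := (accumulation_set F).
Local Notation G := (set_cdf V).
Variables (X : normedModType R) (U : set R) (d : nat) (e : nat -> R -> R).
Variables (D : set X) (delta C : R).
Hypothesis nonD : nondentable D delta.
Hypothesis DC : forall x, D x -> `|x| <= C.
Hypothesis convD : forall x y a, 0 <= a -> a <= 1 -> D x -> D y -> D (a *: x + (1 - a) *: y).
Variables (m0 : nat) (f : R -> X) (rho beta kappa K L h : R).
Hypothesis mU : measurable U.
Hypothesis VU : V `<=` U.
Hypothesis K0 : 0 <= K.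
Hypothesis C0 : 0 <= C.
Hypothesis L0 : 0 <= L.
Hypothesis h0 : 0 <= h.
Hypothesis kappa0 : 0 < kappa.
Hypothesis fD : forall t, I01 t -> close_to D rho (f t).
Hypothesis f_lip : forall A s t, atom (F m0) A -> A s -> A t -> `|f s - f t| <= L * `|s - t|.
Hypothesis e_spline : forall i, (i < d)%N -> spline (F m0) k (e i).
Hypothesis eK : forall i t, (i < d)%N -> I01 t -> `|e i t| <= K.
Hypothesis e_lip : forall i A s t, (i < d)%N -> atom (F m0) A -> A s -> A t ->
  `|e i s - e i t| <= L * `|s - t|.
Hypothesis fh : L * h <= beta.
Hypothesis eh : 2 * C * (L * h) <= kappa / 4.

(** The budget kappa (q - p) pays, by a quarter each, for the oscillation of the basis on the cell,
    for the bump losses [theta], and for the error in the approximation of u. *)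
Lemma cell_strip p q A : 0 <= p -> p < q -> q <= 1 -> q - p <= h -> atom (F m0) A ->
  `]p, q[ `<=` A -> (G p < G q -> `]p, q[ `<=` U) ->
  strip F k U d e delta (2 * C * K) kappa (fun t w => close_to D (rho + beta) (f t + w)) p q.
Proof.
move=> p0 pq q1 qph aA pqA pqU.
have M0 : 0 <= 2 * C * K by rewrite !mulr_ge0.
have [Gqp|Gpq] := leP (G q) (G p); first exact: strip_null (ltW pq) Gqp.
have [mid pmid midq] : exists2 mid, p < mid & mid < q by exists ((p + q) / 2); lra.
have I01pq t : p < t < q -> I01 t.
  move=> /andP[pt tq]; rewrite /I01/= in_itv/= (le_trans p0 (ltW pt)).
  exact: le_trans (ltW tq) q1.
have Apq t : p < t < q -> A t by move=> ptq; apply: pqA; rewrite /= in_itv.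
have Amid : A mid by apply: Apq; rewrite pmid.
have Imid : I01 mid by apply: I01pq; rewrite pmid.
have dist t : p < t < q -> L * `|t - mid| <= L * h.
  move=> /andP[pt tq]; rewrite ler_wpM2l// ler_norml; apply/andP; split; lra.
have [u Du fu] := fD Imid.
have K1 : 0 < K + 1 by apply: ltr_wpDl.
(* The tolerance is kappa / (4 (K + 1)), since this error is multiplied by a value of a basis
   spline, at most [K]; the 1 guards against K = 0. *)
have [s [hs sum1 su]] := nonD Du (divr_gt0 kappa0 (mulr_gt0 (ltr0n _ 4) K1)).
set s' := [seq (x.1, x.2 - u) | x <- s].
have s'P y : y \in s' -> exists2 x, x \in s & y = (x.1, x.2 - u).
  by move=> /mapP[x xs ->]; exists x.
have s'0 y : y \in s' -> 0 <= y.1 by move=> /s'P[x /hs[x0 _ _] ->].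
have sum1' : \sum_(y <- s') y.1 = 1 by rewrite big_map.
have sumu : \sum_(y <- s') y.1 *: y.2 = \sum_(x <- s) x.1 *: x.2 - u.
  rewrite big_map/= (eq_bigr (fun x : R * X => x.1 *: x.2 - x.1 *: u)); last first.
    by move=> x _; rewrite scalerBr.
  by rewrite sumrB -scaler_suml sum1 scale1r.
set M := 2 * C * K in M0 *.
set N : R := (size s')%:R.
have N0 : 0 <= N by exact: ler0n.
(* Chosen so that the total loss 2 N theta fits the budget both directly and after multiplication by
   M; the added ones keep the denominator positive. *)
pose theta := kappa * (q - p) / (8 * (M + 1) * (N + 1)).
have den0 : 0 < 8 * (M + 1) * (N + 1) by rewrite !mulr_gt0// ltr_wpDl.
have qp0 : 0 < q - p by rewrite subr_gt0.
have th0 : 0 < theta by rewrite divr_gt0// mulr_gt0.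
have thE : theta * (M + 1) * (N + 1) = kappa * (q - p) / 8.
  by rewrite /theta; field; rewrite !gt_eqF// ltr_wpDl.
have thM : M * (2 * N * theta) <= kappa * (q - p) / 4.
  have : 0 <= theta * (M + N + 1) by rewrite mulr_ge0 ?(ltW th0)// !addr_ge0.
  by move: thE; rewrite !mulrDr !mulrDl !mulr1; lra.
have thN : 2 * N * theta <= kappa * (q - p).
  have : 0 <= theta * (M * N + M + 1) by rewrite mulr_ge0 ?(ltW th0)// !addr_ge0// mulr_ge0.
  have : 0 < kappa * (q - p) by rewrite mulr_gt0.
  by move: thE; rewrite !mulrDr !mulrDl !mulr1; lra.
have Gs : G q - G p = (\sum_(y <- s') y.1) * (G q - G p) by rewrite sum1' mul1r.
have Gpq0 : 0 <= G q - G p by rewrite subr_ge0 ltW.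
have [n [L1 [W [sL1 L1s [mW Wpq hW] mVW cL1]]]] :=
  cell_exists hF k0 Gpq0 th0 s'0 p0 (ltW pq) q1 Gs.
exists n, L1, W; split => //.
- move=> t It /(L1s t It)[ptq [a [y [a0 a1 /s'P[x xs ->] ->]]]]; split => //=.
  have [_ Dx _] := hs x xs.
  exists (a *: x.2 + (1 - a) *: u); first exact: convD.
  (* On a flank of a bump the comparison point is the mixture of x.2 and u, so the distance to [D]
     exceeds that at the midpoint only by the oscillation of f. *)
  have -> : f t + a *: (x.2 - u) - (a *: x.2 + (1 - a) *: u) = (f mid - u) + (f t - f mid).
    rewrite [RHS]addrC addrA subrK scalerBr scalerBl scale1r opprD opprB -addrA.
    by rewrite addrACA subrr add0r addKr.
  apply: le_lt_trans (ler_normD _ _) _; apply: ltr_leD => //.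
  apply: le_trans (f_lip aA (Apq t ptq) Amid) _.
  exact: le_trans (dist t ptq) fh.
- split => // t /hW[y /s'P[x xs ->] ->] /=.
  by have [_ _] := hs x xs.
- by apply: le_trans mVW; rewrite lerD2l lerN2.
move=> i id.
(* The cell lies in [U], so the mismatch between its length and its V-measure is an increment of the
   two distribution functions, the form required by [strip]. *)
have HG : set_cdf U q - set_cdf U p = q - p.
  exact: (set_cdf_cover mU p0 (ltW pq) q1 (pqU Gpq)).
have Lh0 : 0 <= L * h by rewrite mulr_ge0.
have C20 : 0 <= 2 * C by rewrite mulr_ge0.
have hc := cL1 (2 * C) m0 (e i) (e i mid) (L * h) K (e_spline id) C20 K0 Lh0
  (eK id Imid).
have {hc}hc : `|coefficient L1 (e i) - (e i mid * (G q - G p)) *: \sum_(y <- s') y.1 *: y.2| <=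
    2 * C * (L * h * (q - p) + K * (q - p - (G q - G p) + 2 * (size s')%:R * theta)).
  apply: hc.
    by move=> t ptq; apply: le_trans (e_lip id aA (Apq t ptq) Amid) (dist t ptq).
  move=> y /s'P[x /hs[_ Dx _] ->] /=.
  by apply: le_trans (ler_normB _ _) _; have := DC Dx; have := DC Du; lra.
rewrite -/N sumu in hc.
rewrite -[coefficient _ _](subrK ((e i mid * (G q - G p)) *: (\sum_(x <- s) x.1 *: x.2 - u))).
apply: le_trans (ler_normD _ _) _.
have h2 : `|(e i mid * (G q - G p)) *: (\sum_(x <- s) x.1 *: x.2 - u)| <= kappa * (q - p) / 4.
  rewrite normrZ normrM (ger0_norm Gpq0).
  have Gl := set_cdf_lipschitz (measurable_accumulation_set F) (ltW pq).
  apply: (@le_trans _ _ ((K + 1) * (q - p) * (kappa / (4 * (K + 1))))).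
    apply: ler_pM; rewrite ?mulr_ge0//; last exact: ltW.
    apply: ler_pM => //; apply: le_trans (eK id Imid) _; lra.
  by rewrite le_eqVlt; apply/orP; left; apply/eqP; field; rewrite gt_eqF.
apply: le_trans (lerD hc h2) _.
rewrite HG.
have h3 : 2 * C * (L * h) * (q - p) <= kappa / 4 * (q - p) by rewrite ler_wpM2r// ltW.
have -> : 2 * C * (L * h * (q - p) + K * (q - p - (G q - G p) + 2 * N * theta)) =
  2 * C * (L * h) * (q - p) + M * (q - p - (G q - G p)) + M * (2 * N * theta).
  by rewrite /M; ring.
have := mulr_gt0 kappa0 qp0.
lra.
Qed.

End cell_strip.

Section splines_over_partition.
Context (R : realType) (G : set (set R)) (k : nat).
Hypothesis hG : interval_partition (atom G).

Lemma tensor_sum_lipschitz (X : normedModType R) (L : seq ((R -> R) * X)) :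
  (forall x, x \in L -> spline G k x.1) ->
  exists C, [/\ 0 <= C, forall t, I01 t -> `|tensor_sum L t| <= C
    & forall A s t, atom G A -> A s -> A t ->
        `|tensor_sum L s - tensor_sum L t| <= C * `|s - t|].
Proof.
elim: L => [|x L IH] hL.
  by exists 0; split=> // *; rewrite /tensor_sum !big_nil ?subrr ?mul0r normr0.
have [C [C0 bC lC]] : exists C, [/\ 0 <= C, forall t, I01 t -> `|tensor_sum L t| <= C
    & forall A s t, atom G A -> A s -> A t ->
        `|tensor_sum L s - tensor_sum L t| <= C * `|s - t|].
  by apply: IH => y yL; apply: hL; rewrite inE yL orbT.
have [K [K0 bK lK]] := spline_lipschitz hG (hL x (mem_head _ _)).
have E t : tensor_sum (x :: L) t = x.1 t *: x.2 + tensor_sum L t.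
  by rewrite /tensor_sum big_cons.
exists (K * `|x.2| + C); split.
- by rewrite addr_ge0// mulr_ge0.
- move=> t It; rewrite E; apply: le_trans (ler_normD _ _) _; apply: lerD; last exact: bC.
  by rewrite normrZ ler_wpM2r// bK.
- move=> A s t aA As At; rewrite !E opprD addrACA -scalerBl mulrDl.
  apply: le_trans (ler_normD _ _) _; apply: lerD; last exact: (lC A).
  by rewrite normrZ mulrAC ler_wpM2r// (lK A).
Qed.

Lemma spline_family_lipschitz (d : nat) (e : nat -> R -> R) :
  (forall i, (i < d)%N -> spline G k (e i)) ->
  exists C, [/\ 0 <= C, forall i t, (i < d)%N -> I01 t -> `|e i t| <= C
    & forall i A s t, (i < d)%N -> atom G A -> A s -> A t -> `|e i s - e i t| <= C * `|s - t|].
Proof.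
elim: d => [|d IH] he; first by exists 0.
have [C [C0 bC lC]] : exists C, [/\ 0 <= C, forall i t, (i < d)%N -> I01 t -> `|e i t| <= C
    & forall i A s t, (i < d)%N -> atom G A -> A s -> A t -> `|e i s - e i t| <= C * `|s - t|].
  by apply: IH => i id; apply: he; rewrite ltnS ltnW.
have [K [K0 bK lK]] := spline_lipschitz hG (he d (ltnSn d)).
exists (K + C); split; first exact: addr_ge0.
- move=> i t; rewrite ltnS leq_eqVlt => /orP[/eqP ->|id] It.
    by apply: le_trans (bK t It) _; rewrite lerDl.
  by apply: le_trans (bC i t id It) _; rewrite lerDr.
- move=> i A s t; rewrite ltnS leq_eqVlt mulrDl => /orP[/eqP ->|id] aA As At.
    by apply: le_trans (lK A s t aA As At) _; rewrite lerDl mulr_ge0.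
  by apply: le_trans (lC i A s t id aA As At) _; rewrite lerDr mulr_ge0.
Qed.

Lemma tensor_sum_basis (X : normedModType R) d e (L : seq ((R -> R) * X)) :
  (forall h, spline G k h -> forall t, I01 t -> h t = \sum_(i < d) inner h (e i) * e i t) ->
  (forall x, x \in L -> spline G k x.1) -> forall t, I01 t ->
  \sum_(i < d) e i t *: coefficient L (e i) = tensor_sum L t.
Proof.
move=> eb hL t It; elim: L hL => [|x L IH] hL.
  rewrite /tensor_sum big_nil big1// => i _.
  by rewrite /coefficient big_nil scaler0.
rewrite /tensor_sum big_cons -/(tensor_sum L t) -IH; last first.
  by move=> y yL; apply: hL; rewrite inE yL orbT.
rewrite {1}(eb x.1 (hL x (mem_head _ _)) t It) scaler_suml -big_split/=.
apply: eq_bigr => i _.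
by rewrite /coefficient big_cons scalerDr scalerA mulrC.
Qed.

(** The list represents minus the projection of [tensor_sum L]; appending it to [L] cancels all
    coefficients against the basis. *)
Lemma coefficient_correction (X : normedModType R) d e (L : seq ((R -> R) * X)) j :
  orthonormal_family G k d e -> (j < d)%N ->
  coefficient [seq (e i, - coefficient L (e i)) | i <- iota 0 d] (e j) = - coefficient L (e j).
Proof.
move=> he jd; rewrite {1}/coefficient big_map/= -{1}(subn0 d) -/(index_iota 0 d) big_mkord.
rewrite (bigD1 (Ordinal jd))//= he.2// eqxx scale1r big1 ?addr0// => i ij.
by rewrite he.2// (_ : (i == j :> nat) = false) ?scale0r//; exact/negbTE.
Qed.

End splines_over_partition.

Lemma close_to_mono (R : realType) (X : normedModType R) (D : set X) r r' z z' :
  close_to D r z -> r + `|z' - z| <= r' -> close_to D r' z'.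
Proof.
move=> [y Dy zy] h; exists y => //; apply: lt_le_trans h.
rewrite -[z' - y](subrKA z) addrC; apply: le_lt_trans (ler_normD _ _) _.
by rewrite ltrD2r.
Qed.

Lemma small_factor (R : realType) (a b : R) : 0 <= a -> 0 < b -> exists2 h, 0 < h & a * h <= b.
Proof.
move=> a0 b0; have a1 : 0 < a + 1 by apply: ltr_wpDl.
exists (b / (a + 1)); first exact: divr_gt0.
rewrite mulrA ler_pdivrMr//; have := ltW b0; lra.
Qed.

(** * The next term of the martingale *)

Section extension.
Context (R : realType) (F : nat -> set (set R)) (k : nat) (X : completeNormedModType R).
Hypothesis hF : interval_filtration F.
Hypothesis k0 : (0 < k)%N.
Local Notation V := (accumulation_set F).
Local Notation m := (rmu (@lebesgue01 R)).
Local Notation G := (set_cdf V).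
Variables (D : set X) (delta C : R).
Hypothesis delta0 : 0 < delta.
Hypothesis nonD : nondentable D delta.
Hypothesis DC : forall x, D x -> `|x| <= C.
Hypothesis convD : forall x y a, 0 <= a -> a <= 1 -> D x -> D y -> D (a *: x + (1 - a) *: y).

(** The new spline is the old one plus the perturbation minus the projection of the perturbation, so
    its coefficients against the basis of level m0 are those of the old spline. *)
Lemma spline_extension m0 (L0 : seq ((R -> R) * X)) rho rho' eps :
  (forall x, x \in L0 -> spline (F m0) k x.1) -> rho < rho' -> 0 < eps ->
  (forall t, I01 t -> close_to D rho (tensor_sum L0 t)) ->
  exists m1 L1 E, [/\
    (m0 < m1)%N /\ (forall x, x \in L1 -> spline (F m1) k x.1),
    forall t, I01 t -> close_to D rho' (tensor_sum L1 t),
    [/\ measurable E, E `<=` V & m V - eps <= m E],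
    forall t, E t -> delta / 2 <= `|tensor_sum L1 t - tensor_sum L0 t|
  & exists2 PX, is_spline_projectionX (F m0) k PX &
      forall t, I01 t -> PX (tensor_sum L1) t = tensor_sum L0 t].
Proof.
move=> sL0 rho_lt eps0 fD.
have hG := filtration_partition hF m0.
have mV := measurable_accumulation_set F.
have [d [e [he eb]]] := spline_orthonormal_basis k hG.
have [K [K0 eK e_lip]] := spline_family_lipschitz hG he.1.
have [Cf [Cf0 _ f_lip]] := tensor_sum_lipschitz hG sL0.
have C0 : 0 <= C.
  have I0 : I01 (0 : R) by rewrite /I01/= in_itv/= lexx ler01.
  by have [y /DC Cy _] := fD 0 I0; exact: le_trans Cy.
pose M := 2 * C * K.
have M0 : 0 <= M by rewrite !mulr_ge0.
(* The distance to [D] grows by at most beta through the cells and by at most beta through the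
   correction; the second bound lets the jump keep delta / 2. *)
pose beta := Num.min ((rho' - rho) / 2) (delta / 2).
have beta0 : 0 < beta by rewrite lt_min !divr_gt0 ?subr_gt0.
have [brho bdelta] : beta <= (rho' - rho) / 2 /\ beta <= delta / 2.
  by rewrite /beta !ge_min !lexx orbT.
have dK0 : 0 <= d%:R * K by rewrite mulr_ge0.
(* The correction is at most d K (M eps3 + kappa), where eps3 bounds the excess measure of [U]; each
   summand is made to contribute at most beta / 2. *)
have [kap kap0 hkap] := small_factor dK0 (divr_gt0 beta0 (ltr0n R 2)).
pose kappa := Num.min kap eps.
have kappa0 : 0 < kappa by rewrite lt_min kap0.
have [kk ke] : kappa <= kap /\ kappa <= eps by rewrite /kappa !ge_min !lexx orbT.
have dKM0 : 0 <= d%:R * K * M by rewrite mulr_ge0.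
have [eps3 eps30 heps3] := small_factor dKM0 (divr_gt0 beta0 (ltr0n R 2)).
have [U [h0 [mU h00 mUV VU]]] := closed_neighborhood (closed_accumulation_set (F := F)) eps30.
pose L := Cf + K.
have L0' : 0 <= L by rewrite addr_ge0.
have [h1 h10 hh1] := small_factor L0' beta0.
have CL0 : 0 <= 2 * C * L by rewrite !mulr_ge0.
have [h2 h20 hh2] := small_factor CL0 (divr_gt0 kappa0 (ltr0n R 4)).
pose h := Num.min h0 (Num.min h1 h2).
have hpos : 0 < h by rewrite !lt_min h00 h10.
have [hh0 [hh1' hh2']] : h <= h0 /\ h <= h1 /\ h <= h2 by rewrite /h !ge_min !lexx !orbT.
have VsubU : V `<=` U by move=> x Vx; apply: (VU x) => //; rewrite subrr normr0.
have : strip F k U d e delta M kappa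
    (fun t w => close_to D (rho + beta) (tensor_sum L0 t + w)) 0 1.
  apply: (split_at_atoms hG hpos).
    move=> p r q p0 pr rq q1; exact: (strip_cat hF p0 (ltW pr) (ltW rq) q1).
  move=> p q A p0 pq q1 qph aA pqA.
  apply: (@cell_strip R F k hF k0 X U d e D delta C nonD DC convD m0 (tensor_sum L0)
    rho beta kappa K L h mU VsubU K0 C0 L0' (ltW hpos) kappa0 fD _ he.1 eK _ _ _
    p q A p0 pq q1 qph aA pqA).
  - move=> A' s t aA' As At; apply: le_trans (f_lip A' s t aA' As At) _.
    by rewrite ler_wpM2r// lerDl.
  - move=> i A' s t id aA' As At; apply: le_trans (e_lip i A' s t id aA' As At) _.
    by rewrite ler_wpM2r// lerDr.
  - by apply: le_trans hh1; rewrite ler_wpM2l.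
  - by rewrite mulrA; apply: le_trans hh2; rewrite ler_wpM2l.
  (* A cell in which V has positive measure contains a point of V, and it is shorter than the radius
     [h0] of the neighborhood. *)
  - move=> /(accumulation_point_between pq)[x Vx /andP[px xq]] t.
    rewrite /= in_itv/= => /andP[pt tq]; apply: (VU x) => //.
    by apply: lt_le_trans (le_trans qph hh0); rewrite ltr_norml; apply/andP; split; lra.
move=> [n [L1 [W [sL1 QL1 [mW W01 hW] mVW cL1]]]].
rewrite !set_cdf_total// subr0 mulr1 in mVW.
pose corr t := \sum_(i < d) e i t *: coefficient L1 (e i).
pose L2 := [seq (e i, - coefficient L1 (e i)) | i <- iota 0 d].
have L2E t : tensor_sum L2 t = - corr t.
  rewrite /tensor_sum /L2 big_map/= -{1}(subn0 d) -/(index_iota 0 d) big_mkord /corr -sumrN.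
  by apply: eq_bigr => i _; rewrite scalerN.
have corr_le t : I01 t -> `|corr t| <= beta.
  move=> It; apply: le_trans (ler_norm_sum _ _ _) _.
  apply: (@le_trans _ _ (\sum_(i < d) K * (M * eps3 + kappa))).
    apply: ler_sum => i _; rewrite normrZ; apply: ler_pM => //; first exact: eK.
    apply: le_trans (cL1 i (ltn_ord i)) _.
    rewrite !set_cdf_total// subr0 mulr1 lerD2r ler_wpM2l//.
    by move: mUV; rewrite -lerBlDl.
  rewrite sumr_const card_ord -mulr_natl.
  have : d%:R * K * kappa <= beta / 2 by apply: le_trans hkap; rewrite ler_wpM2l.
  have -> : d%:R * (K * (M * eps3 + kappa)) = d%:R * K * M * eps3 + d%:R * K * kappa by ring.
  by lra.
have gV t : I01 t -> close_to D (rho + beta) (tensor_sum L0 t + tensor_sum L1 t).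
  move=> It; have [->|/(QL1 t It)[_ //]] := eqVneq (tensor_sum L1 t) 0.
  by apply: close_to_mono (fD t It) _; rewrite addr0 subrr normr0 addr0 lerDl ltW.
have sumE t : tensor_sum (L0 ++ L1 ++ L2) t = tensor_sum L0 t + tensor_sum L1 t - corr t.
  by rewrite !tensor_sum_cat L2E addrA.
have sL : forall x, x \in L0 ++ L1 ++ L2 -> spline (F (maxn n m0).+1) k x.1.
  have nn : (n <= (maxn n m0).+1)%N by rewrite leqW// leq_maxl.
  have mm : (m0 <= (maxn n m0).+1)%N by rewrite leqW// leq_maxr.
  move=> x; rewrite !mem_cat => /or3P[/sL0|/sL1|/mapP[i]].
  - exact: spline_filtration.
  - exact: spline_filtration.
  - rewrite mem_iota add0n => /andP[_ id] ->; apply: (spline_filtration hF mm).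
    exact: he.1.
(* The maximum makes old and new splines available at one level; the successor makes the levels
   strictly increase. *)
exists (maxn n m0).+1, (L0 ++ L1 ++ L2), (V `&` W); split.
- by split => //; rewrite ltnS leq_maxr.
- move=> t It; rewrite sumE; apply: close_to_mono (gV t It) _.
  set a := tensor_sum L0 t + _; rewrite [a - _ - a]addrAC subrr add0r normrN.
 have := corr_le t It; lra.
- by split; [exact: measurableI|exact: subIsetl|apply: le_trans mVW; rewrite lerB].
- move=> t [Vt Wt]; have It := accumulation_set_I01 hF Vt.
  rewrite sumE -(addrA (tensor_sum L0 t)) [tensor_sum L0 t + _]addrC addrK.
  apply: le_trans (lerB_dist _ _); have := hW t Wt; have := corr_le t It; lra.
- have [PX [hPX PXE]] := projectionX_exists hG he eb X.
  exists PX => // t It; rewrite PXE.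
    rewrite -(tensor_sum_basis eb sL0 It); apply: eq_bigr => i _.
    by rewrite !coefficient_cat (coefficient_correction _ he)// subrr addr0.
  move=> x /sL; apply: spline_L1R; exact: filtration_partition.
Qed.

End extension.

Lemma close_to_norm (R : realType) (X : normedModType R) (D : set X) (r C : R) z :
  (forall x, D x -> `|x| <= C) -> r <= 1 -> close_to D r z -> `|z| <= C + 1.
Proof.
move=> DC r1 [y /DC Cy zy]; rewrite -[z](subrK y).
apply: le_trans (ler_normD _ _) _; rewrite addrC lerD//.
exact/ltW/(lt_le_trans zy).
Qed.

Theorem theorem1p10 (R : realType) (X : completeNormedModType R)
    (F : nat -> set (set R)) (k : nat) :
  ~ RNP X -> interval_filtration F -> (0 < k)%N ->
  exists2 delta : R, 0 < delta &
  forall eta : R, 0 < eta < 1 ->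
  exists (m : nat -> nat) (f : nat -> R -> X) (E : nat -> set R),
    [/\ (forall j, 0 < m j)%N /\ (forall j, m j < m j.+1)%N,
        LinftyX_bounded f,
        martingale_spline_sequence (fun j => F (m j)) k f,
        forall j, spline_tensor (F (m j)) k (f j)
      & forall n, (1 <= n)%N ->
        [/\ measurable (E n), E n `<=` accumulation_set F,
            ((1 - 2 ^- n * eta)%:E * lebesgue_measure (accumulation_set F)
               <= lebesgue_measure (E n))%E
          & forall t, E n t -> delta <= `|f n t - f n.-1 t|]].
Proof.
move=> nRNP hF k0.
have [D [delta [C [delta0 [x0 Dx0] DC convD nonD]]]] := not_RNP_nondentable nRNP.
exists (delta / 2); first by rewrite divr_gt0.
move=> eta /andP[eta0 eta1].
set V := accumulation_set F.
have mV : measurable V := measurable_accumulation_set F.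
have VI : V `<=` @I01 R := accumulation_set_I01 hF.
pose v := rmu (@lebesgue01 R) V.
have v0 : 0 <= v by exact: rmu_ge0.
(* Strictly increasing, which leaves room at every stage, and below 1, which bounds the whole
   sequence by C + 1. It is already positive for n = 0, as the strict inequality in [close_to]
   requires. *)
pose rho n : R := 1 - 2 ^- n.+1.
have pow0 n : 0 < 2 ^- n :> R by rewrite invr_gt0 exprn_gt0.
have powS n : 2 ^- n = 2 * 2 ^- n.+1 :> R by rewrite exprS invfM mulrA divff// mul1r.
have rhoS n : rho n < rho n.+1 by rewrite /rho (powS n.+1); have := pow0 n.+2; lra.
(* The set produced at stage n is [E] of n + 1, hence the exponent. If V is null the required
   estimate is trivial, but the extension still needs a positive tolerance. *)
pose eps n : R := if v == 0 then 1 else 2 ^- n.+1 * eta * v.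
have eps0 n : 0 < eps n.
  rewrite /eps; case: (eqVneq v 0) => // vn; rewrite !mulr_gt0//.
  by rewrite lt_neqAle eq_sym vn.
pose state := (nat * seq ((R -> R) * X) * set R)%type.
pose good n (s : state) := [/\ (0 < s.1.1)%N, forall x, x \in s.1.2 -> spline (F s.1.1) k x.1
  & forall t, I01 t -> close_to D (rho n) (tensor_sum s.1.2 t)].
pose next n (s s' : state) := [/\ (s.1.1 < s'.1.1)%N,
  [/\ measurable s'.2, s'.2 `<=` V & v - eps n <= rmu (@lebesgue01 R) s'.2],
  forall t, s'.2 t -> delta / 2 <= `|tensor_sum s'.1.2 t - tensor_sum s.1.2 t|
  & exists2 PX, is_spline_projectionX (F s.1.1) k PX &
      forall t, I01 t -> PX (tensor_sum s'.1.2) t = tensor_sum s.1.2 t].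
have /choice[g hg] : forall ns : nat * state, exists s', good ns.1 ns.2 ->
    good ns.1.+1 s' /\ next ns.1 ns.2 s'.
  move=> [n s]; have [[s0 sL sD]|ng] := pselect (good n s); last by exists s => /ng.
  have [m1 [L1 [E [[m01 sL1] L1D EV jump PXL]]]] :=
    spline_extension hF k0 delta0 nonD DC convD sL (rhoS n) (eps0 n) sD.
  by exists (m1, L1, E) => _; split; split => //=; rewrite (leq_trans _ m01).
(* The sequence starts at the constant function with value [x0] in [D], at level 1 because the [m j]
   have to be positive. *)
pose s0 : state := (1%N, [:: (fun=> 1, x0)], set0).
pose s := fix s n : state := if n is n'.+1 then g (n', s n') else s0.
have good_s n : good n (s n).
  elim: n => [|n IH]; last exact: (hg (n, s n) IH).1.
  split => //= [x|t It]; first by rewrite inE => /eqP ->; exact: spline_cst.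
  exists x0 => //; rewrite /tensor_sum big_seq1/= scale1r subrr normr0 /rho expr1.
  by rewrite subr_gt0 invf_lt1// ltr1n.
have next_s n : next n (s n) (s n.+1) := (hg (n, s n) (good_s n)).2.
have L1f n : L1X01 (tensor_sum (s n).1.2).
  apply: L1X01_tensor_sum => x xs; have [_ /(_ x xs) sx _] := good_s n.
  exact: (spline_L1R (filtration_partition hF _) sx).
exists (fun n => (s n).1.1), (fun n => tensor_sum (s n).1.2), (fun n => (s n).2); split.
- split => n; first by case: (good_s n).
  by case: (next_s n).
- split; first by move=> n; exact: (L1f n).1.
  exists (C + 1) => n; apply: aeW => t It; have [_ _ /(_ t It)] := good_s n.
  by apply: close_to_norm => //; rewrite /rho lerBlDr lerDl ltW.
- split => // n; have [_ _ _ [PX hPX hE]] := next_s n.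
  by exists PX => //; apply: aeW => t It; exact: hE.
- move=> n; have [_ sL _] := good_s n.
  have L_th (i : 'I_(size (s n).1.2)) : nth (fun=> 0, 0) (s n).1.2 i \in (s n).1.2.
    exact: mem_nth.
  exists (size (s n).1.2), (fun i => (nth (fun=> 0, 0) (s n).1.2 i).1),
    (fun i => (nth (fun=> 0, 0) (s n).1.2 i).2); split.
    by move=> i; exact: sL.
  by move=> t It; rewrite /tensor_sum (big_nth (fun=> 0, 0)) big_mkord.
- case=> // n _; have [_ [mE EV vE] jump _] := next_s n; split => //.
  rewrite (lebesgue01E mV VI) (lebesgue01E mE (subset_trans EV VI)) -EFinM lee_fin.
  move: vE; rewrite /eps -/v; case: eqP => [->|_] vE; first by rewrite mulr0 rmu_ge0.
  by apply: le_trans vE; rewrite mulrBl mul1r.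
Qed.
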